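(* Let $K$ be a field of characteristic $0$ and $G$ a finite abelian group. (i) The graded space $\mathring{\mathcal P}(G)=\bigoplus_{n\in\mathbb{N}}\mathring{\mathcal P}_n(G)$ is a subalgebra of $(\Sigma(G),* )$, freely generated by $\{\mathring p^{\,G}_{(n)^g}: g\in G,\ n\text{ odd}\}$. (ii) The graded algebra $\mathring{\mathcal P}(G)$ is a Hopf subalgebra of $(\Sigma(G),*,\Delta)$. Moreover, the assignment $G\rightsquigarrow\mathring{\mathcal P}(G)$ is a covariant functor from the category of finite abelian groups to the category of graded connected Hopf algebras (a homomorphism $f:G\to G'$ acting by the restriction of $f_*:\sigma^{\mathbf g}\mapsto\sigma^{f(\mathbf g)}$).
   Context: $G_n=G^n\rtimes\mathfrak S_n$ is the wreath product; its elements are written $\sigma^{\mathbf g}=\sigma\cdot(g_1,\dots,g_n)$ and identified with coloured words $\sigma(1)^{g_1}\cdots\sigma(n)^{g_n}$; multiplication is determined by $\sigma\cdot(g_1,\dots,g_n)=(g_{\sigma^{-1}(1)},\dots,g_{\sigma^{-1}(n)})\cdot\sigma$; $\mathfrak S_n\subseteq G_n$ via trivial colours. Hopf algebra $K[\mathsf G]=\bigoplus_{n\ge0}KG_n$: for $\sigma\in\mathfrak S_n$, $\tau\in\mathfrak S_m$, $\sigma\times\tau\in\mathfrak S_{n+m}$ maps $a\in[1,n]$ to $\sigma(a)$ and $n+b$ to $n+\tau(b)$; $\sigma^{\mathbf g}\times\tau^{\mathbf h}=(\sigma\times\tau)^{\mathbf g\cdot\mathbf h}$. $X_{(n,m)}$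 is the set of $u\in\mathfrak S_{n+m}$ increasing on $[1,n]$ and on $[n+1,n+m]$. For $\alpha\in G_n$, $\beta\in G_m$: $\alpha*\beta=\sum_{u\in X_{(n,m)}}u(\alpha\times\beta)$. For $\alpha\in G_n$ and $i\in[0,n]$ let $\alpha_{(i)}\in G_i$, $\alpha_{(n-i)}\in G_{n-i}$ be the unique elements with $\alpha^{-1}=u(\alpha_{(i)}\times\alpha_{(n-i)})^{-1}$ for some $u\in X_{(i,n-i)}$; $\Delta(\alpha)=\sum_{i=0}^n\alpha_{(i)}\otimes\alpha_{(n-i)}$. With these, $K[\mathsf G]$ is known to be a graded connected Hopf algebra, functorial in $G$ via $f_*(\sigma^{\mathbf g})=\sigma^{f(\mathbf g)}$, $f(\mathbf g)=(f(g_1),\dots,f(g_n))$. The rainbow decomposition of $\sigma^{\mathbf g}$ is the unique factorization $\sigma_1^{g_1}\cdots\sigma_k^{g_k}$ of the coloured word into nonempty monochromatic words with $g_i\ne g_{i+1}$. $\mathrm{std}(w)$ for $w=a_1\cdots a_n$ is the unique $\sigma\in\mathfrak S_n$ with, for $i<j$, $\sigma(i)>\sigma(j)\iff a_i>a_j$. For $I=\{i_1<\dots<i_k\}\subseteq[1,n-1]$, $\mathbf c_I=(i_1,i_2-i_1,\dots,n-i_k)$. For $\sigma\in\mathfrak S_n$: $D(\sigma)=\mathbf c_I$ with $I=\{i\in[1,n-1]:\sigma(i)>\sigma(i+1)\}$, and $\mathring P(\sigma)=\mathbf c_I$ with $I=\{i\in[1,n-1]:i>1,\ \sigma(i-1)<\sigma(i)>\sigma(i+1)\}$;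 for words, $D(w)=D(\mathrm{std}(w))$, $\mathring P(w)=\mathring P(\mathrm{std}(w))$. For a composition $\mathbf c=(c_1,\dots,c_r)$ and $g\in G$, $\mathbf c^g=c_1^g\cdots c_r^g$; a $G$-composition of $n$ is a word in letters $c^g$ ($c\ge1$, $g\in G$) with integers summing to $n$. Put $D_G(\sigma^{\mathbf g})=D(\sigma_1)^{g_1}\cdots D(\sigma_k)^{g_k}$ and $\mathring P_G(\sigma^{\mathbf g})=\mathring P(\sigma_1)^{g_1}\cdots\mathring P(\sigma_k)^{g_k}$ (concatenations). Set $d^G_{\mathbf c^{\mathbf g}}=\sum_{D_G(\alpha)=\mathbf c^{\mathbf g}}\alpha$, $\mathring p^{\,G}_{\mathbf c^{\mathbf g}}=\sum_{\mathring P_G(\alpha)=\mathbf c^{\mathbf g}}\alpha$ in $KG_n$. $\Sigma(G)\subseteq K[\mathsf G]$ is the graded span of all $d^G_{\mathbf c^{\mathbf g}}$ (the Mantaci-Reutenauer Hopf algebra, known to be a Hopf subalgebra of $K[\mathsf G]$), and $\mathring{\mathcal P}_n(G)$ is the $K$-span of the $\mathring p^{\,G}_{\mathbf c^{\mathbf g}}$ in degree $n$. *)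

(* Defs.v *)
From HB Require Import structures.
From mathcomp Require Import all_boot all_order all_algebra all_fingroup.
From mathcomp Require Import finmap zify.
From mathcomp.multinomials Require Export monalg.

Set Implicit Arguments.
Unset Strict Implicit.
Unset Printing Implicit Defensive.

Import GRing.Theory.
Local Open Scope ring_scope.

(* Linear algebra over free modules {malg K[T]}.  The tensor product of       *)
(* {malg K[T]} and {malg K[U]} is {malg K[T * U]}; since K is a field, the    *)
(* tensor product of two subspaces embeds in it as the span of the pure       *)
(* tensors [tens x y].  A linear map out of {malg K[T]} is given by its       *)
(* values f : T -> V on the basis, and is then applied through [lext f].      *)

Section LinearAlgebra.
Context {K : fieldType}.

Definition lext {T : choiceType} {V : lmodType K} (f : T -> V)
    (x : {malg K[T]}) : V :=
  \sum_(a <- msupp x) x@_a *: f a.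

Definition lext2 {T U : choiceType} {V : lmodType K} (f : T -> U -> V)
    (x : {malg K[T]}) (y : {malg K[U]}) : V :=
  lext (fun a => lext (f a) y) x.

Definition tens {T U : choiceType} (x : {malg K[T]}) (y : {malg K[U]}) :
    {malg K[(T * U)%type]} :=
  lext2 (fun a b => << (a, b) >>) x y.

Definition subspace {V : lmodType K} (A : V -> Prop) : Prop :=
  A 0 /\ forall (c : K) (x y : V), A x -> A y -> A (c *: x + y).

Definition span {V : lmodType K} (S : V -> Prop) (x : V) : Prop :=
  exists s : seq (K * V),
    (forall p, p \in s -> S p.2) /\ x = \sum_(p <- s) p.1 *: p.2.

Definition gsum {V : lmodType K} (W : nat -> V -> Prop) (x : V) : Prop :=
  exists (n : nat) (y : nat -> V),
    (forall i, W i (y i)) /\ x = \sum_(i < n) y i.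

Definition gdirect {V : lmodType K} (W : nat -> V -> Prop) : Prop :=
  forall (n : nat) (y : nat -> V), (forall i, W i (y i)) ->
    \sum_(i < n) y i = 0 -> forall i, (i < n)%N -> y i = 0.

End LinearAlgebra.

(* The underlying graded space of the Hopf algebra is the sum of the          *)
(* subspaces [hgr n] of the free module on [hidx]; it may be proper.  The     *)
(* operations are restrictions of linear maps on the free modules, given on   *)
(* the basis, and the axioms are only required on the underlying space.       *)

Record hopf_data (K : fieldType) := HopfData {
  hidx : choiceType;
  hmulb : hidx -> hidx -> {malg K[hidx]};
  hone : {malg K[hidx]};
  hdeltab : hidx -> {malg K[(hidx * hidx)%type]};
  hepsb : hidx -> K;
  hgr : nat -> {malg K[hidx]} -> Prop
}.

Section Hopf.
Context {K : fieldType}.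
Implicit Types H : hopf_data K.

Definition hspace H := {malg K[hidx H]}.

Definition carrier H : hspace H -> Prop := gsum (@hgr K H).

Definition hmul H (x y : hspace H) : hspace H := lext2 (@hmulb K H) x y.

Definition hdelta H (x : hspace H) : {malg K[(hidx H * hidx H)%type]} :=
  lext (@hdeltab K H) x.

Definition heps H (x : hspace H) : K := lext (fun a => @hepsb K H a : K^o) x.

(* (a (x) b)(c (x) d) = ac (x) bd *)
Definition hmul_tens H (X Y : {malg K[(hidx H * hidx H)%type]}) :
    {malg K[(hidx H * hidx H)%type]} :=
  lext2 (fun p q => tens (@hmulb K H p.1 q.1) (@hmulb K H p.2 q.2)) X Y.

Definition tens_assoc (T : choiceType) (X : {malg K[((T * T) * T)%type]}) :
    {malg K[(T * (T * T))%type]} :=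
  lext (fun p => << (p.1.1, (p.1.2, p.2)) >>) X.

Definition antipode H (S : hidx H -> hspace H) : Prop :=
  forall x : hspace H, carrier x ->
    [/\ carrier (lext S x),
        lext (fun p => hmul (S p.1) << p.2 >>) (hdelta x) = heps x *: hone H
      & lext (fun p => hmul << p.1 >> (S p.2)) (hdelta x) = heps x *: hone H].

Record gc_hopf H : Prop := GCHopf {
  gc_subspace : forall n, subspace (@hgr K H n);
  gc_direct : gdirect (@hgr K H);
  gc_one : @hgr K H 0%N (hone H);
  gc_mul : forall i j (x y : hspace H),
    hgr i x -> hgr j y -> hgr (i + j)%N (hmul x y);
  gc_mulA : forall x y z : hspace H, carrier x -> carrier y -> carrier z ->
    hmul x (hmul y z) = hmul (hmul x y) z;
  gc_mul1x : forall x : hspace H, carrier x -> hmul (hone H) x = x;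
  gc_mulx1 : forall x : hspace H, carrier x -> hmul x (hone H) = x;
  gc_delta : forall n (x : hspace H), hgr n x ->
    span (fun t => exists i j (y z : hspace H),
            [/\ (i + j)%N = n, hgr i y, hgr j z & t = tens y z]) (hdelta x);
  gc_deltaA : forall x : hspace H, carrier x ->
    tens_assoc (lext (fun p => tens (hdeltab p.1) << p.2 >>) (hdelta x)) =
    lext (fun p => tens << p.1 >> (hdeltab p.2)) (hdelta x);
  gc_eps : forall n (x : hspace H), (0 < n)%N -> hgr n x -> heps x = 0;
  gc_counitl : forall x : hspace H, carrier x ->
    lext (fun p => hepsb p.1 *: << p.2 >>) (hdelta x) = x;
  gc_counitr : forall x : hspace H, carrier x ->
    lext (fun p => hepsb p.2 *: << p.1 >>) (hdelta x) = x;
  gc_delta1 : hdelta (hone H) = tens (hone H) (hone H);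
  gc_deltaM : forall x y : hspace H, carrier x -> carrier y ->
    hdelta (hmul x y) = hmul_tens (hdelta x) (hdelta y);
  gc_eps1 : heps (hone H) = 1;
  gc_epsM : forall x y : hspace H, carrier x -> carrier y ->
    heps (hmul x y) = heps x * heps y;
  gc_connected : forall x : hspace H, hgr 0%N x -> exists c : K, x = c *: hone H;
  gc_antipode : exists S, antipode (H := H) S
}.

Record hopf_morphism H H' (f : hidx H -> hspace H') : Prop := HopfMorphism {
  hm_gr : forall n (x : hspace H), hgr n x -> hgr n (lext f x);
  hm_one : lext f (hone H) = hone H';
  hm_mul : forall x y : hspace H, carrier x -> carrier y ->
    lext f (hmul x y) = hmul (lext f x) (lext f y);
  hm_delta : forall x : hspace H, carrier x ->
    hdelta (lext f x) = lext (fun p => tens (f p.1) (f p.2)) (hdelta x);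
  hm_eps : forall x : hspace H, carrier x -> heps (lext f x) = heps x
}.

Definition subalgebra H (A : hspace H -> Prop) : Prop :=
  [/\ forall x, A x -> carrier x, subspace A, A (hone H)
    & forall x y, A x -> A y -> A (hmul x y)].

(* A bialgebra has at most one antipode, so S below is the antipode of H; its *)
(* existence is not part of the definition and is supplied, for a Hopf        *)
(* algebra, by [gc_antipode].                                                 *)
Definition hopf_subalgebra H (A : hspace H -> Prop) : Prop :=
  [/\ subalgebra A,
      forall x, A x ->
        span (fun t => exists y z, [/\ A y, A z & t = tens y z]) (hdelta x)
    & forall S, antipode S -> forall x, A x -> A (lext S x)].

(* The free associative algebra on I is the monoid algebra of the free monoid *)
(* {fmonom I}; [free_eval p] substitutes p i for the generator i.             *)
Definition free_eval H (I : choiceType) (p : I -> hspace H)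
    (F : {malg K[{fmonom I}]}) : hspace H :=
  lext (fun w : {fmonom I} =>
          foldr (fun i x => hmul (p i) x) (hone H) (fmonom_val w)) F.

Definition freely_generated_by H (A : hspace H -> Prop)
    (I : choiceType) (p : I -> hspace H) : Prop :=
  injective (free_eval p) /\ forall x, A x <-> exists F, free_eval p F = x.

(* The source category is that of finite abelian groups; F and Fmap are the   *)
(* object and arrow maps.                                                     *)
Record hopf_functor (F : finGroupType -> hopf_data K)
    (Fmap : forall G G' : finGroupType,
       (G -> G') -> hidx (F G) -> hspace (F G')) : Prop := HopfFunctor {
  hf_obj : forall G : finGroupType, abelian [set: G] -> gc_hopf (F G);
  hf_mor : forall (G G' : finGroupType) (f : G -> G'),
    abelian [set: G] -> abelian [set: G'] ->
    {morph f : x y / (x * y)%g} -> hopf_morphism (Fmap G G' f);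
  hf_id : forall G : finGroupType, abelian [set: G] ->
    forall x : hspace (F G), carrier x -> lext (Fmap G G id) x = x;
  hf_comp : forall (G G' G'' : finGroupType) (f : G -> G') (f' : G' -> G''),
    abelian [set: G] -> abelian [set: G'] -> abelian [set: G''] ->
    {morph f : x y / (x * y)%g} -> {morph f' : x y / (x * y)%g} ->
    forall x : hspace (F G), carrier x ->
      lext (Fmap G G'' (f' \o f)) x = lext (Fmap G' G'' f') (lext (Fmap G G' f) x)
}.

End Hopf.

Record wreath (gT : finGroupType) (n : nat) :=
  Wreath { wperm : 'S_n; wcol : {ffun 'I_n -> gT} }.

Section WreathGroup.
Context (gT : finGroupType) (n : nat).
Implicit Types a b : wreath gT n.

Definition wreath_pair a := (wperm a, wcol a).
Definition pair_wreath (p : 'S_n * {ffun 'I_n -> gT}) := Wreath p.1 p.2.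
Lemma wreath_pairK : cancel wreath_pair pair_wreath. Proof. by case. Qed.
HB.instance Definition _ := Finite.copy (wreath gT n) (can_type wreath_pairK).

(* s.(g_1,..,g_n).t.(h_1,..,h_n) = (s o t).(g_t(1) h_1,..,g_t(n) h_n).  The   *)
(* library multiplies permutations from left to right: (t * s) i = s (t i).   *)
Definition wreath_mul a b : wreath gT n :=
  Wreath (wperm b * wperm a)%g [ffun i => (wcol a (wperm b i) * wcol b i)%g].
Definition wreath_one : wreath gT n := Wreath 1%g [ffun=> 1%g].
Definition wreath_inv a : wreath gT n :=
  Wreath (wperm a)^-1%g [ffun i => ((wcol a ((wperm a)^-1%g i))^-1)%g].

Lemma wreath_mulA : associative wreath_mul.
Proof.
move=> a b c; rewrite /wreath_mul /= mulgA; congr Wreath.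
by apply/ffunP=> i; rewrite !ffunE /= permM mulgA.
Qed.

Lemma wreath_mul1 : left_id wreath_one wreath_mul.
Proof.
case=> s g; rewrite /wreath_mul /= mulg1; congr Wreath.
by apply/ffunP=> i; rewrite !ffunE mul1g.
Qed.

Lemma wreath_mulV : left_inverse wreath_one wreath_inv wreath_mul.
Proof.
case=> s g; rewrite /wreath_mul /= mulgV; congr Wreath.
by apply/ffunP=> i; rewrite !ffunE permK mulVg.
Qed.

HB.instance Definition _ := Finite_isGroup.Build (wreath gT n)
  wreath_mulA wreath_mul1 wreath_mulV.

Definition perm_wreath (u : 'S_n) : wreath gT n := Wreath u [ffun=> 1%g].

End WreathGroup.

Section Cross.
Context (n m : nat).

Definition cross_fun (s : 'S_n) (t : 'S_m) (k : 'I_(n + m)%N) : 'I_(n + m)%N :=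
  match split k with inl i => lshift m (s i) | inr j => rshift n (t j) end.

Lemma cross_fun_inj s t : injective (cross_fun s t).
Proof.
move=> k l; rewrite /cross_fun.
case: split_ordP => i ->; case: split_ordP => j ->; move/eqP.
- by rewrite eq_lshift => /eqP/perm_inj ->.
- by rewrite eq_lrshift.
- by rewrite eq_rlshift.
- by rewrite eq_rshift => /eqP/perm_inj ->.
Qed.

Definition cross_perm (s : 'S_n) (t : 'S_m) : 'S_(n + m)%N :=
  perm (@cross_fun_inj s t).

Definition cross (gT : finGroupType) (a : wreath gT n) (b : wreath gT m) :
    wreath gT (n + m)%N :=
  Wreath (cross_perm (wperm a) (wperm b))
    [ffun k => match split k with inl i => wcol a i | inr j => wcol b j end].

Definition shuffles : {set 'S_(n + m)%N} :=
  [set u : 'S_(n + m)%N | [forall k : 'I_(n + m)%N, forall l : 'I_(n + m)%N,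
     (k < l)%N && ((l < n)%N || (n <= k)%N) ==> (u k < u l)%N]].

End Cross.

Definition colperm (gT : finGroupType) : choiceType := {n : nat & wreath gT n}.

Definition colp (gT : finGroupType) (n : nat) (a : wreath gT n) : colperm gT :=
  Tagged (wreath gT) a.

Section KG.
Context (K : fieldType) (gT : finGroupType).
Local Notation KG := {malg K[colperm gT]}.

Definition KG_mulb (a b : colperm gT) : KG :=
  \sum_(u in shuffles (tag a) (tag b))
     << colp (perm_wreath gT u * cross (tagged a) (tagged b))%g >>.

(* For each i exactly one pair (b, c) satisfies the condition; equality of    *)
(* tagged elements avoids a cast from degree i + (n - i) to degree n.         *)
Definition KG_deltab (a : colperm gT) :
    {malg K[(colperm gT * colperm gT)%type]} :=
  \sum_(i < (tag a).+1) \sum_(b : wreath gT i)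
    \sum_(c : wreath gT (tag a - i)%N |
            [exists u in shuffles i (tag a - i)%N,
               colp ((tagged a)^-1)%g ==
               colp (perm_wreath gT u * (cross b c)^-1)%g])
      << (colp b, colp c) >>.

Definition KG_one : KG := << colp (1%g : wreath gT 0) >>.

Definition KG_epsb (a : colperm gT) : K := (tag a == 0%N)%:R.

(* The operations of K[G], on the graded subspace with components W. *)
Definition KG_hopf (W : nat -> KG -> Prop) : hopf_data K :=
  HopfData KG_mulb KG_one KG_deltab KG_epsb W.

End KG.

Definition KG_map (K : fieldType) (gT gT' : finGroupType) (f : gT -> gT')
    (a : colperm gT) : {malg K[colperm gT']} :=
  << colp (Wreath (wperm (tagged a)) [ffun i => f (wcol (tagged a) i)]) >>.

(* 1-based: the word s(1)...s(n) in the letters 1..n, and its letter s(i).    *)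
Definition one_line (n : nat) (s : 'S_n) : seq nat :=
  [seq (s i).+1 | i <- enum 'I_n].

Definition letter (n : nat) (s : 'S_n) (i : nat) : nat :=
  nth 0%N (one_line s) i.-1.

(* For I = [:: i_1; ..; i_k] increasing: (i_1, i_2 - i_1, .., n - i_k). *)
Definition comp_of (n : nat) (I : seq nat) : seq nat :=
  pairmap (fun a b => (b - a)%N) 0%N (rcons I n).

Definition descent_comp (n : nat) (s : 'S_n) : seq nat :=
  comp_of n [seq i <- iota 1 n.-1 | (letter s i > letter s i.+1)%N].

Definition peak_comp (n : nat) (s : 'S_n) : seq nat :=
  comp_of n [seq i <- iota 1 n.-1 |
    [&& (1 < i)%N, (letter s i.-1 < letter s i)%N
      & (letter s i > letter s i.+1)%N]].

Definition is_std (w : seq nat) (s : 'S_(size w)) : bool :=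
  [forall i : 'I_(size w), forall j : 'I_(size w), (i < j)%N ==>
     ((s i > s j)%N == (nth 0%N w i > nth 0%N w j)%N)].

Definition std (w : seq nat) : 'S_(size w) :=
  odflt 1%g [pick s : 'S_(size w) | is_std s].

Definition descent_word (w : seq nat) : seq nat := descent_comp (std w).
Definition peak_word (w : seq nat) : seq nat := peak_comp (std w).

Section Coloured.
Context {gT : finGroupType}.

Definition coloured_word (n : nat) (a : wreath gT n) : seq (nat * gT) :=
  [seq ((wperm a i).+1, wcol a i) | i <- enum 'I_n].

Fixpoint rainbow (w : seq (nat * gT)) : seq (seq nat * gT) :=
  if w is x :: w' then
    if rainbow w' is (v, h) :: r then
      if x.2 == h then (x.1 :: v, h) :: r
      else ([:: x.1], x.2) :: (v, h) :: r
    else [:: ([:: x.1], x.2)]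
  else [::].

Definition colour (v : seq nat) (g : gT) : seq (nat * gT) :=
  [seq (c, g) | c <- v].

Definition D_G (n : nat) (a : wreath gT n) : seq (nat * gT) :=
  flatten [seq colour (descent_word b.1) b.2 | b <- rainbow (coloured_word a)].

Definition P_G (n : nat) (a : wreath gT n) : seq (nat * gT) :=
  flatten [seq colour (peak_word b.1) b.2 | b <- rainbow (coloured_word a)].

Definition weight (c : seq (nat * gT)) : nat := sumn (unzip1 c).

Definition is_Gcomp (n : nat) (c : seq (nat * gT)) : bool :=
  all (fun x => 0 < x.1)%N c && (weight c == n).

End Coloured.

Section Span.
Context (K : fieldType) (gT : finGroupType).
Local Notation KG := {malg K[colperm gT]}.

Definition d_G (c : seq (nat * gT)) : KG :=
  \sum_(a : wreath gT (weight c) | D_G a == c) << colp a >>.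

Definition p_G (c : seq (nat * gT)) : KG :=
  \sum_(a : wreath gT (weight c) | P_G a == c) << colp a >>.

Definition Sigma_gr (n : nat) : KG -> Prop :=
  span (fun x => exists2 c, is_Gcomp n c & x = d_G c).

Definition Peak_gr (n : nat) : KG -> Prop :=
  span (fun x => exists2 c, is_Gcomp n c & x = p_G c).

Definition Sigma_hopf : hopf_data K := KG_hopf Sigma_gr.
Definition Peak_hopf : hopf_data K := KG_hopf Peak_gr.

Definition Peak : KG -> Prop := gsum Peak_gr.

Definition odd_peak (i : {n : nat | odd n} * gT) : KG :=
  p_G [:: (val i.1, i.2)].

End Span.

Lemma rainbowP (gT : finGroupType) (w : seq (nat * gT)) :
  [/\ flatten [seq colour b.1 b.2 | b <- rainbow w] = w,
      all (fun b => b.1 != [::]) (rainbow w)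
    & sorted (fun b b' => b.2 != b'.2) (rainbow w)].
Proof.
elim: w => [//|[x g] w [/=]].
case: (rainbow w) => [|[v h] r] /= <-; first by split.
move=> /andP[v0 r0] rs; case: eqVneq => [->|ngh] /=; split=> //.
- by case: r r0 rs.
- by rewrite v0 r0.
- by rewrite ngh.
Qed.

Lemma std_exists (w : seq nat) : exists s : 'S_(size w), is_std s.
Proof.
pose lt (i j : 'I_(size w)) :=
  (nth 0%N w i < nth 0%N w j)%N || (nth 0%N w i == nth 0%N w j) && (i < j)%N.
pose r (i : 'I_(size w)) := #|[set j | lt j i]|.
have ltirr i : lt i i = false by rewrite /lt !ltnn andbF.
have lttrans : transitive lt by rewrite /lt => j i k; lia.
have r_lt i : (r i < size w)%N.
  rewrite -[X in (_ < X)%N]card_ord -cardsT; apply: proper_card.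
  by apply/properP; split; [exact: subsetT | exists i; rewrite ?inE ?ltirr].
have rmono i j : lt i j -> (r i < r j)%N.
  move=> lij; apply: proper_card; apply/properP; split.
    by apply/subsetP=> k; rewrite !inE => /lttrans; apply.
  by exists i; rewrite inE ?ltirr.
have tot (i j : 'I_(size w)) : (i < j)%N -> lt j i = (nth 0%N w j < nth 0%N w i)%N.
  by rewrite /lt; lia.
have tot2 (i j : 'I_(size w)) : (i < j)%N -> lt i j = ~~ (nth 0%N w j < nth 0%N w i)%N.
  by rewrite /lt; lia.
have rE (i j : 'I_(size w)) : (i < j)%N -> (r j < r i)%N = (nth 0%N w j < nth 0%N w i)%N.
  move=> ij; rewrite -tot //; apply/idP/idP; last exact: rmono.
  apply: contraLR; rewrite tot // => nji; rewrite -leqNgt ltnW //.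
  by apply: rmono; rewrite tot2.
have rinj : injective (fun i => Ordinal (r_lt i)).
  move=> i j [] eqr; apply: val_inj; case: (ltngtP i j) => // ij.
    have [|] := boolP (lt j i); first by move/rmono; rewrite eqr ltnn.
    by rewrite tot // -tot2 // => /rmono; rewrite eqr ltnn.
  have [|] := boolP (lt i j); first by move/rmono; rewrite eqr ltnn.
  by rewrite tot // -tot2 // => /rmono; rewrite eqr ltnn.
exists (perm rinj); apply/forallP=> i; apply/forallP=> j.
by apply/implyP=> ij; rewrite !permE /= rE.
Qed.

Lemma stdP (w : seq nat) : is_std (std w).
Proof.
rewrite /std; case: pickP => [s //|ns].
by have [s] := std_exists w; rewrite ns.
Qed.

(* Main.v *)
From HB Require Import structures.
From mathcomp Require Import all_boot all_order all_algebra all_fingroup.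
From mathcomp Require Import finmap zify ring.
Require Import Defs.

(** An element x of K[G] is regarded as a function on coloured words: [cf x w]
    is its coefficient at the standardization of w.  In this dual picture the
    product becomes deconcatenation, (x * y)(w) being the sum of x(u) y(v) over
    the factorizations w = uv ([cf_mul]), and the coproduct becomes shuffling:
    its coefficient at (u, v), where the letters of u are smaller than those of
    v, is the sum of x(w) over the shuffles w of u and v ([mcoeff_delta]).  The
    bialgebra axioms then express that words can be cut in three parts in a
    well-defined way and that cutting is compatible with shuffling
    ([shuf_splits]).

    The peak composition of a coloured word amounts to a flag on each position
    ([pdat]): a position is flagged if a colour run ends there or if it is an
    inner peak of its run.  Flags are local, so those of a word determine those
    of its prefixes and suffixes ([pdat_take], [pdat_drop]).  Hence the
    functions that only depend on the flags, which are the linear combinations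
    of the peak sums ([PeakP]), are closed under the product; they lie in
    Sigma(G) because descents determine peaks.

    Let q_n be the peak sum of the composition with the single part n of colour
    g.  It is the indicator function of the words of length n and colour g that
    first decrease strictly and then increase weakly.  If Lambda(t) and S(t)
    denote the generating series of the decreasing and of the increasing words,
    then Q(t) = 1 + 2 q_1 t + 2 q_2 t^2 + ... equals Lambda(t) S(t), since the
    minimum of such a word can be given to either factor ([conv_dec_inc]).  Now
    Lambda(t) S(-t) = 1, so Q(t) Q(-t) = 1; as 2 is invertible, this expresses
    every q_n with n even through the smaller ones ([qgen_even]).  Moreover
    Q(t), like Lambda(t) and S(t), is grouplike, so the coproduct of q_n is
    again a combination of tensor products of peak sums ([delta_qgen]).

    The q_n generate: the product q_c of the generators prescribed by a
    composition c is supported on the words made of peakless blocks of the sizes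
    and colours in c, whose flags are those of c except that some of them are
    moved one step to the right or suppressed.  So q_c is the peak sum of c plus
    peak sums that are smaller for a suitable weight [mu] ([odd_gen_peak]).

    The odd q_n are free: for a composition o with odd parts let theta_o be the
    alternating sum of the values at the words coloured by o whose letters
    increase, except that a subset of those at odd offsets in the blocks of o is
    raised to peaks.  If c has a cut which is not a cut of o, then a letter next
    to this cut can be raised or not without effect on q_c, and theta_o(q_c)
    vanishes ([theta_cut]).  Thus theta_o(q_c) is 1 if c = o and 0 for the other
    c with at least as many parts as o, and the functional of a shortest
    monomial in a linear relation isolates its coefficient ([odd_eval_inj]).

    The Hopf structure follows.  The coproduct is multiplicative and preserves
    peak sums on the generators, hence everywhere ([delta_peak]).  K[G] is
    connected, so the antipode exists as a geometric series ([antip]), and its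
    defining equation computes it recursively within the peak subspace
    ([antipode_Peak]).  A map f of colours may merge colour runs, so f_* does
    not send peak sums to peak sums; but it is multiplicative and sends the
    generator q_n of colour g to that of colour f(g) ([kmap_qgen]), hence
    preserves the algebra that they generate. *)

Set Implicit Arguments.
Unset Strict Implicit.
Unset Printing Implicit Defensive.

Import GRing.Theory.
Local Open Scope ring_scope.

(** * Linear maps out of free modules *)

Section LinearExtension.
Context {K : fieldType}.
Implicit Types T U : choiceType.

Lemma lext_dom T (V : lmodType K) (f : T -> V) (x : {malg K[T]}) (d : {fset T}) :
  (msupp x `<=` d)%fset -> lext f x = \sum_(a <- d) x@_a *: f a.
Proof.
move=> sxd; rewrite /lext (big_fset_incl _ sxd) // => a _ anx.
by rewrite mcoeff_outdom ?scale0r.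
Qed.

Lemma lext_is_linear T (V : lmodType K) (f : T -> V) : linear (lext f).
Proof.
move=> c x y; pose d := (msupp x `|` msupp y)%fset.
rewrite !(@lext_dom _ _ f _ d) ?fsubsetUl ?fsubsetUr //.
  rewrite scaler_sumr -big_split; apply: eq_bigr => a _.
  by rewrite mcoeffD mcoeffZ scalerDl scalerA.
apply: fsubset_trans (msuppD_le _ _) _.
by rewrite fsubUset fsubsetUr (fsubset_trans (msuppZ_le _ _)) ?fsubsetUl.
Qed.

HB.instance Definition _ T (V : lmodType K) (f : T -> V) :=
  GRing.isLinear.Build K {malg K[T]} V *:%R (lext f) (lext_is_linear f).

Lemma lext_sum T (V : lmodType K) (f : T -> V) (I : Type) (r : seq I) P
  (F : I -> {malg K[T]}) :
  lext f (\sum_(i <- r | P i) F i) = \sum_(i <- r | P i) lext f (F i).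
Proof. exact: (raddf_sum (lext f)). Qed.

Lemma lextU T (V : lmodType K) (f : T -> V) a : lext f << a >> = f a.
Proof.
rewrite (@lext_dom _ _ _ _ [fset a]%fset) ?msuppU_le // big_seq_fset1.
by rewrite mcoeffUU scale1r.
Qed.

Lemma malg_lext T (x : {malg K[T]}) : lext (fun a => << a >>) x = x.
Proof.
rewrite /lext [RHS]monalgE; apply: eq_bigr => a _; apply/malgP => b.
by rewrite mcoeffZ !mcoeffU mulrnAr mulr1.
Qed.

Lemma eq_lext T (V : lmodType K) (f g : T -> V) : f =1 g -> lext f =1 lext g.
Proof. by move=> fg x; apply: eq_bigr => a _; rewrite fg. Qed.

Lemma linear_lext T (V W : lmodType K) (h : {linear V -> W}) (f : T -> V) x :
  h (lext f x) = lext (fun a => h (f a)) x.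
Proof. by rewrite linear_sum; apply: eq_bigr => a _; rewrite linearZ. Qed.

Lemma lextZl T (V : lmodType K) (f : T -> K) (v : V) x :
  lext (fun a => f a : K^o) x *: v = lext (fun a => f a *: v) x.
Proof. by rewrite scaler_suml; apply: eq_bigr => a _; rewrite scalerA. Qed.

Lemma lext_comp T U (V : lmodType K) (f : T -> {malg K[U]}) (g : U -> V) x :
  lext g (lext f x) = lext (fun a => lext g (f a)) x.
Proof. exact: (linear_lext (lext g)). Qed.

Lemma mcoeff_lext T U (f : T -> {malg K[U]}) x b :
  (lext f x)@_b = \sum_(a <- msupp x) x@_a * (f a)@_b.
Proof.
rewrite /lext raddf_sum; apply: eq_bigr => a _; exact: mcoeffZ.
Qed.

Lemma lext_exchange T U (V : lmodType K) (f : T -> U -> V) x y :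
  lext (fun a => lext (f a) y) x = lext (fun b => lext (f ^~ b) x) y.
Proof.
rewrite /lext; under eq_bigr do rewrite scaler_sumr.
rewrite exchange_big; apply: eq_bigr => b _; rewrite scaler_sumr.
by apply: eq_bigr => a _; rewrite !scalerA mulrC.
Qed.

Lemma lext2_is_linear_l T U (V : lmodType K) (f : T -> U -> V) y :
  linear (lext2 f ^~ y).
Proof. by move=> c x x'; rewrite /lext2 linearP. Qed.

Lemma lext2_is_linear_r T U (V : lmodType K) (f : T -> U -> V) x :
  linear (lext2 f x).
Proof.
have E z : lext2 f x z = lext (fun b => lext (f ^~ b) x) z.
  exact: lext_exchange.
by move=> c y y'; rewrite !E linearP.
Qed.

HB.instance Definition _ T U (V : lmodType K) (f : T -> U -> V) x :=
  GRing.isLinear.Build K {malg K[U]} V *:%R (lext2 f x)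
    (lext2_is_linear_r f x).

(** Fixing the second argument of [lext2] gives a linear map; it needs a head
    symbol to carry this structure. *)
Definition lext2r T U (V : lmodType K) (f : T -> U -> V) y x := lext2 f x y.

HB.instance Definition _ T U (V : lmodType K) (f : T -> U -> V) y :=
  GRing.isLinear.Build K {malg K[T]} V *:%R (lext2r f y)
    (lext2_is_linear_l f y).

Lemma lext2_lext T T' U (V : lmodType K) (f : T -> U -> V)
    (h : T' -> {malg K[T]}) x y :
  lext2 f (lext h x) y = lext (fun a => lext2 f (h a) y) x.
Proof. exact: (linear_lext (lext2r f y)). Qed.

Lemma lext2_lextr T U U' (V : lmodType K) (f : T -> U -> V)
    (h : U' -> {malg K[U]}) x y :
  lext2 f x (lext h y) = lext (fun b => lext2 f x (h b)) y.
Proof. exact: (linear_lext (lext2 f x)). Qed.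

Lemma lext2UU T U (V : lmodType K) (f : T -> U -> V) a b :
  lext2 f << a >> << b >> = f a b.
Proof. by rewrite /lext2 !lextU. Qed.

Lemma lext2Ul T U (V : lmodType K) (f : T -> U -> V) a y :
  lext2 f << a >> y = lext (f a) y.
Proof. by rewrite /lext2 lextU. Qed.

Lemma lext2E T U (V : lmodType K) (f : T -> U -> V) x y :
  lext2 f x y = \sum_(a <- msupp x) \sum_(b <- msupp y) (x@_a * y@_b) *: f a b.
Proof.
rewrite /lext2 /lext; apply: eq_bigr => a _; rewrite scaler_sumr.
by apply: eq_bigr => b _; rewrite scalerA.
Qed.

Lemma eq_lext2 T U (V : lmodType K) (f g : T -> U -> V) :
  (forall a b, f a b = g a b) -> forall x y, lext2 f x y = lext2 g x y.
Proof.
by move=> fg x y; rewrite /lext2; apply: eq_lext => a; apply: eq_lext.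
Qed.

Lemma linear_lext2 T U (V W : lmodType K) (h : {linear V -> W})
  (f : T -> U -> V) x y : h (lext2 f x y) = lext2 (fun a b => h (f a b)) x y.
Proof. by rewrite /lext2 linear_lext; apply: eq_lext => a; rewrite linear_lext. Qed.

Lemma lext_lext2 T U T' (V : lmodType K) (h : T' -> V)
  (f : T -> U -> {malg K[T']}) x y :
  lext h (lext2 f x y) = lext2 (fun a b => lext h (f a b)) x y.
Proof. exact: (linear_lext2 (lext h)). Qed.

Lemma sum_msupp_eq T (x : {malg K[T]}) b :
  \sum_(a <- msupp x) x@_a * (a == b)%:R = x@_b.
Proof.
rewrite [in RHS](monalgE x) raddf_sum /=; apply: eq_bigr => a _.
by rewrite /= mcoeffU mulr_natr.
Qed.

Lemma mcoeff_tens T U (x : {malg K[T]}) (y : {malg K[U]}) p :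
  (tens x y)@_p = x@_p.1 * y@_p.2.
Proof.
rewrite /tens lext2E raddf_sum -[x@_p.1]sum_msupp_eq big_distrl /=.
apply: eq_bigr => a _; rewrite raddf_sum -[y@_p.2]sum_msupp_eq big_distrr /=.
apply: eq_bigr => b _; rewrite mcoeffZ mcoeffU -mulr_natr mul1r.
by case: p => p1 p2 /=; rewrite xpair_eqE -mulnb natrM; ring.
Qed.

Lemma tensUU T U (a : T) (b : U) :
  tens << a >> << b >> = << (a, b) >> :> {malg K[(T * U)%type]}.
Proof. exact: lext2UU. Qed.

Lemma lext_tens T U (V : lmodType K) (f : T * U -> V) x y :
  lext f (tens x y) = lext2 (fun a b => f (a, b)) x y.
Proof. by rewrite lext_lext2; apply: eq_lext2 => a b; rewrite lextU. Qed.

End LinearExtension.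

(** * Subspaces and spans *)

Section Subspaces.
Context {K : fieldType} {V : lmodType K}.
Implicit Types (A S : V -> Prop).

Lemma subspaceD A x y : subspace A -> A x -> A y -> A (x + y).
Proof. by case=> _ Al Ax Ay; rewrite -[x]scale1r; apply: Al. Qed.

Lemma subspaceZ A c x : subspace A -> A x -> A (c *: x).
Proof. by case=> A0 Al Ax; rewrite -[_ *: _]addr0; apply: Al. Qed.

Lemma subspaceB A x y : subspace A -> A x -> A y -> A (x - y).
Proof.
by move=> sA Ax Ay; rewrite -scaleN1r; apply: subspaceD => //; apply: subspaceZ.
Qed.

Lemma subspace_sum A (I : eqType) (r : seq I) (P : pred I) (F : I -> V) :
  subspace A -> (forall i, i \in r -> P i -> A (F i)) ->
  A (\sum_(i <- r | P i) F i).
Proof.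
move=> sA AF; rewrite big_seq_cond; apply: big_ind => [|x y|i /andP[]].
- by case: sA.
- exact: subspaceD.
- exact: AF.
Qed.

Lemma span_subspace S : subspace (span S).
Proof.
split; first by exists [::]; rewrite big_nil.
move=> c x y [s [Ss ->]] [t [St ->]].
exists ([seq (c * p.1, p.2) | p <- s] ++ t); split.
  by move=> p; rewrite mem_cat => /orP[/mapP[q qs ->]|/St//]; apply: (Ss q).
rewrite big_cat big_map scaler_sumr; congr (_ + _).
by apply: eq_bigr => p _; rewrite scalerA.
Qed.

Lemma span_gen S x : S x -> span S x.
Proof.
move=> Sx; exists [:: (1, x)]; split; last by rewrite big_seq1 scale1r.
by move=> p; rewrite inE => /eqP->.
Qed.

Lemma span_min A S : subspace A -> (forall x, S x -> A x) ->
  forall x, span S x -> A x.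
Proof.
move=> sA SA x [s [Ss ->]]; apply: subspace_sum => // p ps _.
by apply: subspaceZ => //; apply: SA; apply: Ss.
Qed.

End Subspaces.

(** * Standardization of coloured words *)

(** The value of a permutation at i is the number of smaller values, and the
    inversions tell which values these are. *)
Lemma ltn_perm_inj n (s t : 'S_n) :
  (forall i j : 'I_n, (i < j)%N -> (s j < s i)%N = (t j < t i)%N) -> s = t.
Proof.
move=> st.
have rank (u : 'S_n) i : nat_of_ord (u i) = #|[set j | (u j < u i)%N]|.
  have -> : [set j | (u j < u i)%N] = u @^-1: [set k : 'I_n | (k < u i)%N].
    by apply/setP=> j; rewrite !inE.
  rewrite card_preimset; last exact: perm_inj.
  rewrite -sum1dep_card -(big_ord_widen _ (fun=> 1%N)) 1?ltnW //.
  by rewrite sum1_card card_ord.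
have neq (u : 'S_n) i j : i != j -> nat_of_ord (u i) != u j.
  by apply: contra => /eqP/val_inj/perm_inj->.
apply/permP=> i; apply: val_inj; rewrite /= (rank s) (rank t); apply: eq_card => j.
rewrite !inE; case: (ltngtP i j) => [ij|ji|/val_inj->]; last by rewrite !ltnn.
  exact: st.
have := st _ _ ji; move: (neq s i j) (neq t i j).
have -> : i != j by apply: contraTneq ji => ->; rewrite ltnn.
by move=> /(_ isT) ? /(_ isT) ?; lia.
Qed.

Section Words.
Context {gT : finGroupType}.
Implicit Types (w u v : seq (nat * gT)) (a b c : colperm gT).

Definition cw a : seq (nat * gT) := coloured_word (tagged a).

Definition cstd w : colperm gT :=
  colp (Wreath (std (unzip1 w))
    [ffun i : 'I_(size (unzip1 w)) => nth 1%g (unzip2 w) i]).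

(** Records the colours and the inversions.  This determines the standardization
    ([eq_cstd]), but is structurally recursive and has a type that does not
    depend on the length of the word. *)
Fixpoint pat w : seq (gT * seq bool) :=
  if w is x :: w' then (x.2, [seq (y.1 < x.1)%N | y <- w']) :: pat w' else [::].

(** Words of this form are the images of coloured permutations under [cw]. *)
Definition permw w := perm_eq (unzip1 w) (iota 1 (size w)).

Definition shift n w := [seq ((x.1 + n)%N, x.2) | x <- w].

Lemma size_cw a : size (cw a) = tag a.
Proof. by rewrite size_map size_enum_ord. Qed.

Lemma tag_cstd w : tag (cstd w) = size w.
Proof. exact: size_map. Qed.

Lemma size_pat w : size (pat w) = size w.
Proof. by elim: w => //= x w ->. Qed.

Lemma patP w v :
  pat w = pat v <-> unzip2 w = unzip2 v /\
   forall i j, (i < j < size w)%N ->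
     (nth 0%N (unzip1 w) j < nth 0%N (unzip1 w) i)%N =
     (nth 0%N (unzip1 v) j < nth 0%N (unzip1 v) i)%N.
Proof.
elim: w v => [|x w IH] [|y v] /=; try by split=> [|[]].
split=> [[xy e pe]|[[xy e] H]].
  have [eu H] := (IH v).1 pe; rewrite xy eu; split=> // -[|i] [|j] //=.
    rewrite ltnS => jw; have := congr1 (nth false ^~ j) e.
    have sz : size v = size w by rewrite -(size_pat v) -pe size_pat.
    by rewrite !(nth_map (0%N, 1%g)) ?sz // ?size_map ?sz.
  by rewrite !ltnS; apply: H.
have sz : size v = size w.
  by move/(congr1 size): e; rewrite !size_map.
congr (_ :: _); last by apply/IH; split=> // i j ij; apply: (H i.+1 j.+1).
congr (_, _) => //; apply: (@eq_from_nth _ false); rewrite !size_map ?sz // => j jw.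
by have := H 0%N j.+1 jw; rewrite /= !(nth_map (0%N, 1%g)) ?sz.
Qed.

Lemma cw_letters n (a : wreath gT n) :
  unzip1 (cw (colp a)) = [seq (wperm a i).+1 | i <- enum 'I_n].
Proof. by rewrite /unzip1 -map_comp. Qed.

Lemma nth_cw1 n (a : wreath gT n) (i : 'I_n) :
  nth 0%N (unzip1 (cw (colp a))) i = (wperm a i).+1.
Proof.
by rewrite cw_letters (nth_map i) ?size_enum_ord // nth_ord_enum.
Qed.

Lemma cw_colours n (a : wreath gT n) :
  unzip2 (cw (colp a)) = [seq wcol a i | i <- enum 'I_n].
Proof. by rewrite /unzip2 -map_comp. Qed.

Lemma cw_pat_inj a b : pat (cw a) = pat (cw b) -> a = b.
Proof.
suff inj n (a' : wreath gT n) m (b' : wreath gT m) :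
    pat (cw (colp a')) = pat (cw (colp b')) -> colp a' = colp b'.
  by case: a b => n a [m b]; apply: inj.
move: {a b} a' b' => a b ab.
have nm : n = m.
  by have := congr1 size ab; rewrite !size_pat !size_cw.
move: b ab; rewrite -{}nm => b /patP[]; rewrite !cw_colours => colab ordab.
congr (colp _); case: a b colab ordab => [s g] [t h] colab ordab.
congr Wreath.
  apply: ltn_perm_inj => i j ij.
  by have := ordab i j; rewrite !nth_cw1 !ltnS ij size_cw /=; apply.
by apply/ffunP=> i; move/eq_in_map: colab; apply; rewrite mem_enum.
Qed.

Lemma pat_cstd w : pat (cw (cstd w)) = pat w.
Proof.
have sz : size (unzip1 w) = size w by rewrite size_map.
apply/patP; rewrite cw_colours; split.
  apply: (@eq_from_nth _ 1%g) => [|i]; rewrite size_map size_enum_ord.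
    by rewrite !size_map.
  move=> ilt; rewrite (nth_map (Ordinal ilt)) ?size_enum_ord // ffunE.
  by rewrite nth_enum_ord.
move=> i j /andP[ij]; rewrite size_cw tag_cstd -sz => jlt.
have ilt := ltn_trans ij jlt.
have /forallP/(_ (Ordinal ilt))/forallP/(_ (Ordinal jlt))/implyP/(_ ij)/eqP :=
  stdP (unzip1 w).
have := nth_cw1 (tagged (cstd w)) (Ordinal ilt).
have := nth_cw1 (tagged (cstd w)) (Ordinal jlt).
by rewrite /= => -> ->; rewrite ltnS.
Qed.

Lemma cwK : cancel cw cstd.
Proof. by move=> a; apply: cw_pat_inj; rewrite pat_cstd. Qed.

Lemma eq_cstd w v : (cstd w = cstd v) <-> (pat w = pat v).
Proof.
split=> [e|e]; first by rewrite -pat_cstd e pat_cstd.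
by apply: cw_pat_inj; rewrite !pat_cstd.
Qed.

Lemma cstd_eq w a : (cstd w = a) <-> (pat w = pat (cw a)).
Proof. by rewrite -{1}(cwK a) eq_cstd. Qed.

Lemma pat_take n w v : pat w = pat v -> pat (take n w) = pat (take n v).
Proof.
elim: w v n => [|x w IH] [|y v] [|n] //= [-> e /IH->].
by rewrite !map_take e.
Qed.

Lemma pat_drop n w v : pat w = pat v -> pat (drop n w) = pat (drop n v).
Proof. by elim: w v n => [|x w IH] [|y v] [|n] //= [_ _ /IH->]. Qed.

Lemma pat_shift n w : pat (shift n w) = pat w.
Proof.
elim: w => //= x w ->; congr ((_, _) :: _); rewrite -map_comp.
by apply: eq_map => y /=; rewrite ltn_add2r.
Qed.

Lemma permw_cw a : permw (cw a).
Proof.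
case: a => n a; rewrite /permw size_cw /unzip1 -map_comp.
have -> : iota 1 n = [seq (nat_of_ord i).+1 | i <- enum 'I_n].
  by rewrite (map_comp succn) val_enum_ord (iotaDl 1 0).
rewrite [X in perm_eq X _](map_comp (fun i : 'I_n => i.+1) (wperm a)).
apply: perm_map; apply: uniq_perm; rewrite ?enum_uniq //.
  by rewrite map_inj_uniq ?enum_uniq //; apply: perm_inj.
move=> i; rewrite mem_enum; apply/mapP; exists ((wperm a)^-1%g i).
  by rewrite mem_enum.
by rewrite permKV.
Qed.

Lemma permw_exists n w : size w = n -> permw w ->
  exists a : wreath gT n, cw (colp a) = w.
Proof.
move=> <- pw.
have szu : size (unzip1 w) = size w by rewrite size_map.
have lt i : (i < size w)%N -> (0 < nth 0%N (unzip1 w) i <= size w)%N.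
  move=> iw; have : nth 0%N (unzip1 w) i \in unzip1 w by rewrite mem_nth ?szu.
  by rewrite (perm_mem pw) mem_iota add1n ltnS.
have lt' (i : 'I_(size w)) : ((nth 0%N (unzip1 w) i).-1 < size w)%N.
  by have := lt i (ltn_ord i); lia.
have inj : injective (fun i => Ordinal (lt' i)).
  move=> i j [] e; apply: val_inj; apply/eqP.
  rewrite -(@nth_uniq _ 0%N (unzip1 w)) ?szu ?ltn_ord //; last first.
    by rewrite (perm_uniq pw) iota_uniq.
  have /andP[i0 _] := lt i (ltn_ord i); have /andP[j0 _] := lt j (ltn_ord j).
  by rewrite -(prednK i0) -(prednK j0) e.
exists (Wreath (perm inj) [ffun i : 'I_(size w) => nth 1%g (unzip2 w) i]).
apply: (@eq_from_nth _ (0%N, 1%g)) => [|i]; rewrite size_cw //= => iw.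
rewrite /cw /= /coloured_word (nth_map (Ordinal iw)) ?size_enum_ord //=.
rewrite (_ : nth _ _ i = Ordinal iw); last first.
  by apply: val_inj; rewrite /= nth_enum_ord.
rewrite permE ffunE /= prednK; last by case/andP: (lt i iw).
by rewrite !(nth_map (0%N, 1%g)) //; case: (nth _ w i).
Qed.

Lemma permwK w : permw w -> cw (cstd w) = w.
Proof. by case/(permw_exists erefl) => a <-; rewrite cwK. Qed.

Lemma enum_lrshift n m : enum 'I_(n + m)%N =
  [seq lshift m i | i <- enum 'I_n] ++ [seq rshift n i | i <- enum 'I_m].
Proof.
apply: (inj_map val_inj); rewrite val_enum_ord map_cat iotaD.
congr (_ ++ _); first by rewrite -map_comp -val_enum_ord; apply: eq_map.
by rewrite -map_comp addnC iotaDl -val_enum_ord -map_comp; apply: eq_map.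
Qed.

Lemma cw_lrshift n m (c : wreath gT (n + m)%N) : cw (colp c) =
  [seq ((wperm c (lshift m i)).+1, wcol c (lshift m i)) | i <- enum 'I_n] ++
  [seq ((wperm c (rshift n i)).+1, wcol c (rshift n i)) | i <- enum 'I_m].
Proof.
by rewrite /cw /coloured_word enum_lrshift map_cat; congr (_ ++ _); rewrite -map_comp.
Qed.

Lemma take_cw n m (c : wreath gT (n + m)%N) : take n (cw (colp c)) =
  [seq ((wperm c (lshift m i)).+1, wcol c (lshift m i)) | i <- enum 'I_n].
Proof. by rewrite cw_lrshift take_size_cat // size_map size_enum_ord. Qed.

Lemma drop_cw n m (c : wreath gT (n + m)%N) : drop n (cw (colp c)) =
  [seq ((wperm c (rshift n i)).+1, wcol c (rshift n i)) | i <- enum 'I_m].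
Proof. by rewrite cw_lrshift drop_size_cat // size_map size_enum_ord. Qed.

Lemma pat_enum n (f f' : 'I_n -> nat) (g g' : 'I_n -> gT) :
  pat [seq (f i, g i) | i <- enum 'I_n] = pat [seq (f' i, g' i) | i <- enum 'I_n]
  <-> g =1 g' /\ forall i j : 'I_n, (i < j)%N -> (f j < f i)%N = (f' j < f' i)%N.
Proof.
have nthE (h : 'I_n -> nat) (k : 'I_n -> gT) i :
    nth 0%N (unzip1 [seq (h i, k i) | i <- enum 'I_n]) (nat_of_ord i) = h i.
  by rewrite /unzip1 -map_comp (nth_map i) ?size_enum_ord // nth_ord_enum.
have colE (h : 'I_n -> nat) (k : 'I_n -> gT) :
    unzip2 [seq (h i, k i) | i <- enum 'I_n] = map k (enum 'I_n).
  by rewrite -[LHS]map_comp.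
rewrite patP !colE; split=> -[colfg H]; split.
- by move=> i; move/eq_in_map: colfg; apply; rewrite mem_enum.
- move=> i j ij; have := H i j; rewrite !nthE; apply.
  by rewrite ij size_map size_enum_ord /=.
- by apply: eq_map.
- move=> i j; rewrite size_map size_enum_ord => /andP[ij jn].
  pose i' := Ordinal (ltn_trans ij jn); pose j' := Ordinal jn.
  rewrite -[i]/(val i') -[j]/(val j') (nthE f g i') (nthE f g j').
  by rewrite (nthE f' g' i') (nthE f' g' j'); apply: H.
Qed.

End Words.

(** * Product and coproduct on the basis, in terms of words *)

Section Operations.
Context (K : fieldType) {gT : finGroupType}.
Implicit Types (w u v : seq (nat * gT)) (a b c : colperm gT).

Lemma colp_eq n (a b : wreath gT n) : (colp a == colp b) = (a == b).
Proof. exact: eq_Tagged. Qed.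

Lemma colp_cast n (a : colperm gT) : tag a = n -> exists b : wreath gT n, a = colp b.
Proof. by case: a => m a /= <-; exists a. Qed.

Lemma cross_permL n m (s : 'S_n) (t : 'S_m) i :
  cross_perm s t (lshift m i) = lshift m (s i).
Proof.
rewrite permE /cross_fun; case: split_ordP => j /eqP;
  by rewrite ?eq_lshift ?eq_lrshift // => /eqP->.
Qed.

Lemma cross_permR n m (s : 'S_n) (t : 'S_m) i :
  cross_perm s t (rshift n i) = rshift n (t i).
Proof.
rewrite permE /cross_fun; case: split_ordP => j /eqP;
  by rewrite ?eq_rshift ?eq_rlshift // => /eqP->.
Qed.

Lemma wcol_crossL n m (a : wreath gT n) (b : wreath gT m) i :
  wcol (cross a b) (lshift m i) = wcol a i.
Proof.
rewrite ffunE; case: split_ordP => j /eqP;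
  by rewrite ?eq_lshift ?eq_lrshift // => /eqP->.
Qed.

Lemma wcol_crossR n m (a : wreath gT n) (b : wreath gT m) i :
  wcol (cross a b) (rshift n i) = wcol b i.
Proof.
rewrite ffunE; case: split_ordP => j /eqP;
  by rewrite ?eq_rshift ?eq_rlshift // => /eqP->.
Qed.

Lemma cw_cross n m (a : wreath gT n) (b : wreath gT m) :
  cw (colp (cross a b)) = cw (colp a) ++ shift n (cw (colp b)).
Proof.
rewrite cw_lrshift; congr (_ ++ _).
  by apply: eq_map => i; rewrite cross_permL wcol_crossL.
rewrite /shift /cw /coloured_word -map_comp; apply: eq_map => i /=.
by rewrite cross_permR wcol_crossR /= addSn addnC.
Qed.

Lemma shufflesP n m (u : 'S_(n + m)%N) : reflect
  ((forall i j : 'I_n, (i < j)%N -> (u (lshift m i) < u (lshift m j))%N) /\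
   (forall i j : 'I_m, (i < j)%N -> (u (rshift n i) < u (rshift n j))%N))
  (u \in shuffles n m).
Proof.
rewrite inE; apply: (iffP forallP) => [H|[Hl Hr] k].
  split=> i j ij.
    by have /forallP/(_ (lshift m j))/implyP := H (lshift m i); apply; rewrite /= ij ltn_ord.
  have /forallP/(_ (rshift n j))/implyP := H (rshift n i); apply=> /=.
  by rewrite ltn_add2l ij leq_addr orbT.
apply/forallP=> l; apply/implyP.
case: (split_ordP k) => i ->; case: (split_ordP l) => j -> /=.
- by case/andP=> ij _; apply: Hl.
- by move=> H; exfalso; move: H (ltn_ord i); lia.
- by move=> H; exfalso; move: H (ltn_ord j); lia.
- by rewrite ltn_add2l => /andP[ij _]; apply: Hr.
Qed.

Lemma wperm_mul n (a b : wreath gT n) k : wperm (a * b)%g k = wperm a (wperm b k).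
Proof. exact: permM. Qed.

Lemma wcol_mul n (a b : wreath gT n) k :
  wcol (a * b)%g k = (wcol a (wperm b k) * wcol b k)%g.
Proof. exact: ffunE. Qed.

Lemma wreath_ext n (a b : wreath gT n) :
  wperm a =1 wperm b -> wcol a =1 wcol b -> a = b.
Proof. by case: a b => [s g] [t h] /= /permP-> /ffunP->. Qed.

(** A permutation with prescribed standardizations of its two halves is
    obtained by a unique shuffle. *)
Lemma shuffle_cross n m (a : wreath gT n) (b : wreath gT m)
    (c : wreath gT (n + m)%N) (u : 'S_(n + m)%N) :
  (u \in shuffles n m) && (perm_wreath gT u * cross a b == c)%g =
  [&& u == ((wperm (cross a b))^-1 * wperm c)%g,
      cstd (take n (cw (colp c))) == colp a
    & cstd (drop n (cw (colp c))) == colp b].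
Proof.
set X := cross a b; apply/idP/idP.
  case/andP=> /shufflesP[ul ur] /eqP<-; apply/and3P; split.
  - apply/eqP/permP=> k; rewrite permM.
    have -> : wperm (perm_wreath gT u * X)%g ((wperm X)^-1%g k) = u k.
      by rewrite wperm_mul permKV.
    by [].
  - apply/eqP/cstd_eq; rewrite take_cw; apply/pat_enum; split=> [i|i j ij].
      by rewrite wcol_mul ffunE mul1g wcol_crossL.
    rewrite !wperm_mul /= !cross_permL !ltnS.
    case: (ltngtP (wperm a i) (wperm a j)) => [lt|gt|/val_inj->]; rewrite ?ltnn //.
      by apply/negbTE; rewrite -leqNgt ltnW ?ul.
    exact: ul.
  - apply/eqP/cstd_eq; rewrite drop_cw; apply/pat_enum; split=> [i|i j ij].
      by rewrite wcol_mul ffunE mul1g wcol_crossR.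
    rewrite !wperm_mul /= !cross_permR !ltnS.
    case: (ltngtP (wperm b i) (wperm b j)) => [lt|gt|/val_inj->]; rewrite ?ltnn //.
      by apply/negbTE; rewrite -leqNgt ltnW ?ur.
    exact: ur.
have total p (f f' : 'I_p -> nat) (injf : injective f) (injf' : injective f') :
    (forall i j : 'I_p, (i < j)%N -> (f j < f i)%N = (f' j < f' i)%N) ->
    forall i j, (f' j < f' i)%N -> (f j < f i)%N.
  move=> H i j; case: (ltngtP i j) => [/H->//|ji|/val_inj->]; last by rewrite !ltnn.
  have nij : i <> j by move=> e; rewrite e ltnn in ji.
  have nf : f i <> f j by move/injf.
  have nf' : f' i <> f' j by move/injf'.
  by move: (H _ _ ji); lia.
case/and3P=> /eqP-> /eqP/cstd_eq; rewrite take_cw => /pat_enum[ca pa].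
move=> /eqP/cstd_eq; rewrite drop_cw => /pat_enum[cb pb].
have tota := total _ _ _ _ _ pa; have totb := total _ _ _ _ _ pb.
apply/andP; split.
  have XVl i : (wperm X)^-1%g (lshift m i) = lshift m ((wperm a)^-1%g i).
    by apply: (canLR (permK _)); rewrite cross_permL permKV.
  have XVr i : (wperm X)^-1%g (rshift n i) = rshift n ((wperm b)^-1%g i).
    by apply: (canLR (permK _)); rewrite cross_permR permKV.
  apply/shufflesP; split=> i j ij; rewrite !permM ?XVl ?XVr -ltnS.
    apply: tota; rewrite /= ?permKV // => ? ? [] /val_inj/perm_inj //.
    exact: lshift_inj.
  apply: totb; rewrite /= ?permKV // => ? ? [] /val_inj/perm_inj //.
  exact: rshift_inj.
apply/eqP/wreath_ext => k; first by rewrite wperm_mul /= permM permK.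
rewrite wcol_mul ffunE mul1g; case: (split_ordP k) => i ->.
  by rewrite wcol_crossL ca.
by rewrite wcol_crossR cb.
Qed.

(** At most one shuffle u contributes to the coefficient at c: the one given by
    [shuffle_cross]. *)
Lemma mcoeff_mulb a b c : (KG_mulb K a b)@_c =
  ((cstd (take (tag a) (cw c)) == a) && (cstd (drop (tag a) (cw c)) == b))%:R.
Proof.
case: a b => n a [m b]; rewrite /KG_mulb -!/(colp _) /= raddf_sum /=.
under eq_bigr do rewrite mcoeffU.
have [tc|tc] := eqVneq (tag c) (n + m)%N; last first.
  rewrite big1 => [|u _]; last first.
    by case: eqP => // e; rewrite -e eqxx in tc.
  case: eqP => //= ta; case: eqP => //= tb; case/eqP: tc.
  have := congr1 tag ta; have := congr1 tag tb.
  by rewrite !tag_cstd size_drop size_take size_cw /=; case: ltnP; lia.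
have [{tc}c ->] := colp_cast tc.
under eq_bigr do rewrite colp_eq.
rewrite big_mkcond /=.
set v := ((wperm (cross a b))^-1 * wperm c)%g.
rewrite (bigD1 v) //= big1 => [|u nuv].
  have := shuffle_cross a b c v; rewrite eqxx /= addr0 => <-.
  by case: (v \in _).
have := shuffle_cross a b c u; rewrite (negbTE nuv) /=.
by case: (u \in _) => //= ->.
Qed.

Definition lo n w := [seq x <- w | x.1 <= n]%N.
Definition hi n w := [seq x <- w | n < x.1]%N.

Lemma sorted_enum_ord n : sorted (fun i j : 'I_n => i < j)%N (enum 'I_n).
Proof.
have := iota_ltn_sorted 0 n; rewrite -val_enum_ord sorted_map.
by apply: sub_sorted.
Qed.

Lemma cw_mul_perm n (a : wreath gT n) (u : 'S_n) :
  cw (colp (a * perm_wreath gT u)%g) =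
  [seq ((wperm a k).+1, wcol a k) | k <- [seq u j | j <- enum 'I_n]].
Proof.
rewrite /cw /coloured_word -[RHS]map_comp; apply: eq_map => j /=.
by rewrite permM !ffunE mulg1.
Qed.

(** The two factors of the coproduct are the subwords of the small and of the
    large letters: the shuffle u lists the positions of the former, then those
    of the latter, both in increasing order. *)
Lemma unshuffle_cross n m (a : wreath gT (n + m)%N) (b : wreath gT n)
    (c : wreath gT m) :
  [exists u in shuffles n m, a^-1 == perm_wreath gT u * (cross b c)^-1]%g =
  (lo n (cw (colp a)) == cw (colp b)) &&
  (hi n (cw (colp a)) == shift n (cw (colp c))).
Proof.
pose ltI (i j : 'I_(n + m)%N) := (i < j)%N.
have ltI_trans : transitive ltI by move=> i j k; apply: ltn_trans.
have ltI_irr : irreflexive ltI by move=> i; apply: ltnn.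
have ltI_enum : sorted ltI (enum 'I_(n + m)%N) by apply: sorted_enum_ord.
pose let_ k := ((wperm a k).+1, wcol a k).
pose s1 := [seq k <- enum 'I_(n + m)%N | wperm a k < n]%N.
pose s2 := [seq k <- enum 'I_(n + m)%N | ~~ (wperm a k < n)%N].
have loE : lo n (cw (colp a)) = map let_ s1 by rewrite /lo filter_map.
have hiE : hi n (cw (colp a)) = map let_ s2.
  rewrite /hi filter_map; congr map; apply: eq_filter => k.
  by rewrite -leqNgt.
apply/exists_inP/andP => [[u uS /eqP e]|[/eqP lob /eqP hic]].
  have Xe : cross b c = (a * perm_wreath gT u)%g.
    by rewrite -[LHS]invgK -[RHS]invgK invMg e mulKg.
  have aE k : wperm a (u k) = wperm (cross b c) k by rewrite Xe wperm_mul.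
  have [ul ur] := shufflesP _ uS.
  have s1E : s1 = [seq u (lshift m j) | j <- enum 'I_n].
    apply: (irr_sorted_eq ltI_trans ltI_irr).
    - exact: sorted_filter.
    - by rewrite sorted_map; apply: sub_sorted (sorted_enum_ord n) => i j; apply: ul.
    move=> k; rewrite mem_filter mem_enum andbT -[k in LHS](permKV u) aE.
    case: (split_ordP (u^-1 k)%g) => j /(canRL (permK _)).
      rewrite invgK => ->; rewrite permK cross_permL /= ltn_ord; apply/esym/mapP.
      by exists j; rewrite ?mem_enum.
    rewrite invgK => ->; rewrite permK cross_permR /= ltnNge leq_addr; apply/esym/mapP.
    by case=> l _ /perm_inj/eqP; rewrite eq_rlshift.
  have s2E : s2 = [seq u (rshift n j) | j <- enum 'I_m].
    apply: (irr_sorted_eq ltI_trans ltI_irr).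
    - exact: sorted_filter.
    - by rewrite sorted_map; apply: sub_sorted (sorted_enum_ord m) => i j; apply: ur.
    move=> k; rewrite mem_filter mem_enum andbT -[k in LHS](permKV u) aE.
    case: (split_ordP (u^-1 k)%g) => j /(canRL (permK _)).
      rewrite invgK => ->; rewrite permK cross_permL /= ltn_ord; apply/esym/mapP.
      by case=> l _ /perm_inj/eqP; rewrite eq_lrshift.
    rewrite invgK => ->; rewrite permK cross_permR /= ltnNge leq_addr; apply/esym/mapP.
    by exists j; rewrite ?mem_enum.
  have /eqP := cw_mul_perm a u; rewrite -Xe cw_cross enum_lrshift !map_cat.
  rewrite -[X in map _ X ++ _]map_comp -[X in _ ++ map _ X]map_comp.
  rewrite eqseq_cat ?size_map -?enumT ?size_enum_ord // => /andP[/eqP-> /eqP->].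
  by rewrite loE hiE s1E s2E -!map_comp.
pose s := s1 ++ s2.
have sz1 : size s1 = n.
  by rewrite -(size_map let_) -loE lob size_cw.
have sz2 : size s2 = m.
  by rewrite -(size_map let_) -hiE hic size_map size_cw.
have us : uniq s by rewrite (perm_uniq (permEl (perm_filterC _ _))) enum_uniq.
have inj : injective (fun j => nth j s (nat_of_ord j)).
  move=> i j; rewrite (set_nth_default j) ?size_cat ?sz1 ?sz2 //.
  by move/eqP; rewrite nth_uniq ?size_cat ?sz1 ?sz2 // => /eqP/val_inj.
have sE : [seq perm inj j | j <- enum 'I_(n + m)%N] = s.
  have szs : size s = (n + m)%N by rewrite size_cat sz1 sz2.
  case: (posnP (n + m)%N) => [nm0|nm_gt0].
    by rewrite [RHS]size0nil ?szs //; apply: size0nil; rewrite size_map size_enum_ord.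
  apply: (@eq_from_nth _ (Ordinal nm_gt0)); rewrite size_map size_enum_ord ?szs //.
  move=> i ilt; rewrite (nth_map (Ordinal ilt)) ?size_enum_ord // permE.
  by rewrite nth_enum_ord //; apply: set_nth_default; rewrite szs.
exists (perm inj).
  apply/shufflesP; split=> i j ij; rewrite !permE /= !nth_cat sz1.
    rewrite !ltn_ord (set_nth_default (lshift m i)) ?sz1 // -[(_ < _)%N]/(ltI _ _).
    by apply: sorted_ltn_nth => //; rewrite ?inE ?sz1 //; apply: sorted_filter.
  rewrite !ltnNge !leq_addr /= !addKn -ltnNge (set_nth_default (rshift n i)) ?sz2 //.
  rewrite -[(_ < _)%N]/(ltI _ _).
  by apply: sorted_ltn_nth => //; rewrite ?inE ?sz2 //; apply: sorted_filter.
suff -> : cross b c = (a * perm_wreath gT (perm inj))%g by rewrite invMg mulKVg.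
apply/eqP; rewrite -colp_eq; apply/eqP/(can_inj cwK).
by rewrite cw_cross cw_mul_perm sE map_cat -loE -hiE lob hic.
Qed.

Lemma perm_lo n m w : size w = (n + m)%N -> permw w ->
  perm_eq (unzip1 (lo n w)) (iota 1 n).
Proof.
move=> sw; rewrite /permw sw => pw.
have -> : unzip1 (lo n w) = [seq k <- unzip1 w | k <= n]%N.
  by rewrite /unzip1 filter_map.
rewrite (perm_trans (perm_filter _ pw)) // iotaD filter_cat.
rewrite (_ : [seq _ <- iota 1 n | _] = iota 1 n); last first.
  by apply/all_filterP/allP => k; rewrite mem_iota; lia.
rewrite (_ : [seq _ <- iota _ m | _] = [::]) ?cats0 //.
by apply/eqP; rewrite -[_ == _]negbK -has_filter; apply/hasPn => k; rewrite mem_iota; lia.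
Qed.

Lemma perm_hi n m w : size w = (n + m)%N -> permw w ->
  perm_eq (unzip1 (hi n w)) (iota n.+1 m).
Proof.
move=> sw; rewrite /permw sw => pw.
have -> : unzip1 (hi n w) = [seq k <- unzip1 w | n < k]%N.
  by rewrite /unzip1 filter_map.
rewrite (perm_trans (perm_filter _ pw)) // iotaD filter_cat.
rewrite (_ : [seq _ <- iota 1 n | _] = [::]); last first.
  by apply/eqP; rewrite -[_ == _]negbK -has_filter; apply/hasPn => k; rewrite mem_iota; lia.
rewrite (_ : [seq _ <- iota _ m | _] = iota n.+1 m) //.
by rewrite add1n; apply/all_filterP/allP => k; rewrite mem_iota; lia.
Qed.

Lemma size_lo n m w : size w = (n + m)%N -> permw w -> size (lo n w) = n.
Proof.
by move=> sw /(perm_lo sw)/perm_size; rewrite size_map size_iota.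
Qed.

Lemma size_hi n m w : size w = (n + m)%N -> permw w -> size (hi n w) = m.
Proof.
by move=> sw /(perm_hi sw)/perm_size; rewrite size_map size_iota.
Qed.

Lemma permw_lo n m w : size w = (n + m)%N -> permw w -> permw (lo n w).
Proof. by move=> sw pw; rewrite /permw (size_lo sw pw) (perm_lo sw). Qed.

Lemma permw_hi n m w : size w = (n + m)%N -> permw w ->
  exists2 v, permw v & hi n w = shift n v.
Proof.
move=> sw pw; have sh := size_hi sw pw; have ph := perm_hi sw pw.
have hE : hi n w = shift n [seq ((x.1 - n)%N, x.2) | x <- hi n w].
  rewrite /shift -map_comp -[LHS]map_id; apply/eq_in_map => -[x g].
  rewrite mem_filter /= => /andP[nx _]; rewrite subnK //; exact: ltnW.
exists [seq ((x.1 - n)%N, x.2) | x <- hi n w] => //.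
rewrite /permw size_map sh; apply: (perm_map_inj (@addIn n)).
have -> : [seq (k + n)%N | k <- iota 1 m] = iota n.+1 m.
  rewrite -[n.+1]addn1 iotaDl; apply: eq_map => k; exact: addnC.
suff -> : [seq (k + n)%N | k <- unzip1 [seq ((x.1 - n)%N, x.2) | x <- hi n w]] =
  unzip1 (hi n w) by [].
by rewrite [in RHS]hE /shift /unzip1 -!map_comp.
Qed.

(** Up to a shift of its letters, each of the two subwords is the word of a
    coloured permutation, so exactly one pair contributes for each i. *)
Lemma KG_deltabE a : KG_deltab K a =
  \sum_(i < (tag a).+1) << (cstd (lo i (cw a)), cstd (hi i (cw a))) >>.
Proof.
apply: eq_bigr => -[i /=]; rewrite ltnS => ile _.
have ta : tag a = (i + (tag a - i))%N by rewrite subnKC.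
move: (tag a - i)%N ta => k ta; have [a' e] := colp_cast ta.
have sz : size (cw (colp a')) = (i + k)%N by rewrite size_cw.
have [b0 b0E] := permw_exists (size_lo sz (permw_cw _)) (permw_lo sz (permw_cw _)).
have [v pv vE] := permw_hi sz (permw_cw (colp a')).
have szv : size v = k.
  by rewrite -(size_map (fun x => ((x.1 + i)%N, x.2))) -(size_hi sz (permw_cw _)) vE.
have [c0 c0E] := permw_exists szv pv.
have cond (b : wreath gT i) (c : wreath gT k) : [exists u in shuffles i k,
     colp ((tagged a)^-1)%g == colp (perm_wreath gT u * (cross b c)^-1)%g] =
   (b == b0) && (c == c0).
  rewrite {}e /= /colp; under eq_existsb do rewrite colp_eq.
  rewrite unshuffle_cross -b0E vE -c0E -![in RHS]colp_eq.
  rewrite (can_eq cwK) eq_sym; congr (_ && _).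
  rewrite eq_sym (inj_eq (_ : injective (shift i))) ?(can_eq cwK) //.
  by apply: inj_map => -[x g] [y h] [] /addIn-> ->.
rewrite (bigD1 b0) //= [X in _ + X]big1 ?addr0 => [|b bb]; last first.
  by rewrite big1 // => c; rewrite cond (negbTE bb).
rewrite (eq_bigl (pred1 c0)) => [|c]; last by rewrite cond eqxx.
rewrite big_pred1_eq e -b0E vE.
have -> : cstd (shift i v) = cstd v by apply/eq_cstd; rewrite pat_shift.
by rewrite -c0E !cwK.
Qed.

End Operations.

(** * Deconcatenations and shuffles of words *)

Section SplitShuffle.
Context {T : eqType} {R : comNzRingType}.
Implicit Types (u v w : seq T) (p q : seq T * seq T).

Fixpoint splits w : seq (seq T * seq T) :=
  ([::], w) ::
  (if w is x :: w' then [seq (x :: p.1, p.2) | p <- splits w'] else [::]).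

Fixpoint shuf u : seq T -> seq (seq T) :=
  if u is x :: u' then
    fix shufx v := if v is y :: v' then
      map (cons x) (shuf u' v) ++ map (cons y) (shufx v') else [:: u]
  else fun v => [:: v].

Lemma splitsE w :
  splits w = [seq (take i w, drop i w) | i <- iota 0 (size w).+1].
Proof.
elim: w => // x w; rewrite [splits (x :: w)]/= => ->.
rewrite -[iota 0 (size (x :: w)).+1]/(0%N :: iota (1 + 0) (size w).+1) iotaDl.
rewrite map_cons take0 drop0; congr (_ :: _).
by rewrite -map_comp -[RHS]map_comp.
Qed.

Lemma shufs0 u : shuf u [::] = [:: u].
Proof. by case: u. Qed.

Lemma shuf_cons x u y v : shuf (x :: u) (y :: v) =
  map (cons x) (shuf u (y :: v)) ++ map (cons y) (shuf (x :: u) v).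
Proof. by []. Qed.

Lemma splits_mem w p : p \in splits w -> p.1 ++ p.2 = w.
Proof. by rewrite splitsE => /mapP[i _ ->]; apply: cat_take_drop. Qed.

Lemma sum_splits_cons x w (H : seq T * seq T -> R) :
  \sum_(p <- splits (x :: w)) H p =
  H ([::], x :: w) + \sum_(p <- splits w) H (x :: p.1, p.2).
Proof. by rewrite [splits _]/= big_cons big_map. Qed.

(** Both sides sum over the ways to cut w in three. *)
Lemma splits_assoc w (F : seq T -> seq T -> seq T -> R) :
  \sum_(p <- splits w) \sum_(q <- splits p.1) F q.1 q.2 p.2 =
  \sum_(p <- splits w) \sum_(q <- splits p.2) F p.1 q.1 q.2.
Proof.
elim: w F => [|x w IH] F /=; first by rewrite !big_seq1.
rewrite !(big_cons, big_map, big_nil) /= addr0 -addrA; congr (_ + _).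
rewrite -(IH (fun a b c => F (x :: a) b c)) -big_split /=.
by apply: eq_bigr => p _; rewrite big_cons big_map.
Qed.

Lemma shuf_perm u v w : w \in shuf u v -> perm_eq w (u ++ v).
Proof.
elim: u v w => [|x u IHu] v w; first by rewrite inE => /eqP->.
elim: v w => [|y v IHv] w; first by rewrite shufs0 inE cats0 => /eqP->.
rewrite shuf_cons mem_cat => /orP[]/mapP[w' ww' ->].
  by rewrite cat_cons perm_cons IHu.
by rewrite perm_sym -[y :: v]cat1s perm_catCA perm_cons perm_sym; apply: IHv.
Qed.

(** When the letters of u and v are told apart by a predicate, a shuffle of u
    and v is a word with these two subwords. *)
Lemma mem_shuf (P : pred T) u v w : all P u -> all (predC P) v ->
  (w \in shuf u v) = (filter P w == u) && (filter (predC P) w == v).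
Proof.
have base (Q : pred T) (t s : seq T) : all (predC Q) t ->
    (s == t) = (filter Q s == [::]) && (filter (predC Q) s == t).
  move=> at_; apply/eqP/andP => [->|[/eqP Qs /eqP<-]]; last first.
    by apply/esym/all_filterP; rewrite all_predC has_filter Qs.
  by split; [rewrite -[_ == _]negbK -has_filter -all_predC | apply/eqP/all_filterP].
have base' (t s : seq T) : all P t ->
    (s == t) = (filter P s == t) && (filter (predC P) s == [::]).
  move=> at_; rewrite (base (predC P)) 1?andbC; last first.
    by apply: sub_all at_ => ? /=; rewrite negbK.
  by congr ((_ == _) && _); apply: eq_filter => ? /=; rewrite negbK.
elim: w u v => [|z w IH] [|x u] v au av; first by rewrite inE (base P).
- case: v av => [|y v] // av.
  by rewrite shuf_cons mem_cat; apply/orP => -[]/mapP[].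
- by rewrite inE (base P).
case: v av => [|y v] av; first by rewrite shufs0 inE base'.
case/andP: (au) (av) => Px au' /andP[Py av']; rewrite shuf_cons mem_cat.
have inc t s : (z :: w \in map (cons t) s) = (z == t) && (w \in s).
  apply/mapP/andP => [[w' sw [-> ->]]|[/eqP-> ws]]; first by [].
  by exists w.
rewrite !inc !IH //=; case: (boolP (P z)) => Pz /=; rewrite !eqseq_cons.
  have /negbTE-> : z != y by apply: contraNneq Py => <-.
  by rewrite orbF andbA.
have /negbTE-> : z != x by apply: contraNneq Pz => ->.
by case: (z == y); rewrite /= ?andbF.
Qed.

Lemma uniq_shuf (P : pred T) u v :
  all P u -> all (predC P) v -> uniq (shuf u v).
Proof.
elim: u v => [|x u IHu] // v /andP[Px au].
elim: v => [|y v IHv] // /andP[Py av].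
rewrite shuf_cons cat_uniq !map_inj_uniq ?IHu ?IHv //=; try by move=> ? ? [].
  rewrite andbT; apply/hasPn => _ /mapP[w _ ->]; apply/mapP => -[w' _ []] e _.
  by move: Py; rewrite e /= Px.
by apply/andP.
Qed.

(** Deconcatenation is multiplicative for the shuffle product.  The induction
    goes by the first letter of w, which is taken from u or from v; unless the
    first part is empty, this is also the first letter of a shuffle of prefixes
    of u and v. *)
Lemma shuf_splits u v (F : seq T -> seq T -> R) :
  \sum_(w <- shuf u v) \sum_(p <- splits w) F p.1 p.2 =
  \sum_(p <- splits u) \sum_(q <- splits v)
    \sum_(w1 <- shuf p.1 q.1) \sum_(w2 <- shuf p.2 q.2) F w1 w2.
Proof.
elim: u v F => [|x u IHu] v F.
  by rewrite /= !big_seq1; apply: eq_bigr => p _ /=; rewrite !big_seq1.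
elim: v F => [|y v IHv] F.
  rewrite shufs0 big_seq1; apply: eq_bigr => p _.
  by rewrite /= !big_seq1 !shufs0 !big_seq1.
have split_cons z (s : seq (seq T)) :
    \sum_(w <- map (cons z) s) \sum_(p <- splits w) F p.1 p.2 =
    \sum_(w <- map (cons z) s) F [::] w +
    \sum_(w <- s) \sum_(p <- splits w) F (z :: p.1) p.2.
  rewrite !big_map -big_split; apply: eq_bigr => w _ /=.
  by rewrite big_cons big_map.
rewrite shuf_cons big_cat [LHS]/= !split_cons.
rewrite (IHu _ (fun a b => F (x :: a) b)) (IHv (fun a b => F (y :: a) b)).
rewrite addrACA -big_cat -shuf_cons !sum_splits_cons -!addrA; congr (_ + _).
  by rewrite [shuf ([::], _).1 _]/= big_seq1.
rewrite [LHS]addrCA; congr (_ + _).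
  by apply: eq_bigr => q _ /=; rewrite !big_seq1.
rewrite -big_split; apply: eq_bigr => p _.
rewrite [LHS]/= !sum_splits_cons -addrA; congr (_ + _).
  by rewrite [(_, _).1]/= !shufs0 !big_seq1.
rewrite -big_split; apply: eq_bigr => q _ /=.
by rewrite big_cat !big_map.
Qed.

End SplitShuffle.

Lemma shuf_map (T U : eqType) (f : T -> U) u v :
  shuf (map f u) (map f v) = map (map f) (shuf u v).
Proof.
elim: u v => [|x u IHu] v //; elim: v => [|y v IHv] //.
rewrite [map f (x :: u)]/= [map f (y :: v)]/= !shuf_cons map_cat.
rewrite -/(map f (y :: v)) IHu -/(map f (x :: u)) IHv -!map_comp.
by congr (_ ++ _); apply: eq_map.
Qed.

(** * The operations of K[G] in the dual picture *)

HB.lock Definition kmul (K : fieldType) (gT : finGroupType)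
  (x y : {malg K[colperm gT]}) : {malg K[colperm gT]} :=
  lext2 (@KG_mulb K gT) x y.

HB.lock Definition kdelta (K : fieldType) (gT : finGroupType)
  (x : {malg K[colperm gT]}) : {malg K[(colperm gT * colperm gT)%type]} :=
  lext (@KG_deltab K gT) x.

Section HopfAxioms.
Context {K : fieldType} {gT : finGroupType}.
Local Notation word := (seq (nat * gT)).
Local Notation KG := {malg K[colperm gT]}.
Local Notation KG2 := {malg K[(colperm gT * colperm gT)%type]}.
Local Notation "x ** y" := (kmul x y) (at level 40, left associativity).
Local Notation Delta := (@kdelta K gT).
Implicit Types (w u v : word) (a b c : colperm gT) (x y z : KG) (X Y : KG2).

(** An element of K[G] is regarded as a function on words; it is the dual
    picture, in which * becomes deconcatenation and Delta becomes shuffle. *)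
Definition cf x w : K := x@_(cstd w).

Lemma cf_cw x a : cf x (cw a) = x@_a.
Proof. by rewrite /cf cwK. Qed.

Lemma cf_pat x w v : pat w = pat v -> cf x w = cf x v.
Proof. by move=> e; rewrite /cf; congr mcoeff; apply/eq_cstd. Qed.

Lemma cf_ext x y : (forall w, cf x w = cf y w) -> x = y.
Proof. by move=> e; apply/malgP => a; rewrite -!cf_cw. Qed.

Lemma cfD x y w : cf (x + y) w = cf x w + cf y w.
Proof. exact: mcoeffD. Qed.

Lemma cfB x y w : cf (x - y) w = cf x w - cf y w.
Proof. exact: mcoeffB. Qed.

Lemma cfZ (k : K) x w : cf (k *: x) w = k * cf x w.
Proof. exact: mcoeffZ. Qed.

Lemma cf_sum (I : Type) (r : seq I) (P : pred I) (F : I -> KG) w :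
  cf (\sum_(i <- r | P i) F i) w = \sum_(i <- r | P i) cf (F i) w.
Proof. exact: (raddf_sum (mcoeff (cstd w))). Qed.

Lemma sum_splits_pat w v (F : word -> word -> K) :
  (forall u1 u2 v1 v2, pat u1 = pat v1 -> pat u2 = pat v2 -> F u1 u2 = F v1 v2) ->
  pat w = pat v ->
  \sum_(p <- splits w) F p.1 p.2 = \sum_(p <- splits v) F p.1 p.2.
Proof.
move=> HF e; rewrite !splitsE !big_map.
rewrite (_ : size v = size w); last by rewrite -!size_pat e.
by apply: eq_bigr => i _; apply: HF; rewrite /= ?(pat_take _ e) ?(pat_drop _ e).
Qed.

(** Only the cut after [tag a] letters can contribute; when c is shorter than
    this, both sides vanish. *)
Lemma mcoeff_mulb_splits a b c : (KG_mulb K a b)@_c =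
  \sum_(p <- splits (cw c)) (a == cstd p.1)%:R * (b == cstd p.2)%:R.
Proof.
rewrite mcoeff_mulb splitsE big_map; under eq_bigr do rewrite -natrM mulnb.
have [tac|tac] := leqP (tag a) (tag c); last first.
  rewrite take_oversize ?size_cw 1?ltnW // cwK.
  rewrite (_ : c == a = false); last by apply: contraTF tac => /eqP->; rewrite ltnn.
  rewrite big1_seq // => i /andP[_]; rewrite mem_iota add0n ltnS => ic.
  case: eqP => // /(congr1 tag); rewrite tag_cstd size_take_min => ta.
  by move: tac; rewrite ta size_cw ltnNge geq_minr.
rewrite (bigD1_seq (tag a)) ?iota_uniq ?mem_iota ?size_cw ?add0n ?ltnS //.
rewrite big1_seq => [|i /andP[ia]]; last first.
  rewrite mem_iota => ic; case: eqP => [/(congr1 tag)|//].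
  by rewrite tag_cstd size_takel ?size_cw // => ta; rewrite ta eqxx in ia.
by rewrite /= addr0 [a == _]eq_sym [b == _]eq_sym.
Qed.

Lemma cf_mul x y w :
  cf (x ** y) w = \sum_(p <- splits w) cf x p.1 * cf y p.2.
Proof.
have -> : \sum_(p <- splits w) cf x p.1 * cf y p.2 =
    \sum_(p <- splits (cw (cstd w))) cf x p.1 * cf y p.2.
  apply: (sum_splits_pat (F := fun u v => cf x u * cf y v)); last first.
    by rewrite pat_cstd.
  by move=> u1 u2 v1 v2 e1 e2; rewrite (cf_pat _ e1) (cf_pat _ e2).
rewrite unlock {1}/cf lext2E raddf_sum /=; under eq_bigr do rewrite raddf_sum /=.
under [RHS]eq_bigr => p _ do
  rewrite -[cf x _]sum_msupp_eq -[cf y _]sum_msupp_eq big_distrlr /=.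
rewrite [RHS]exchange_big /=; apply: eq_bigr => a _.
rewrite exchange_big /=; apply: eq_bigr => b _.
rewrite mcoeffZ mcoeff_mulb_splits big_distrr /=.
by apply: eq_bigr => p _; ring.
Qed.

Lemma KG_mulA x y z : x ** (y ** z) = x ** y ** z.
Proof.
apply: cf_ext => w.
rewrite (cf_mul x).
rewrite (cf_mul (x ** y)).
under eq_bigr => p _ do rewrite cf_mul big_distrr /=.
under [RHS]eq_bigr => p _ do rewrite cf_mul big_distrl /=.
rewrite (splits_assoc w (fun t u v => cf x t * cf y u * cf z v)).
by apply: eq_bigr => p _; apply: eq_bigr => q _; rewrite mulrA.
Qed.

Lemma cstd_nil w : (cstd w == colp (1%g : wreath gT 0)) = nilp w.
Proof.
apply/eqP/nilP => [/(congr1 tag)|->]; first by rewrite tag_cstd => /size0nil.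
by apply/cstd_eq; rewrite /cw /coloured_word /= enum_ord0.
Qed.

Lemma cf_one w : cf (KG_one K gT) w = (nilp w)%:R.
Proof. by rewrite /cf mcoeffU eq_sym cstd_nil. Qed.

Lemma KG_mul1x x : KG_one K gT ** x = x.
Proof.
apply: cf_ext => w; rewrite cf_mul; case: w => [|l w].
  by rewrite big_seq1 cf_one mul1r.
rewrite sum_splits_cons cf_one mul1r big1 ?addr0 // => p _.
by rewrite cf_one mul0r.
Qed.

Lemma KG_mulx1 x : x ** KG_one K gT = x.
Proof.
apply: cf_ext => w; rewrite cf_mul splitsE big_map -addn1 iotaD big_cat /=.
rewrite big_seq1 take_size drop_size cf_one mulr1 big1_seq ?add0r // => i /andP[_].
rewrite mem_iota => /andP[_ iw]; rewrite cf_one /nilp size_drop subn_eq0.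
by rewrite leqNgt iw mulr0.
Qed.

Lemma heps_cf x : lext (fun a => KG_epsb K a : K^o) x = cf x [::].
Proof.
rewrite /cf -sum_msupp_eq; apply: eq_bigr => a _; congr (_ * _%:R).
congr nat_of_bool; apply/eqP/eqP => [/eqP ta|->]; last by rewrite tag_cstd.
by rewrite -[a]cwK; congr cstd; apply: size0nil; rewrite size_cw (eqP ta).
Qed.

Lemma KG_epsM x y : cf (x ** y) [::] = cf x [::] * cf y [::].
Proof. by rewrite cf_mul big_seq1. Qed.

(** * The coproduct *)

Lemma lo_lo i j w : (j <= i)%N -> lo j (lo i w) = lo j w.
Proof.
move=> ji; rewrite /lo -filter_predI; apply: eq_filter => l /=.
by case: leqP => // lj; rewrite (leq_trans lj).
Qed.

Lemma lo_shift i j w : lo (i + j) (shift i w) = shift i (lo j w).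
Proof.
rewrite /lo /shift filter_map; congr map; apply: eq_filter => l /=.
by rewrite addnC leq_add2l.
Qed.

Lemma hi_shift i j w : hi (i + j) (shift i w) = shift i (hi j w).
Proof.
rewrite /hi /shift filter_map; congr map; apply: eq_filter => l /=.
by rewrite [(l.1 + _)%N]addnC ltn_add2l.
Qed.

Lemma hi_hi i j w : (i <= j)%N -> hi j (hi i w) = hi j w.
Proof.
move=> ij; rewrite /hi -filter_predI; apply: eq_filter => l /=.
by case: ltnP => // lj; rewrite (leq_ltn_trans ij).
Qed.

Lemma lo_hi i j w : lo j (hi i w) = hi i (lo j w).
Proof.
by rewrite /hi /lo -!filter_predI; apply: eq_filter => l /=; rewrite andbC.
Qed.

Lemma cstd_shift i w : cstd (shift i w) = cstd w.
Proof. by apply/eq_cstd; rewrite pat_shift. Qed.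

Lemma size_cw_split a i : (i <= tag a)%N -> size (cw a) = (i + (tag a - i))%N.
Proof. by move=> ia; rewrite size_cw subnKC. Qed.

Lemma tens_suml (T U : choiceType) (I : Type) (r : seq I) (F : I -> {malg K[T]})
    (y : {malg K[U]}) :
  tens (\sum_(i <- r) F i) y = \sum_(i <- r) tens (F i) y.
Proof. exact: (raddf_sum (lext2r _ y)). Qed.

Lemma tens_sumr (T U : choiceType) (I : Type) (r : seq I) (x : {malg K[T]})
    (F : I -> {malg K[U]}) :
  tens x (\sum_(i <- r) F i) = \sum_(i <- r) tens x (F i).
Proof. exact: (raddf_sum (lext2 _ x)). Qed.

Lemma KG_deltab_permw w : permw w -> KG_deltab K (cstd w) =
  \sum_(j < (size w).+1) << (cstd (lo j w), cstd (hi j w)) >>.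
Proof. by move=> pw; rewrite KG_deltabE tag_cstd permwK. Qed.

Lemma sum_triangle (V : zmodType) n (F : nat -> nat -> V) :
  \sum_(i < n) \sum_(j < i.+1) F i j =
  \sum_(j < n) \sum_(k < n - j) F (j + k)%N j.
Proof.
rewrite (eq_bigr (fun i : 'I_n => \sum_(j < n | (j < i.+1)%N) F i j)); last first.
  by move=> i _; rewrite (big_ord_widen n (F i)).
rewrite (exchange_big_dep predT) //=; apply: eq_bigr => j _.
rewrite -(big_mkord (fun i => j < i.+1)%N (fun i => F i j)).
rewrite -[LHS]big_filter (_ : [seq _ <- _ | _] = index_iota j n).
  rewrite -{1}[nat_of_ord j]add0n big_addn big_mkord.
  by apply: eq_bigr => k _; rewrite addnC.
have jn : n = (j + (n - j))%N by rewrite subnKC // ltnW.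
rewrite /index_iota subn0 [X in iota 0 X]jn iotaD filter_cat.
rewrite (_ : [seq _ <- iota 0 j | _] = [::]); last first.
  apply/eqP; rewrite -[_ == _]negbK -has_filter; apply/hasPn => k.
  by rewrite mem_iota; lia.
by apply/all_filterP/allP => k; rewrite mem_iota; lia.
Qed.

(** Both sides sum, over j <= i, the triples made of the letters at most j, of
    those between j and i, and of those above i. *)
Lemma KG_deltaA x :
  tens_assoc (lext (fun p => tens (KG_deltab K p.1) << p.2 >>) (Delta x)) =
  lext (fun p => tens << p.1 >> (KG_deltab K p.2)) (Delta x).
Proof.
rewrite unlock /tens_assoc !lext_comp; apply: eq_lext => a.
rewrite !KG_deltabE !raddf_sum /=.
pose F i j := (cstd (lo j (cw a)), (cstd (hi j (lo i (cw a))), cstd (hi i (cw a)))).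
transitivity (\sum_(i < (tag a).+1) \sum_(j < i.+1) << F i j >>
    : {malg K[(colperm gT * (colperm gT * colperm gT))%type]}).
  apply: eq_bigr => -[i /=]; rewrite ltnS => ia _; rewrite lextU /=.
  have sz := size_cw_split ia; have pl := permw_lo sz (permw_cw a).
  rewrite KG_deltab_permw // (size_lo sz (permw_cw a)) tens_suml raddf_sum.
  apply: eq_bigr => -[j /=]; rewrite ltnS => ji _; rewrite tensUU lextU.
  by rewrite /F lo_lo.
rewrite (sum_triangle _ (fun i j => << F i j >>)).
apply: eq_bigr => -[j /=]; rewrite ltnS => ja _; rewrite lextU /=.
have sz := size_cw_split ja; have [v pv vE] := permw_hi sz (permw_cw a).
have szv : size v = (tag a - j)%N by rewrite -(size_hi sz (permw_cw a)) vE size_map.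
rewrite vE cstd_shift KG_deltab_permw // szv tens_sumr subSn //.
apply: eq_bigr => k _; rewrite tensUU /F.
have -> : hi (j + k) (cw a) = shift j (hi k v).
  by rewrite -hi_shift -vE hi_hi ?leq_addr.
by rewrite -lo_hi vE lo_shift !cstd_shift.
Qed.

Lemma lo_all a : lo (tag a) (cw a) = cw a.
Proof.
apply/all_filterP/allP => l la.
have : l.1 \in unzip1 (cw a) by apply: map_f.
by rewrite (perm_mem (permw_cw a)) mem_iota size_cw => /andP[].
Qed.

Lemma hi_all a : hi 0 (cw a) = cw a.
Proof.
apply/all_filterP/allP => l la.
have : l.1 \in unzip1 (cw a) by apply: map_f.
by rewrite (perm_mem (permw_cw a)) mem_iota size_cw => /andP[].
Qed.

Lemma KG_counitl x : lext (fun p => KG_epsb K p.1 *: << p.2 >>) (Delta x) = x.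
Proof.
rewrite unlock lext_comp -[RHS]malg_lext; apply: eq_lext => a.
rewrite KG_deltabE lext_sum; under eq_bigr do rewrite lextU.
have eps i (ia : (i <= tag a)%N) : KG_epsb K (cstd (lo i (cw a))) = (i == 0%N)%:R.
  by rewrite /KG_epsb tag_cstd (size_lo (size_cw_split ia) (permw_cw a)).
rewrite big_ord_recl big1 => [|i _]; first by rewrite addr0 eps // hi_all cwK scale1r.
by rewrite lift0 eps ?scale0r ?ltn_ord.
Qed.

Lemma KG_counitr x : lext (fun p => KG_epsb K p.2 *: << p.1 >>) (Delta x) = x.
Proof.
rewrite unlock lext_comp -[RHS]malg_lext; apply: eq_lext => a.
rewrite KG_deltabE lext_sum; under eq_bigr do rewrite lextU.
have eps i (ia : (i <= tag a)%N) :
    KG_epsb K (cstd (hi i (cw a))) = (tag a <= i)%N%:R.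
  by rewrite /KG_epsb tag_cstd (size_hi (size_cw_split ia) (permw_cw a)) subn_eq0.
rewrite big_ord_recr big1 => [|i _].
  by rewrite [LHS]add0r eps // leqnn lo_all cwK scale1r.
by rewrite (eps i (ltnW (ltn_ord i))) leqNgt ltn_ord scale0r.
Qed.

Lemma KG_delta1 : Delta (KG_one K gT) = tens (KG_one K gT) (KG_one K gT).
Proof.
have e1 : cstd [::] = colp (1%g : wreath gT 0) by apply/eqP; rewrite cstd_nil.
have e0 : cw (colp (1%g : wreath gT 0)) = [::].
  by apply: size0nil; rewrite size_cw.
rewrite unlock lextU KG_deltabE big_ord1 tensUU e0.
by rewrite -[lo _ _]/[::] -[hi _ _]/[::] e1.
Qed.

(** In the dual picture, the coproduct is the shuffle of words whose letters
    are first made comparable: those of the second word become larger. *)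
Definition below u v := allrel (fun l m : nat * gT => l.1 < m.1)%N u v.

(** The words are zipped, so that a single shuffle acts on both pairs; its
    pattern only involves comparisons within u, within v, and between u and v,
    and the latter are settled by [below]. *)
Lemma shuf_pat u v u' v' : below u v -> below u' v' ->
  pat u = pat u' -> pat v = pat v' ->
  [seq cstd w | w <- shuf u v] = [seq cstd w | w <- shuf u' v'].
Proof.
move=> luv luv' eu ev.
pose r (s t : (nat * gT) * (nat * gT)) :=
  (t.1.1 < s.1.1)%N == (t.2.1 < s.2.1)%N.
have patE W : (pat (unzip1 W) == pat (unzip2 W)) =
    all (fun s => s.1.2 == s.2.2) W && pairwise r W.
  elim: W => //= s W IH; rewrite eqseq_cons IH xpair_eqE.
  suff -> : ([seq (l.1 < s.1.1)%N | l <- unzip1 W] ==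
     [seq (l.1 < s.2.1)%N | l <- unzip2 W]) = all (r s) W.
    by rewrite -!andbA; do !bool_congr.
  by elim: W {IH} => //= t W <-; rewrite eqseq_cons.
have szu : size u = size u' by rewrite -!size_pat eu.
have szv : size v = size v' by rewrite -!size_pat ev.
rewrite -(unzip1_zip (eq_leq szu)) -(unzip1_zip (eq_leq szv)).
rewrite -[u' in RHS](unzip2_zip (eq_leq (esym szu))) -[v' in RHS](unzip2_zip (eq_leq (esym szv))).
rewrite /unzip1 /unzip2 !shuf_map -!map_comp; apply/eq_in_map => W /=.
set U := zip u u'; set V := zip v v' => WUV; apply/eq_cstd/eqP.
rewrite (patE W).
have /andP[cU rU] : all (fun s => s.1.2 == s.2.2) U && pairwise r U.
  by rewrite -patE unzip1_zip ?unzip2_zip ?szu // eu eqxx.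
have /andP[cV rV] : all (fun s => s.1.2 == s.2.2) V && pairwise r V.
  by rewrite -patE unzip1_zip ?unzip2_zip ?szv // ev eqxx.
rewrite (perm_all _ (shuf_perm WUV)) all_cat cU cV /=.
have cross s t : s \in U -> t \in V -> r s t /\ r t s.
  move=> sU tV; have lt : (s.1.1 < t.1.1)%N.
    apply: (allrelP luv).
      by rewrite -(unzip1_zip (eq_leq szu)); apply: map_f.
    by rewrite -(unzip1_zip (eq_leq szv)); apply: map_f.
  have lt' : (s.2.1 < t.2.1)%N.
    apply: (allrelP luv').
      by rewrite -(unzip2_zip (eq_leq (esym szu))); apply: map_f.
    by rewrite -(unzip2_zip (eq_leq (esym szv))); apply: map_f.
  by rewrite /r /= lt lt' !ltnNge (ltnW lt) (ltnW lt').
elim: U V W {cU cV luv luv' patE szu szv eu ev} rU rV cross WUV => [|s U IHU] V W.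
  by move=> _ rV _; rewrite inE => /eqP->.
elim: V W => [|t V IHV] W; first by move=> rU _ _; rewrite shufs0 inE => /eqP->.
rewrite shuf_cons mem_cat => /andP[sU rU] /andP[tV rV] cr.
case/orP=> /mapP[W' WW' ->] /=; rewrite (perm_all _ (shuf_perm WW')) all_cat.
  rewrite (IHU (t :: V)) //= ?tV // ?andbT; last first.
    by move=> s' t' s'U t'V; apply: cr; rewrite // inE s'U orbT.
  rewrite sU andTb -/(all (r s) (t :: V)).
  by apply/allP => t' t'V; case: (cr s t'); rewrite ?mem_head.
rewrite IHV //= ?sU // ?andbT; last first.
  by move=> s' t' s'U t'V; apply: cr; rewrite // inE t'V orbT.
rewrite tV andbT -/(all (r t) (s :: U)).
by apply/allP => s' s'U; case: (cr s' t); rewrite ?mem_head.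
Qed.

End HopfAxioms.

(** * Compatibility of the product with the coproduct *)

Section Comultiplication.
Context {K : fieldType} {gT : finGroupType}.
Local Notation word := (seq (nat * gT)).
Local Notation KG := {malg K[colperm gT]}.
Local Notation KG2 := {malg K[(colperm gT * colperm gT)%type]}.
Local Notation "x ** y" := (kmul x y) (at level 40, left associativity).
Local Notation Delta := (@kdelta K gT).
Implicit Types (w u v : word) (a b c : colperm gT) (x y z : KG) (X Y : KG2).

Lemma below_shift a b : below (cw a) (shift (tag a) (cw b)).
Proof.
apply/allrelP => l m la /mapP[m' m'b ->] /=.
have : l.1 \in unzip1 (cw a) by apply: map_f.
have : m'.1 \in unzip1 (cw b) by apply: map_f.
rewrite !(perm_mem (permw_cw _)) !mem_iota !size_cw => /andP[m0 _] /andP[_ la'].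
by apply: leq_trans la' _; rewrite leq_add2r.
Qed.

(** The words with given subwords of small and of large letters are the shuffles
    of these subwords. *)
Lemma mcoeff_deltab a b c : (KG_deltab K a)@_(b, c) =
  \sum_(w <- shuf (cw b) (shift (tag b) (cw c))) (cstd w == a)%:R.
Proof.
set n := tag b; pose P (l : nat * gT) := (l.1 <= n)%N.
have Pb : all P (cw b).
  apply/allP => l lb; have : l.1 \in unzip1 (cw b) by apply: map_f.
  by rewrite (perm_mem (permw_cw b)) mem_iota size_cw => /andP[].
have Pc : all (predC P) (shift n (cw c)).
  apply/allP => _ /mapP[l lc ->] /=; rewrite -ltnNge -[X in (X < _)%N]add0n ltn_add2r.
  have : l.1 \in unzip1 (cw c) by apply: map_f.
  by rewrite (perm_mem (permw_cw c)) mem_iota => /andP[].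
have memE w : w \in shuf (cw b) (shift n (cw c)) -> cw (cstd w) = w.
  move=> /shuf_perm pw; apply: permwK; rewrite /permw.
  have := permw_cw (colp (cross (tagged b) (tagged c))); rewrite /permw cw_cross.
  rewrite (perm_size pw); apply: perm_trans; exact: perm_map.
have -> : \sum_(w <- shuf (cw b) (shift n (cw c))) (cstd w == a)%:R =
    (cw a \in shuf (cw b) (shift n (cw c)))%:R :> K.
  have us := uniq_shuf Pb Pc; case: (boolP (cw a \in _)) => [ain|anin].
    rewrite (bigD1_seq (cw a)) //= cwK eqxx big1_seq ?addr0 // => w /andP[wa win].
    by case: eqP => // e; rewrite -e memE ?eqxx // in wa.
  rewrite big1_seq // => w /andP[_ win]; case: eqP => // e.
  by rewrite -e memE ?win in anin.
rewrite (mem_shuf _ Pb Pc) -/(lo n (cw a)).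
rewrite (_ : filter (predC P) (cw a) = hi n (cw a)); last first.
  by apply: eq_filter => l /=; rewrite ltnNge.
rewrite KG_deltabE raddf_sum /=; under eq_bigr do rewrite mcoeffU xpair_eqE.
have [na|na] := leqP n (tag a); last first.
  rewrite big1 => [|i _]; last first.
    case: eqP => // /(congr1 tag); rewrite tag_cstd.
    rewrite (size_lo (size_cw_split _) (permw_cw a)) => [ib|]; last by rewrite -ltnS.
    by move: na; rewrite ltnNge /n -ib -ltnS ltn_ord.
  case: eqP => // /(congr1 size) szlo; move: na; rewrite ltnNge -size_cw.
  by rewrite /n -(size_cw b) -szlo size_filter count_size.
have sz := size_cw_split na; have [v pv vE] := permw_hi sz (permw_cw a).
rewrite (bigD1 (Ordinal (na : (n < (tag a).+1)%N))) //= big1 ?addr0 => [|i ni].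
  rewrite vE cstd_shift -[RHS]/(((lo n (cw a) == cw b) && _)%:R).
  rewrite (inj_eq (_ : injective (shift n))); last first.
    by apply: inj_map => -[l g] [m h] [] /addIn-> ->.
  rewrite -(can_eq cwK) permwK ?(permw_lo sz (permw_cw a)) //.
  by rewrite -(can_eq cwK (cstd v)) permwK.
case: eqP => // /(congr1 tag); rewrite tag_cstd.
rewrite (size_lo (size_cw_split _) (permw_cw a)) => [ib|]; last by rewrite -ltnS.
by case/eqP: ni; apply: val_inj.
Qed.

Lemma mcoeff_delta x u v : below u v ->
  (Delta x)@_(cstd u, cstd v) = \sum_(w <- shuf u v) cf x w.
Proof.
move=> buv.
have -> : \sum_(w <- shuf u v) cf x w =
    \sum_(w <- shuf (cw (cstd u)) (shift (tag (cstd u)) (cw (cstd v)))) cf x w.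
  have := shuf_pat buv (below_shift (cstd u) (cstd v)).
  rewrite pat_shift !pat_cstd => /(_ erefl erefl) e.
  by rewrite -(big_map (@cstd gT) predT (fun a => x@_a)) e big_map.
rewrite unlock mcoeff_lext.
under eq_bigr do rewrite mcoeff_deltab big_distrr /=.
rewrite exchange_big; apply: eq_bigr => w _ /=.
by under eq_bigr do rewrite eq_sym; rewrite sum_msupp_eq.
Qed.

Definition ktens X Y : KG2 :=
  lext2 (fun p q => tens (KG_mulb K p.1 q.1) (KG_mulb K p.2 q.2)) X Y.

(** The product of the tensor square deconcatenates both components. *)
Lemma mcoeff_ktens X Y u v : (ktens X Y)@_(cstd u, cstd v) =
  \sum_(p <- splits u) \sum_(q <- splits v)
    X@_(cstd p.1, cstd q.1) * Y@_(cstd p.2, cstd q.2).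
Proof.
have -> : \sum_(p <- splits u) \sum_(q <- splits v)
      X@_(cstd p.1, cstd q.1) * Y@_(cstd p.2, cstd q.2) =
    \sum_(p <- splits (cw (cstd u))) \sum_(q <- splits (cw (cstd v)))
      X@_(cstd p.1, cstd q.1) * Y@_(cstd p.2, cstd q.2).
  rewrite (sum_splits_pat (v := cw (cstd u)) (F := fun s t => \sum_(q <- splits v)
    X@_(cstd s, cstd q.1) * Y@_(cstd t, cstd q.2))) ?pat_cstd //; last first.
    by move=> ? ? ? ? /eq_cstd-> /eq_cstd->.
  apply: eq_bigr => p _.
  rewrite (sum_splits_pat (v := cw (cstd v)) (F := fun s t =>
    X@_(cstd p.1, cstd s) * Y@_(cstd p.2, cstd t))) ?pat_cstd //.
  by move=> ? ? ? ? /eq_cstd-> /eq_cstd->.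
rewrite /ktens lext2E raddf_sum /=; under eq_bigr do rewrite raddf_sum /=.
under [RHS]eq_bigr => p _ do under eq_bigr => q _ do
  rewrite -[X@_(_, _)]sum_msupp_eq -[Y@_(_, _)]sum_msupp_eq big_distrlr /=.
under [RHS]eq_bigr => p _ do rewrite exchange_big /=.
rewrite [RHS]exchange_big /=; apply: eq_bigr => -[s1 s2] _.
under [RHS]eq_bigr => p _ do rewrite exchange_big /=.
rewrite [RHS]exchange_big /=; apply: eq_bigr => -[t1 t2] _.
rewrite mcoeffZ mcoeff_tens /= !mcoeff_mulb_splits big_distrlr /= big_distrr /=.
apply: eq_bigr => p _; rewrite big_distrr /=; apply: eq_bigr => q _.
by rewrite !xpair_eqE -!mulnb !natrM; ring.
Qed.

(** In the dual picture this is the compatibility of deconcatenation with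
    shuffles, [shuf_splits]. *)
Lemma KG_deltaM x y : Delta (x ** y) = ktens (Delta x) (Delta y).
Proof.
apply/malgP => -[b c]; set v := shift (tag b) (cw c).
have -> : (b, c) = (cstd (cw b), cstd v) by rewrite cstd_shift !cwK.
have bv : below (cw b) v := below_shift b c.
rewrite mcoeff_delta // mcoeff_ktens.
under eq_bigr do rewrite cf_mul.
rewrite (shuf_splits (cw b) v (fun w1 w2 => cf x w1 * cf y w2)).
apply: eq_big_seq => p /splits_mem bp; apply: eq_big_seq => q /splits_mem vq.
have /and4P[] : [&& below p.1 q.1, below p.1 q.2, below p.2 q.1 & below p.2 q.2].
  by move: bv; rewrite /below -bp -vq allrel_catl !allrel_catr => /andP[/andP[-> ->] /andP[-> ->]].
by move=> b1 _ _ b2; rewrite !mcoeff_delta // big_distrlr.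
Qed.

End Comultiplication.

(** * Peak data of a coloured word *)

Section CutData.
Context {gT : finGroupType}.
Local Notation word := (seq (nat * gT)).
Local Notation flags := (seq (gT * bool)).
Implicit Types (w u : word) (s t : flags) (c : seq (nat * gT)).
Implicit Types (k : option nat -> nat -> nat -> bool).

(** In [is_des] and [is_peak], p is the letter before x if it has the same
    colour; x is compared with the next letter y.  The weak inequality in
    [is_peak] is the one of standardization, where equal letters increase. *)
Definition is_des (p : option nat) (x y : nat) := (y < x)%N.
Definition is_peak (p : option nat) (x y : nat) :=
  if p is Some z then (z <= x)%N && (y < x)%N else false.

Definition same_colour (p : option (nat * gT)) (x : nat * gT) : option nat :=
  if p is Some z then if z.2 == x.2 then Some z.1 else None else None.

(** A G-composition is a word of coloured positions in which the last position
    of each part is flagged; the flags make concatenation and the passage to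
    subwords local. *)
Fixpoint cdat k p w : flags :=
  if w is x :: w' then
    (x.2, if w' is y :: _ then (x.2 != y.2) || k (same_colour p x) x.1 y.1 else true)
      :: cdat k (Some x) w'
  else [::].

Definition pdat w : flags := cdat is_peak None w.

(** The composition whose parts are the runs of positions up to the next flag,
    and its inverse [dec].  A part takes the colour of its flagged position. *)
Fixpoint enc s : seq (nat * gT) :=
  if s is (g, b) :: s' then
    if b then (1%N, g) :: enc s' else
    if enc s' is (n, h) :: c then (n.+1, h) :: c else [:: (1%N, g)]
  else [::].

Definition blk (n : nat) (g : gT) : flags := rcons (nseq n.-1 (g, false)) (g, true).

Definition dec c : flags := flatten [seq blk x.1 x.2 | x <- c].

(** Without a flag between them, neighbours lie in the same part and must have
    the same colour; [enc] is injective only under this condition. *)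
Fixpoint wf_flags s : bool :=
  if s is (g, b) :: s' then
    wf_flags s' && (b || (if s' is (h, _) :: _ then g == h else false))
  else true.

Lemma size_cdat k p w : size (cdat k p w) = size w.
Proof. by elim: w p => //= x w IH p; rewrite IH. Qed.

Lemma cdat_colours k p w : unzip1 (cdat k p w) = unzip2 w.
Proof. by elim: w p => //= x w IH p; rewrite IH. Qed.

Lemma wf_cdat k p w : wf_flags (cdat k p w).
Proof.
elim: w p => //= x w IH p; rewrite IH /=; case: w {IH} => //= y w.
by case: eqP => //= _; rewrite orbT.
Qed.

Lemma dec_cons x c : dec (x :: c) = blk x.1 x.2 ++ dec c.
Proof. by []. Qed.

Lemma enc_pos s : all (fun x => 0 < x.1)%N (enc s).
Proof.
elim: s => //= -[g [|]] s //; case: (enc s) => //= -[n h] c /=.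
by case/andP.
Qed.

Lemma weight_enc s : weight (enc s) = size s.
Proof.
elim: s => //= -[g [|]] s IH /=; first by rewrite /weight /= -IH.
by move: IH; rewrite /weight; case: (enc s) => [|[n h] c] /= <-.
Qed.

Lemma enc_cat s t : last true (unzip2 s) -> enc (s ++ t) = enc s ++ enc t.
Proof.
elim: s => //= -[g [|]] s IH /= ls; first by rewrite IH.
case: s IH ls => // -[h b] s IH ls; rewrite IH //=.
have : enc ((h, b) :: s) != [::].
  by rewrite -size_eq0 /=; case: b {IH ls} => //; case: (enc s) => [|[]].
by rewrite /=; case: (if b then _ else _) => [|[]].
Qed.

Lemma enc_blk n g : (0 < n)%N -> enc (blk n g) = [:: (n, g)].
Proof. by case: n => // n _; rewrite /blk /=; elim: n => //= n ->. Qed.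

Lemma last_blk n g : last true (unzip2 (blk n g)).
Proof. by rewrite /unzip2 map_rcons last_rcons. Qed.

Lemma decK c : all (fun x => 0 < x.1)%N c -> enc (dec c) = c.
Proof.
elim: c => //= -[n g] c IH /andP[/= n0 cp].
by rewrite dec_cons enc_cat ?last_blk // enc_blk // IH.
Qed.

(** The first part has size 1 iff the first position is flagged, since otherwise
    it prolongs the nonempty first part of the rest. *)
Lemma enc_inj s t : wf_flags s -> wf_flags t -> enc s = enc t -> s = t.
Proof.
elim: s t => [|[g b] s IH] [|[h d] t] //=.
- by case: d => //; case: (enc t) => [|[]].
- by case: b => //; case: (enc s) => [|[]].
move=> /andP[ws gs] /andP[wt ht].
have tail : enc s = enc t -> s = t by apply: IH.
case: b d gs ht => [] [] /=.
- by move=> _ _ [-> /tail->].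
- move=> _; case: t wt {IH tail} => // -[h' d] t _ /eqP->.
  have := enc_pos ((h', d) :: t); have := weight_enc ((h', d) :: t).
  by case: (enc _) => // -[[|n] h''] c.
- case: s ws {IH tail} => // -[h' d] s _ /eqP-> _.
  have := enc_pos ((h', d) :: s); have := weight_enc ((h', d) :: s).
  by case: (enc _) => // -[[|n] h''] c.
case: s ws IH tail => // -[g' b] s ws IH tail /eqP->.
case: t wt tail => // -[h' d] t wt tail /eqP-> e.
have st : (g', b) :: s = (h', d) :: t.
  apply: tail; move: e; have := weight_enc ((g', b) :: s).
  have := weight_enc ((h', d) :: t).
  by case: (enc _) => // -[n1 h1] c1; case: (enc _) => // -[n2 h2] c2 _ _ [-> -> ->].
by rewrite st; case: st => ->.
Qed.

Lemma wf_blk n g s : wf_flags s -> wf_flags (blk n g ++ s).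
Proof.
move=> ws; rewrite /blk; case: n => [|n] /=; first by rewrite ws.
by elim: n => [|[|n] IH] /=; rewrite ?ws ?eqxx ?andbT.
Qed.

Lemma encK s : wf_flags s -> dec (enc s) = s.
Proof.
move=> ws; apply: enc_inj => //; last by rewrite decK ?enc_pos.
elim: (enc s) => // x c IH; exact: wf_blk.
Qed.

Lemma cdat_cat k p u v : u != [::] ->
  (if v is y :: _ then (last y u).2 != y.2 else true) ->
  cdat k p (u ++ v) = cdat k p u ++ cdat k None v.
Proof.
case: u => // x u _; elim: u x p => [|y u IH] x p; last first.
  by move=> /(IH y (Some x)) e; rewrite [LHS]/= [RHS]/=; congr (_ :: _); apply: e.
rewrite /=.
case: v => [|y v] //= xy; rewrite xy (negbTE xy); congr ((_, _) :: (_, _) :: _).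
Qed.

(** Where the colour changes, a position is flagged in any case and the next one
    has no predecessor of its colour, so the flags can be computed block by
    block. *)
Lemma rainbow_cdat k w : cdat k None w =
  flatten [seq cdat k None (colour b.1 b.2) | b <- rainbow w].
Proof.
have [e r0 sr] := rainbowP w; rewrite -{1}e.
elim: (rainbow w) r0 sr {e} => //= -[v g] r IH /andP[v0 r0] sr.
rewrite /= cdat_cat.
- by rewrite IH // (path_sorted sr).
- by case: v v0 {sr}.
case: r {IH} r0 sr => // -[[|y v'] h] r //= _ /andP[gh _].
case: v v0 => // x v _ /=.
by elim: v x => //= x' v IH x; apply: IH.
Qed.

(** The flags computed by [cdat] for words of one colour; likewise, [encn] below
    corresponds to [enc]. *)
Fixpoint mdat k (p : option nat) (v : seq nat) : seq bool :=
  if v is x :: v' then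
    (if v' is y :: _ then k p x y else true) :: mdat k (Some x) v'
  else [::].

Lemma cdat_colour k v g :
  cdat k None (colour v g) = [seq (g, b) | b <- mdat k None v].
Proof.
suff H p : cdat k (omap (pair^~ g) p) (colour v g) = [seq (g, b) | b <- mdat k p v].
  exact: (H None).
elim: v p => //= x v IH p; rewrite (IH (Some x)); case: v {IH} => //= y v.
by rewrite eqxx; case: p => //= z; rewrite eqxx.
Qed.

Lemma size_mdat k p v : size (mdat k p v) = size v.
Proof. by elim: v p => //= x v IH p; rewrite IH. Qed.

Lemma nth_mdat k p v j : (j < size v)%N -> nth false (mdat k p v) j =
  (j.+1 == size v) ||
  k (if j is i.+1 then Some (nth 0%N v i) else p) (nth 0%N v j) (nth 0%N v j.+1).
Proof.
elim: v p j => // x v IH p [|j] /=; first by case: v {IH}.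
by rewrite ltnS => jv; rewrite IH // eqSS; case: j jv.
Qed.

Fixpoint encn (b : seq bool) : seq nat :=
  if b is b0 :: b' then
    if b0 then 1%N :: encn b' else
    if encn b' is n :: c then n.+1 :: c else [:: 1%N]
  else [::].

Lemma enc_colour b g : enc [seq (g, x) | x <- b] = colour (encn b) g.
Proof.
elim: b => //= -[|] b -> //; by case: (encn b).
Qed.

Lemma encn_run j b : encn (nseq j false ++ true :: b) = j.+1 :: encn b.
Proof. by elim: j => //= j ->. Qed.

(** The last position is flagged although it is not in the range 1, ..., n - 1
    of the descents and peaks. *)
Lemma comp_ofE (Q : pred nat) n : (0 < n)%N ->
  comp_of n [seq i <- iota 1 n.-1 | Q i] = encn (rcons (map Q (iota 1 n.-1)) true).
Proof.
case: n => // n _; rewrite /comp_of /=.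
suff H a m l : (a < l)%N ->
    pairmap (fun a b => (b - a)%N) a (rcons [seq i <- iota l m | Q i] (l + m)%N) =
    encn (nseq (l - a.+1) false ++ rcons (map Q (iota l m)) true).
  by rewrite -add1n H.
elim: m l a => [|m IH] l a al /=.
  by rewrite addn0 (encn_run _ [::]) subnSK.
case: (Q l) => /=.
  rewrite (encn_run _ (rcons _ _)) subnSK // -addSnnS IH ?subnn //.
rewrite -addSnnS IH 1?ltnW // subSS -(subnSK al); congr encn.
by rewrite -[false :: _]cat1s catA -(nseqD _ 1) addn1.
Qed.

Lemma letter_std v i : (0 < i <= size v)%N -> exists2 j : 'I_(size v),
  i = j.+1 & letter (std v) i = (std v j).+1.
Proof.
case: i => // i /= iv; exists (Ordinal iv) => //.
rewrite /letter /one_line (nth_map (Ordinal iv)) ?size_enum_ord //.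
by congr (nat_of_ord (std v _)).+1; apply: val_inj; rewrite /= nth_enum_ord.
Qed.

Lemma std_des v i j : (i < j < size v)%N ->
  (letter (std v) i.+1 > letter (std v) j.+1)%N = (nth 0%N v i > nth 0%N v j)%N.
Proof.
move=> /andP[ij jv]; have iv := ltn_trans ij jv.
have [oi oiE ->] := @letter_std v i.+1 iv; have [oj ojE ->] := @letter_std v j.+1 jv.
have /forallP/(_ oi)/forallP/(_ oj)/implyP := stdP v.
case: oiE ojE => ei [ej]; rewrite -ei -ej ij => /(_ isT)/eqP <-.
by rewrite ltnS.
Qed.

Lemma letter_neq v i j : (i < j < size v)%N ->
  letter (std v) i.+1 != letter (std v) j.+1.
Proof.
move=> /andP[ij jv]; have iv := ltn_trans ij jv.
have [oi [oiE] ->] := @letter_std v i.+1 iv; have [oj [ojE] ->] := @letter_std v j.+1 jv.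
rewrite eqSS; apply: contraTneq ij => /val_inj/perm_inj e.
by rewrite oiE ojE e ltnn.
Qed.

Lemma std_asc v i j : (i < j < size v)%N ->
  (letter (std v) i.+1 < letter (std v) j.+1)%N = (nth 0%N v i <= nth 0%N v j)%N.
Proof.
by move=> ij; have := std_des ij; have := letter_neq ij; lia.
Qed.

Lemma mdat_rcons k (Q : pred nat) v : v != [::] ->
  (forall j, (j.+1 < size v)%N ->
     Q j.+1 = k (if j is i.+1 then Some (nth 0%N v i) else None)
                (nth 0%N v j) (nth 0%N v j.+1)) ->
  rcons (map Q (iota 1 (size v).-1)) true = mdat k None v.
Proof.
move=> v0 HQ; have sv : (0 < size v)%N by rewrite lt0n size_eq0.
apply: (@eq_from_nth _ false).
  by rewrite size_rcons size_map size_iota size_mdat prednK.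
move=> j; rewrite size_rcons size_map size_iota prednK // => jv.
rewrite nth_mdat // nth_rcons size_map size_iota.
have [<-|nj] := eqVneq j.+1 (size v); first by rewrite /= ltnn eqxx.
have jv' : (j.+1 < size v)%N by rewrite ltn_neqAle nj.
have jm : (j < (size v).-1)%N by rewrite -ltnS prednK.
by rewrite jm (nth_map 0%N) ?size_iota // nth_iota // add1n HQ.
Qed.

Lemma peak_wordE v g : v != [::] ->
  colour (peak_word v) g = enc (cdat is_peak None (colour v g)).
Proof.
move=> v0; rewrite cdat_colour enc_colour -(mdat_rcons (Q := fun i =>
  [&& (1 < i)%N, (letter (std v) i.-1 < letter (std v) i)%N
    & (letter (std v) i > letter (std v) i.+1)%N])) //.
  by rewrite -comp_ofE // lt0n size_eq0.
move=> [|j] jv //=; rewrite std_asc ?std_des ?jv ?ltnSn //.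
exact: ltnW.
Qed.

Lemma descent_wordE v g : v != [::] ->
  colour (descent_word v) g = enc (cdat is_des None (colour v g)).
Proof.
move=> v0; rewrite cdat_colour enc_colour -(mdat_rcons (Q := fun i =>
  (letter (std v) i > letter (std v) i.+1)%N)) //.
  by rewrite -comp_ofE // lt0n size_eq0.
by move=> j jv; rewrite std_des // ltnSn.
Qed.

Lemma last_cdat k p w : last true (unzip2 (cdat k p w)).
Proof. by elim: w p => //= x [|y w] // IH p; apply: (IH (Some x)). Qed.

Lemma enc_flatten (I : Type) (r : seq I) (F : I -> flags) :
  (forall i, last true (unzip2 (F i))) ->
  enc (flatten [seq F i | i <- r]) = flatten [seq enc (F i) | i <- r].
Proof. by move=> lF; elim: r => //= i r IH; rewrite enc_cat // IH. Qed.

Lemma P_G_enc n (a : wreath gT n) : P_G a = enc (pdat (cw (colp a))).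
Proof.
rewrite /pdat rainbow_cdat enc_flatten => [|b]; last exact: last_cdat.
congr flatten; apply/eq_in_map => b br; apply: peak_wordE.
by have [_ /allP r0 _] := rainbowP (coloured_word a); apply: r0.
Qed.

Lemma D_G_enc n (a : wreath gT n) : D_G a = enc (cdat is_des None (cw (colp a))).
Proof.
rewrite rainbow_cdat enc_flatten => [|b]; last exact: last_cdat.
congr flatten; apply/eq_in_map => b br; apply: descent_wordE.
by have [_ /allP r0 _] := rainbowP (coloured_word a); apply: r0.
Qed.

(** A position is a peak iff it is a descent of its colour run and the
    preceding position of this run is not. *)
Lemma cdat_des_peak p p' w w' :
  (if p is Some x then cdat is_des None (x :: w) else cdat is_des None w) =
  (if p' is Some x then cdat is_des None (x :: w') else cdat is_des None w') ->
  (p == None) = (p' == None) ->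
  cdat is_peak p w = cdat is_peak p' w'.
Proof.
elim: w w' p p' => [|x w IH] [|x' w'] [z|] [z'|] //= + pp //.
- move=> [-> e1 e2 e3 e4]; rewrite e2; congr ((_, _) :: _); last first.
    by apply: IH => //=; congr ((_, _) :: _); [exact: e2 | exact: e3 | exact: e4].
  case: w w' e3 e4 {IH} => [|y w] [|y' w'] //= e3 [e4 _ _].
  move: e1 e3; rewrite e2 e4 /is_des; case: eqP => //= _; case: eqP => //= _.
  by move=> e1 e3; rewrite e3 (leqNgt z.1) (leqNgt z'.1) e1.
move=> [e1 e3 e4]; rewrite e1; congr ((_, _) :: _); last first.
  by apply: IH => //=; congr ((_, _) :: _); [exact: e1 | exact: e3 | exact: e4].
by case: w w' e3 e4 {IH} => [|y w] [|y' w'] //= _ [-> _ _].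
Qed.

Lemma D_G_P_G n m (a : wreath gT n) (b : wreath gT m) :
  D_G a = D_G b -> P_G a = P_G b.
Proof.
rewrite !D_G_enc !P_G_enc => /enc_inj e; congr enc.
by apply: cdat_des_peak => //; apply: e; apply: wf_cdat.
Qed.

Lemma pdat_pat w w' : pat w = pat w' -> pdat w = pdat w'.
Proof.
suff H p p' : (if p is Some x then pat (x :: w) else pat w) =
    (if p' is Some x then pat (x :: w') else pat w') ->
    (p == None) = (p' == None) -> cdat is_peak p w = cdat is_peak p' w'.
  by move=> e; apply: H.
elim: w w' p p' => [|x w IH] [|x' w'] [z|] [z'|] //= + pp //.
- move=> [-> e1 e2 e3 e4 e5]; rewrite e3; congr ((_, _) :: _); last first.
    by apply: IH => //=; rewrite e3 e4 e5.
  case: w w' e4 e5 {IH e2} => [|y w] [|y' w'] //= [e4 _] [-> _ _].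
  by case: eqP => //= _; case: eqP => //= _; rewrite e4 (leqNgt z.1) (leqNgt z'.1) e1.
move=> [e1 e3 e4]; rewrite e1; congr ((_, _) :: _); last first.
  by apply: IH => //=; rewrite e1 e3 e4.
by case: w w' e3 e4 {IH} => [|y w] [|y' w'] //= _ [-> _ _]; rewrite !orbF.
Qed.

(** Only the first flag of w depends on the letter before w.  For a word of
    length at least two whose first letter is no longer preceded by a letter,
    this flag depends on the colours alone, which are part of the data. *)
Lemma cdat_forget p p' w w' :
  cdat is_peak p w = cdat is_peak p' w' -> pdat w = pdat w'.
Proof.
rewrite /pdat; case: w w' => [|x w] [|x' w'] //= [-> e1 e2]; rewrite e2.
congr ((_, _) :: _).
by case: w w' e1 e2 => [|y w] [|y' w'] //= _ [-> _ _]; rewrite !orbF.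
Qed.

(** A flag of w inside a prefix or a suffix is a flag of the latter, and at its
    ends the flags are settled by the colours; this is what makes the peak
    classes a subalgebra. *)
Lemma pdat_take n w w' : pdat w = pdat w' -> pdat (take n w) = pdat (take n w').
Proof.
suff H p p' : cdat is_peak p w = cdat is_peak p' w' ->
  cdat is_peak p (take n w) = cdat is_peak p' (take n w') by apply: H.
elim: n w w' p p' => [|n IH] [|x w] [|x' w'] p p' //= [-> e1 e2].
congr ((_, _) :: _); last exact: IH.
by case: n w w' e1 e2 {IH} => [|n] [|y w] [|y' w'] //= -> .
Qed.

Lemma pdat_drop n w w' : pdat w = pdat w' -> pdat (drop n w) = pdat (drop n w').
Proof.
elim: n w w' => [|n IH] [|x w] [|x' w'] //= [_ _ /cdat_forget]; exact: IH.
Qed.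

Lemma size_pdat w : size (pdat w) = size w.
Proof. exact: size_cdat. Qed.

End CutData.

(** * The peak subspace as a space of functions *)

(** The coefficient of S e is the value of X at any point of its support that
    lies over e.  This recognizes the span of class sums as the space of the
    functions that are constant on classes. *)
Lemma class_expansion (K : fieldType) (T : choiceType) (E : eqType) (q : T -> E)
    (S : E -> {malg K[T]}) (X : {malg K[T]}) :
  (forall e b, e \in [seq q a | a <- msupp X] -> (S e)@_b = (q b == e)%:R) ->
  (forall a b, q a = q b -> X@_a = X@_b) ->
  exists val : E -> K, X = \sum_(e <- undup [seq q a | a <- msupp X]) val e *: S e.
Proof.
move=> SE qX.
exists (fun e => if [seq a <- msupp X | q a == e] is a :: _ then X@_a else 0).
apply/malgP => b; rewrite raddf_sum /=.
have SE' e : e \in undup [seq q a | a <- msupp X] -> (S e)@_b = (q b == e)%:R.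
  by rewrite mem_undup; apply: SE.
under eq_big_seq => e eL do rewrite mcoeffZ (SE' e eL).
case: (boolP (q b \in [seq q a | a <- msupp X])) => bL.
  rewrite (bigD1_seq (q b)) ?mem_undup ?undup_uniq //= big1 ?addr0 => [|e eb].
    rewrite eqxx mulr1; case Eb: [seq a <- _ | _] => [|a s].
      case/mapP: bL => a aX ba; have : a \in [seq a <- msupp X | q a == q b].
        by rewrite mem_filter aX ba eqxx.
      by rewrite Eb.
    have : a \in [seq a <- msupp X | q a == q b] by rewrite Eb mem_head.
    by rewrite mem_filter => /andP[/eqP ab _]; apply: qX.
  by rewrite eq_sym (negbTE eb) mulr0.
rewrite big1_seq => [|e /andP[_]]; last first.
  rewrite mem_undup => eL; case: eqP => [be|_]; last by rewrite mulr0.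
  by rewrite be eL in bL.
by apply: mcoeff_outdom; apply: contra bL; apply: map_f.
Qed.

Section PeakSpace.
Context {K : fieldType} {gT : finGroupType}.
Local Notation word := (seq (nat * gT)).
Local Notation KG := {malg K[colperm gT]}.
Local Notation KG2 := {malg K[(colperm gT * colperm gT)%type]}.
Local Notation "x ** y" := (kmul x y) (at level 40, left associativity).
Local Notation Delta := (@kdelta K gT).
Implicit Types (w u v : word) (a b : colperm gT) (x y z : KG) (X Y : KG2).
Implicit Types (c d : seq (nat * gT)).

Definition peak_const x := forall w w', pdat w = pdat w' -> cf x w = cf x w'.

Definition homog n x := forall w, size w != n -> cf x w = 0.

Lemma weight_P_G n (a : wreath gT n) : weight (P_G a) = n.
Proof. by rewrite P_G_enc weight_enc size_pdat size_cw. Qed.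

Lemma weight_D_G n (a : wreath gT n) : weight (D_G a) = n.
Proof. by rewrite D_G_enc weight_enc size_cdat size_cw. Qed.

Lemma P_G_Gcomp n (a : wreath gT n) : is_Gcomp n (P_G a).
Proof. by rewrite /is_Gcomp weight_P_G eqxx P_G_enc enc_pos. Qed.

Lemma D_G_Gcomp n (a : wreath gT n) : is_Gcomp n (D_G a).
Proof. by rewrite /is_Gcomp weight_D_G eqxx D_G_enc enc_pos. Qed.

(** The sum ranges over one degree only, but the statistic st determines the
    degree. *)
Lemma mcoeff_class_sum (st : forall n, wreath gT n -> seq (nat * gT))
    (wst : forall n (a : wreath gT n), weight (st n a) = n) c b :
  (\sum_(a : wreath gT (weight c) | st _ a == c) << colp a >> : KG)@_b =
  (st _ (tagged b) == c)%:R.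
Proof.
rewrite raddf_sum /=; under eq_bigr do rewrite mcoeffU.
have [tb|tb] := eqVneq (tag b) (weight c); last first.
  rewrite big1 => [|a _]; last by case: eqP => // e; rewrite -e eqxx in tb.
  by case: eqP => // e; rewrite -e wst eqxx in tb.
have [{tb}a ->] := colp_cast tb.
under eq_bigr do rewrite colp_eq.
rewrite big_mkcond (bigD1 a) //= eqxx big1 ?addr0 => [|a' /negbTE->].
  by case: (st _ a == c).
by case: ifP.
Qed.

Lemma mcoeff_p_G c b : (p_G K c)@_b = (P_G (tagged b) == c)%:R.
Proof. exact: (mcoeff_class_sum weight_P_G). Qed.

Lemma mcoeff_d_G c b : (d_G K c)@_b = (D_G (tagged b) == c)%:R.
Proof. exact: (mcoeff_class_sum weight_D_G). Qed.

Lemma cf_p_G c w : cf (p_G K c) w = (enc (pdat w) == c)%:R.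
Proof.
rewrite /cf mcoeff_p_G P_G_enc -[cw _]/(cw (cstd w)).
by rewrite (pdat_pat (pat_cstd w)).
Qed.

Lemma P_G_cw a : P_G (tagged a) = enc (pdat (cw a)).
Proof. by case: a => n a; rewrite P_G_enc. Qed.

Lemma peak_constP x :
  peak_const x <-> forall a b, P_G (tagged a) = P_G (tagged b) -> x@_a = x@_b.
Proof.
split=> [px a b|px w w' e].
  rewrite !P_G_cw => /enc_inj e; rewrite -!cf_cw; apply: px.
  by apply: e; apply: wf_cdat.
apply: px; rewrite !P_G_cw; congr enc.
by rewrite !(pdat_pat (pat_cstd _)).
Qed.

Lemma homogP n x : homog n x <-> forall a, tag a != n -> x@_a = 0.
Proof.
split=> [hx a an|hx w wn]; first by rewrite -cf_cw hx ?size_cw.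
by apply: hx; rewrite tag_cstd.
Qed.

Lemma peak_const_subspace : subspace peak_const.
Proof.
split=> [w w' _|k x y px py w w' e]; first by rewrite /cf !mcoeff0.
by rewrite !cfD !cfZ (px _ _ e) (py _ _ e).
Qed.

Lemma homog_subspace n : subspace (homog n).
Proof.
split=> [w _|k x y hx hy w wn]; first by rewrite /cf mcoeff0.
by rewrite cfD cfZ hx // hy // mulr0 addr0.
Qed.

Lemma peak_const_p_G c : peak_const (p_G K c).
Proof. by move=> w w' e; rewrite !cf_p_G e. Qed.

Lemma homog_p_G c : homog (weight c) (p_G K c).
Proof.
move=> w wn; rewrite cf_p_G; case: eqP => // e.
by rewrite -e weight_enc size_pdat eqxx in wn.
Qed.

Lemma msupp_tag n x a : homog n x -> a \in msupp x -> tag a = n.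
Proof.
move=> /homogP hx; rewrite -mcoeff_neq0 => xa.
by apply/eqP; apply: contraR xa => an; rewrite hx.
Qed.

Lemma Peak_grP n x : Peak_gr n x <-> peak_const x /\ homog n x.
Proof.
split=> [|[/peak_constP px hx]].
  have sA : subspace (fun x => peak_const x /\ homog n x).
    split; first by split; [case: peak_const_subspace | case: (homog_subspace n)].
    move=> k y z [py hy] [pz hz]; split; last by case: (homog_subspace n) => _; apply.
    by case: peak_const_subspace => _; apply.
  apply: (span_min sA) => _ [c /andP[_ /eqP cn] ->].
  by split; [apply: peak_const_p_G | rewrite -cn; apply: homog_p_G].
have [|//|val {1}->] := @class_expansion _ _ _ (fun a => P_G (tagged a)) (@p_G K gT) x.
  by move=> e b _; rewrite mcoeff_p_G.
apply: subspace_sum => [|e]; first exact: span_subspace.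
rewrite mem_undup => /mapP[a ax ->] _; apply: subspaceZ; first exact: span_subspace.
apply: span_gen; exists (P_G (tagged a)) => //.
by rewrite -(msupp_tag hx ax) P_G_Gcomp.
Qed.

(** Descents determine peaks, so a function of the peak data is a function of
    the descent data. *)
Lemma Peak_Sigma_gr n x : Peak_gr n x -> Sigma_gr n x.
Proof.
move=> /Peak_grP[/peak_constP px hx].
have [||val {1}->] := @class_expansion _ _ _ (fun a => D_G (tagged a)) (@d_G K gT) x.
- by move=> e b _; rewrite mcoeff_d_G.
- by move=> a b /D_G_P_G/px.
apply: subspace_sum => [|e]; first exact: span_subspace.
rewrite mem_undup => /mapP[a ax ->] _; apply: subspaceZ; first exact: span_subspace.
apply: span_gen; exists (D_G (tagged a)) => //.
by rewrite -(msupp_tag hx ax) D_G_Gcomp.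
Qed.

(** The homogeneous components of a function of the peak data are of the same
    kind, since the peak data determine the length. *)
Lemma PeakP x : Peak x <-> peak_const x.
Proof.
split=> [[n [y [Py ->]]]|px].
  apply: subspace_sum => [|i _ _]; first exact: peak_const_subspace.
  by case/Peak_grP: (Py i).
pose y n : KG := lext (fun a => if tag a == n then << a >> else 0) x.
have yE n w : cf (y n) w = if size w == n then cf x w else 0.
  rewrite /cf mcoeff_lext -[x@_(cstd w)]sum_msupp_eq.
  have [wn|wn] := eqVneq (size w) n.
    apply: eq_bigr => a _; congr (_ * _); case: (eqVneq a (cstd w)) => [->|aw].
      by rewrite tag_cstd wn eqxx mcoeffUU.
    by case: ifP; rewrite ?mcoeff0 // mcoeffU (negbTE aw).
  rewrite big1 // => a _; case: eqP => [an|_]; last by rewrite mcoeff0 mulr0.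
  rewrite mcoeffU; case: eqP => [aw|_]; last by rewrite mulr0.
  by rewrite -an aw tag_cstd eqxx in wn.
exists (\max_(a <- msupp x) tag a).+1, y; split=> [n|].
  apply/Peak_grP; split=> [w w' e|w wn]; last by rewrite yE (negbTE wn).
  by rewrite !yE (px _ _ e) -(size_pdat w) e size_pdat.
apply: cf_ext => w; rewrite cf_sum.
rewrite (eq_bigr (fun i : 'I__ => if size w == i then cf x w else 0)); last first.
  by move=> i _; apply: yE.
have [wx|wx] := boolP (cstd w \in msupp x); last first.
  rewrite big1 => [|i _]; first by rewrite /cf mcoeff_outdom.
  by rewrite /cf (mcoeff_outdom wx) if_same.
have lt : (size w < (\max_(a <- msupp x) tag a).+1)%N.
  rewrite ltnS -tag_cstd.
  exact: (@leq_bigmax_seq _ _ predT (fun a : colperm gT => tag a) (cstd w)).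
rewrite (bigD1 (Ordinal lt)) //= eqxx big1 ?addr0 // => i wi.
by case: eqP => // e; case/eqP: wi; apply: val_inj.
Qed.

Lemma Peak_gr_Peak n x : Peak_gr n x -> Peak x.
Proof. by move=> /Peak_grP[px _]; apply/PeakP. Qed.

Lemma peak_const_one : peak_const (KG_one K gT).
Proof. by move=> w w' e; rewrite !cf_one /nilp -(size_pdat w) e size_pdat. Qed.

Lemma homog_one : homog 0 (KG_one K gT).
Proof. by move=> w wn; rewrite cf_one /nilp (negbTE wn). Qed.

Lemma sum_splits_pdat w w' (F : word -> word -> K) :
  (forall u1 u2 v1 v2, pdat u1 = pdat v1 -> pdat u2 = pdat v2 -> F u1 u2 = F v1 v2) ->
  pdat w = pdat w' ->
  \sum_(p <- splits w) F p.1 p.2 = \sum_(p <- splits w') F p.1 p.2.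
Proof.
move=> HF e; rewrite !splitsE !big_map.
rewrite (_ : size w' = size w); last by rewrite -!size_pdat e.
by apply: eq_bigr => i _; apply: HF; [apply: pdat_take | apply: pdat_drop].
Qed.

Lemma peak_const_mul x y : peak_const x -> peak_const y -> peak_const (x ** y).
Proof.
move=> px py w w' e; rewrite !cf_mul.
apply: (sum_splits_pdat (F := fun u v => cf x u * cf y v)) => //.
by move=> u1 u2 v1 v2 e1 e2; rewrite (px _ _ e1) (py _ _ e2).
Qed.

Lemma homog_mul n m x y : homog n x -> homog m y -> homog (n + m)%N (x ** y).
Proof.
move=> hx hy w wnm; rewrite cf_mul big1_seq // => p /andP[_ /splits_mem pw].
have [pn|pn] := eqVneq (size p.1) n; last by rewrite hx ?mul0r.
rewrite [cf y _]hy ?mulr0 //; apply: contraNneq wnm => pm.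
by rewrite -pw size_cat pn pm.
Qed.

(** The analogue of [peak_const] and [homog] in the tensor square of K[G]. *)
Definition peak_const2 n X :=
  (forall u u' v v', pdat u = pdat u' -> pdat v = pdat v' ->
     X@_(cstd u, cstd v) = X@_(cstd u', cstd v')) /\
  (forall u v, (size u + size v)%N != n -> X@_(cstd u, cstd v) = 0).

Lemma peak_const2_span n X : peak_const2 n X ->
  span (fun t => exists i j y z,
    [/\ (i + j)%N = n, Peak_gr i y, Peak_gr j z & t = tens y z]) X.
Proof.
move=> [cX hX]; set A := span _.
have sA : subspace A by apply: span_subspace.
pose q (p : colperm gT * colperm gT) := (P_G (tagged p.1), P_G (tagged p.2)).
have [||val {1}->] := @class_expansion K _ _ q (fun e => tens (p_G K e.1) (p_G K e.2)) X.
- move=> -[c d] b _; rewrite mcoeff_tens !mcoeff_p_G /q xpair_eqE.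
  by rewrite -natrM mulnb.
- move=> [a b] [a' b']; rewrite /q /= !P_G_cw => -[/enc_inj ea /enc_inj eb].
  rewrite -[a]cwK -[b]cwK -[a']cwK -[b']cwK; apply: cX.
    by apply: ea; apply: wf_cdat.
  by apply: eb; apply: wf_cdat.
apply: subspace_sum => // e; rewrite mem_undup => /mapP[[a b] ab ->] _.
apply: subspaceZ => //; apply: span_gen.
exists (tag a), (tag b), (p_G K (P_G (tagged a))), (p_G K (P_G (tagged b))).
split=> //.
- move: ab; rewrite -mcoeff_neq0 -[a in X@_(a, _)]cwK -[b in X@_(_, b)]cwK => ab.
  by apply/eqP; apply: contraR ab => ab; rewrite hX ?size_cw.
- by apply: span_gen; exists (P_G (tagged a)) => //; apply: P_G_Gcomp.
by apply: span_gen; exists (P_G (tagged b)) => //; apply: P_G_Gcomp.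
Qed.

Lemma peak_const2_mul n m X Y : peak_const2 n X -> peak_const2 m Y ->
  peak_const2 (n + m)%N (ktens X Y).
Proof.
move=> [cX hX] [cY hY]; split=> [u u' v v' eu ev|u v uv]; rewrite !mcoeff_ktens.
  rewrite (sum_splits_pdat (w' := u') (F := fun s t => \sum_(q <- splits v)
    X@_(cstd s, cstd q.1) * Y@_(cstd t, cstd q.2))) //; last first.
    move=> s s' t t' e1 e2; apply: eq_bigr => q _.
    by rewrite (cX _ _ _ _ e1 erefl) (cY _ _ _ _ e2 erefl).
  apply: eq_bigr => p _.
  apply: (sum_splits_pdat (F := fun s t =>
    X@_(cstd p.1, cstd s) * Y@_(cstd p.2, cstd t))) => //.
  by move=> s s' t t' e1 e2; rewrite (cX _ _ _ _ erefl e1) (cY _ _ _ _ erefl e2).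
rewrite big1_seq // => p /andP[_ /splits_mem pu].
rewrite big1_seq // => q /andP[_ /splits_mem qv].
have [pn|pn] := eqVneq (size p.1 + size q.1)%N n; last by rewrite hX ?mul0r.
rewrite [Y@_ _]hY ?mulr0 //; apply: contraNneq uv => pm.
by rewrite -pu -qv !size_cat addnACA pn pm.
Qed.

End PeakSpace.

(** * The peakless sums *)

Lemma perm_shuf (T : eqType) (u v : seq T) : perm_eq (shuf u v) (shuf v u).
Proof.
elim: u v => [|x u IHu] v; first by rewrite shufs0.
elim: v => [|y v IHv]; first by rewrite shufs0.
by rewrite !shuf_cons perm_catC perm_cat // perm_map.
Qed.

Section Generators.
Context {K : fieldType} {gT : finGroupType}.
Local Notation word := (seq (nat * gT)).
Local Notation KG := {malg K[colperm gT]}.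
Local Notation "x ** y" := (kmul x y) (at level 40, left associativity).
Local Notation Delta := (@kdelta K gT).
Implicit Types (w u v : word) (a b : colperm gT) (x y z : KG) (g : gT).
Implicit Types (f h : word -> K) (r : rel nat).

(** The product of K[G] in the dual picture, for functions on all words; these
    need not be of finite support and serve as generating series, the length
    of the word being the exponent of t. *)
Definition conv f h w : K := \sum_(p <- splits w) f p.1 * h p.2.

(** For r strictly decreasing and weakly increasing, these are the terms of the
    series Lambda(t) and S(t). *)
Definition mono r g w : bool :=
  all (fun l => l.2 == g) w && sorted (fun l m => r l.1 m.1) w.

(** These are the words of colour g that first decrease and then increase. *)
Definition vee g w : bool := pdat w == blk (size w) g.

(** The series Q(t) = 1 + 2 q_1 t + 2 q_2 t^2 + ... *)
Definition veeQ g w : K := if w is [::] then 1 else (vee g w)%:R *+ 2.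

(** The substitution of - t for t. *)
Definition sgn f w : K := (-1) ^+ size w * f w.

Lemma conv_cons f h l w :
  conv f h (l :: w) = f [::] * h (l :: w) + conv (fun u => f (l :: u)) h w.
Proof. exact: sum_splits_cons. Qed.

Lemma conv_assoc f h k w : conv f (conv h k) w = conv (conv f h) k w.
Proof.
rewrite /conv; under eq_bigr do rewrite big_distrr /=.
under [RHS]eq_bigr do rewrite big_distrl /=.
rewrite (splits_assoc w (fun s t u => f s * h t * k u)).
by apply: eq_bigr => p _; apply: eq_bigr => q _; rewrite mulrA.
Qed.

Lemma eq_conv f f' h h' : f =1 f' -> h =1 h' -> conv f h =1 conv f' h'.
Proof. by move=> ef eh w; apply: eq_bigr => p _; rewrite ef eh. Qed.

Lemma conv1f f w : conv (fun u => (nilp u)%:R) f w = f w.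
Proof.
case: w => [|l w]; first by rewrite /conv big_seq1 mul1r.
rewrite conv_cons mul1r /conv big1 ?addr0 // => p _; exact: mul0r.
Qed.

Lemma conv_sgn f h w : conv (sgn f) (sgn h) w = sgn (conv f h) w.
Proof.
rewrite /conv /sgn big_distrr /=; apply: eq_big_seq => p /splits_mem <-.
by rewrite size_cat exprD; ring.
Qed.

Lemma mono_cons2 r g l m w :
  mono r g (l :: m :: w) = [&& l.2 == g, r l.1 m.1 & mono r g (m :: w)].
Proof.
rewrite /mono /=.
by case: (l.2 == g); case: (m.2 == g); case: (r _ _); rewrite /= ?andbF.
Qed.

(** This is Lambda(t) S(-t) = 1.  A word which is first r-monotone and then
    anti-r-monotone can be cut before or after its turning letter; the two
    terms have opposite signs and cancel. *)
Lemma conv_mono_sgn r g w :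
  conv (fun u => (mono r g u)%:R) (sgn (fun u => (mono (fun i j => ~~ r i j) g u)%:R)) w =
  (nilp w)%:R.
Proof.
set r' := fun i j => ~~ r i j.
case: w => [|l w]; first by rewrite /conv big_seq1 /sgn /= !mul1r.
suff H : conv (fun u => (mono r g (l :: u))%:R) (sgn (fun u => (mono r' g u)%:R)) w =
    (-1) ^+ size w * (mono r' g (l :: w))%:R.
  by rewrite conv_cons H mul1r /sgn /= exprS; ring.
elim: w l => [|m w IH] l.
  by rewrite /conv big_seq1 /sgn /= /mono /= !mul1r mulr1.
rewrite conv_cons.
have -> : conv (fun u => (mono r g (l :: m :: u))%:R) (sgn (fun u => (mono r' g u)%:R)) w =
    ((l.2 == g) && r l.1 m.1)%:R *
    conv (fun u => (mono r g (m :: u))%:R) (sgn (fun u => (mono r' g u)%:R)) w.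
  rewrite /conv big_distrr /=; apply: eq_bigr => p _.
  by rewrite mono_cons2 andbA mulrA -natrM mulnb.
rewrite IH mono_cons2 /sgn /r' [mono r g [:: l]]/mono /= !andbT exprS.
by case: (l.2 == g); case: (r l.1 m.1); rewrite /= ?mul1r ?mul0r ?mulr0; ring.
Qed.

Lemma cdat_cons2 k p (l m : nat * gT) w : cdat k p (l :: m :: w) =
  (l.2, (l.2 != m.2) || k (same_colour p l) l.1 m.1) :: cdat k (Some l) (m :: w).
Proof. by []. Qed.

Lemma blkSS n g : blk n.+2 g = (g, false) :: blk n.+1 g.
Proof. by []. Qed.

Lemma cdat_blk_head k p (m : nat * gT) w n g :
  cdat k p (m :: w) == blk n g -> m.2 == g.
Proof. by case: n => [|[|n]]; rewrite /blk /= eqseq_cons xpair_eqE => /andP[/andP[]]. Qed.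

Lemma rise_blk l m w g : (l.1 <= m.1)%N -> l.2 = g ->
  (cdat is_peak (Some l) (m :: w) == blk (size w).+1 g) = mono leq g (m :: w).
Proof.
elim: w l m => [|m' w IH] l m lm lg.
  by rewrite /blk /mono /= eqseq_cons xpair_eqE !andbT.
rewrite cdat_cons2 [size _]/= blkSS eqseq_cons xpair_eqE mono_cons2 eqbF_neg.
rewrite negb_or negbK; have [mg|//] := eqVneq m.2 g.
have -> : is_peak (same_colour (Some l) m) m.1 m'.1 = (m'.1 < m.1)%N.
  by rewrite /is_peak /same_colour lg mg eqxx lm.
rewrite -leqNgt mg andTb; have [le|_] := leqP m.1 m'.1; last by rewrite andbF.
rewrite andbT andTb IH //; apply: andb_idl.
by rewrite /mono /= => /andP[/andP[/eqP-> _] _].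
Qed.

(** A peakless word that does not descend at its first letter must increase
    throughout. *)
Lemma vee_cons2 g l m w : vee g (l :: m :: w) =
  (l.2 == g) && (if (m.1 < l.1)%N then vee g (m :: w) else mono leq g (m :: w)).
Proof.
rewrite /vee /pdat cdat_cons2 [size (l :: _)]/= blkSS eqseq_cons xpair_eqE orbF.
rewrite eqbF_neg negbK -andbA; have [lg|//] := eqVneq l.2 g.
have [ml|lm] := ltnP m.1 l.1; last first.
  rewrite rise_blk // andTb lg; apply: andb_idl.
  by rewrite /mono /= => /andP[/andP[/eqP-> _] _].
have -> : cdat is_peak (Some l) (m :: w) = cdat is_peak None (m :: w).
  case: w => // m' w; rewrite !cdat_cons2; congr ((_, _ || _) :: _).
  by rewrite /=; case: eqP => //= _; rewrite leqNgt ml.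
by rewrite andTb lg; apply: andb_idl => /cdat_blk_head/eqP->.
Qed.

(** A nonempty peakless word of colour g is a strictly decreasing word followed by
    a weakly increasing one in exactly two ways: its minimum may go to either. *)
Lemma conv_dec_inc g w :
  conv (fun u => (mono gtn g u)%:R) (fun u => (mono leq g u)%:R) w = veeQ g w.
Proof.
case: w => [|l w]; first by rewrite /conv big_seq1 mulr1.
suff H : conv (fun u => (mono gtn g (l :: u))%:R) (fun u => (mono leq g u)%:R) w =
    (vee g (l :: w))%:R *+ 2 - (mono leq g (l :: w))%:R.
  by rewrite conv_cons H mul1r addrC subrK.
elim: w l => [|m w IH] l.
  rewrite /conv big_seq1 /mono /= !andbT mulr1 /vee /pdat /blk /=.
  by rewrite eqseq_cons xpair_eqE eqxx !andbT mulr2n addrK.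
rewrite conv_cons.
have -> : conv (fun u => (mono gtn g (l :: m :: u))%:R) (fun u => (mono leq g u)%:R) w =
    ((l.2 == g) && (m.1 < l.1)%N)%:R *
    conv (fun u => (mono gtn g (m :: u))%:R) (fun u => (mono leq g u)%:R) w.
  rewrite /conv big_distrr /=; apply: eq_bigr => p _.
  by rewrite mono_cons2 andbA mulrA -!natrM !mulnb.
rewrite IH vee_cons2 mono_cons2 [mono gtn g [:: l]]/mono /= andbT (leqNgt l.1).
case: (l.2 == g); rewrite /= ?mul0r ?addr0 ?mul0rn ?subr0 //.
by case: (m.1 < l.1)%N; rewrite /= ?mul1r ?mul0r; ring.
Qed.

(** This is Q(t) Q(-t) = Lambda(t) S(t) Lambda(-t) S(-t) = 1. *)
Lemma conv_veeQ_sgn g w : conv (veeQ g) (sgn (veeQ g)) w = (nilp w)%:R.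
Proof.
set lam := fun u => (mono gtn g u)%:R : K; set sig := fun u => (mono leq g u)%:R : K.
have eQ : veeQ g =1 conv lam sig by move=> u; rewrite conv_dec_inc.
rewrite (eq_conv (f' := conv lam sig) (h' := conv (sgn lam) (sgn sig))) //; last first.
  by move=> u; rewrite conv_sgn /sgn eQ.
rewrite -conv_assoc (eq_conv (f' := lam) (h' := sgn sig)) // => [|u].
  rewrite -[RHS](conv_mono_sgn gtn g); apply: eq_conv => // u.
  congr (_ * _%:R); congr nat_of_bool; rewrite /mono; congr (_ && _).
  by apply: eq_sorted => l m /=; rewrite -leqNgt.
rewrite conv_assoc -[RHS]conv1f; apply: eq_conv => // u'.
rewrite -(conv_mono_sgn leq g); apply: eq_conv => // u''.
congr (_ * _%:R); congr nat_of_bool; rewrite /mono; congr (_ && _).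
by apply: eq_sorted => l m /=; rewrite -ltnNge.
Qed.

(** Under [mcoeff_delta] this says that the series f is grouplike for the
    coproduct of K[G]. *)
Definition grouplike f := forall u v, below u v ->
  \sum_(w <- shuf u v) f w = f u * f v.

Lemma grouplike_conv f h : grouplike f -> grouplike h -> grouplike (conv f h).
Proof.
move=> Gf Gh u v buv; rewrite /conv (shuf_splits u v (fun s t => f s * h t)).
rewrite big_distrlr /=; apply: eq_big_seq => p /splits_mem pu.
apply: eq_big_seq => q /splits_mem qv.
have /and4P[b1 _ _ b2] : [&& below p.1 q.1, below p.1 q.2, below p.2 q.1 & below p.2 q.2].
  by move: buv; rewrite /below -pu -qv allrel_catl !allrel_catr => /andP[/andP[-> ->] /andP[-> ->]].
by rewrite -big_distrlr Gf // Gh //=; ring.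
Qed.

(** A monotone shuffle takes all letters of u before those of v. *)
Lemma shuf_mono r g u v : transitive r ->
  allrel (fun l m : nat * gT => r l.1 m.1 && ~~ r m.1 l.1) u v ->
  \sum_(w <- shuf u v) (mono r g w)%:R = (mono r g u)%:R * (mono r g v)%:R :> K.
Proof.
move=> tr; have monoE l w : mono r g (l :: w) =
    [&& l.2 == g, all (fun m => r l.1 m.1) w & mono r g w].
  rewrite /mono /= path_sortedE => [|? ? ?]; last exact: tr.
  by rewrite -!andbA; case: (l.2 == g); case: (all _ _); case: (all _ _).
elim: u v => [|l u IHu] v; first by rewrite big_seq1 mul1r.
elim: v => [|m v IHv]; first by rewrite shufs0 big_seq1 mulr1.
move=> uv; rewrite shuf_cons big_cat !big_map /=.
have ulv : allrel (fun l m : nat * gT => r l.1 m.1 && ~~ r m.1 l.1) u (m :: v).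
  by move: uv; rewrite allrel_consl => /andP[].
have lmv : all (fun m => r l.1 m.1) (m :: v).
  move: uv; rewrite allrel_consl => /andP[lmv _]; apply: sub_all lmv.
  by move=> ? /andP[].
have rml : ~~ r m.1 l.1.
  by move: uv; rewrite allrel_consl => /andP[/= /andP[/andP[]]].
rewrite [X in _ + X]big1_seq ?addr0 => [|w /andP[_ win]]; last first.
  have wp : perm_eq w ((l :: u) ++ v) by apply: shuf_perm.
  by rewrite monoE (perm_all _ wp) /= (negbTE rml) andbF.
have -> : \sum_(w <- shuf u (m :: v)) (mono r g (l :: w))%:R =
    ((l.2 == g) && all (fun m => r l.1 m.1) u)%:R *
    \sum_(w <- shuf u (m :: v)) (mono r g w)%:R :> K.
  rewrite big_distrr /=; apply: eq_big_seq => w win; have wp := shuf_perm win.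
  by rewrite monoE (perm_all _ wp) all_cat lmv andbT andbA -natrM mulnb.
by rewrite IHu // mulrA -natrM mulnb (monoE l u) -andbA.
Qed.

(** Q = Lambda S is a product of grouplike series. *)
Lemma grouplike_veeQ g : grouplike (veeQ g).
Proof.
set lam := fun u => (mono gtn g u)%:R : K; set sig := fun u => (mono leq g u)%:R : K.
have eQ : veeQ g =1 conv lam sig by move=> u; rewrite conv_dec_inc.
move=> u v buv; under eq_bigr do rewrite eQ.
rewrite !eQ; apply: grouplike_conv => // {buv}u {}v buv.
  rewrite (perm_big _ (perm_shuf u v)) mulrC; apply: shuf_mono => [i j k ji ik|].
    exact: ltn_trans ik ji.
  rewrite allrelC; apply/allrelP => l m lu mv /=.
  by rewrite (allrelP buv) // -leqNgt ltnW // (allrelP buv).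
apply: shuf_mono; first exact: leq_trans.
apply/allrelP => l m lu mv; have lm : (l.1 < m.1)%N by apply: (allrelP buv).
by rewrite (ltnW lm) -ltnNge lm.
Qed.

(** * Consequences in K[G] *)

Lemma cf_mul_homog n x y w : homog n x ->
  cf (x ** y) w = cf x (take n w) * cf y (drop n w).
Proof.
move=> hx; rewrite cf_mul splitsE big_map.
have [nw|wn] := leqP n (size w); last first.
  rewrite hx ?mul0r; last by rewrite (take_oversize (ltnW wn)) neq_ltn wn.
  rewrite big1_seq // => i /andP[_]; rewrite mem_iota ltnS => /andP[_ iw].
  by rewrite hx ?mul0r //= size_takel // neq_ltn (leq_ltn_trans iw wn).
rewrite (bigD1_seq n) ?iota_uniq ?mem_iota ?ltnS //.
rewrite big1_seq => [|i /andP[ni]]; first by rewrite /= addr0.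
rewrite mem_iota ltnS => /andP[_ iw].
by rewrite hx ?mul0r //= size_takel.
Qed.

Definition qgen n g : KG := p_G K [:: (n, g)].

Lemma cf_qgen n g w : (0 < n)%N ->
  cf (qgen n g) w = ((size w == n) && vee g w)%:R.
Proof.
move=> n0; rewrite cf_p_G; congr (_%:R); congr nat_of_bool; rewrite /vee.
apply/eqP/andP => [e|[/eqP wn /eqP->]]; last first.
  by rewrite wn enc_blk.
have wn : size w = n by rewrite -(size_pdat w) -weight_enc e /weight /= addn0.
split; first by rewrite wn.
apply/eqP; rewrite wn -(enc_blk g n0) in e *.
apply: enc_inj e; first exact: wf_cdat.
by rewrite -[blk _ _]cats0; apply: wf_blk.
Qed.

Lemma veeQ_pdat g w w' : pdat w = pdat w' -> veeQ g w = veeQ g w'.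
Proof.
move=> e; have sw : size w = size w' by rewrite -size_pdat e size_pdat.
by case: w w' e sw => [|l w] [|l' w'] // e sw; rewrite /veeQ /vee e sw.
Qed.

Lemma cf_qgen_veeQ n g w : (0 < n)%N ->
  cf (qgen n g) w *+ 2 = if size w == n then veeQ g w else 0.
Proof.
move=> n0; rewrite cf_qgen //; case: eqP => [wn|_] /=; last by rewrite mul0rn.
by case: w wn => //= e; rewrite -e in n0.
Qed.

Context (two_neq0 : 2%:R != 0 :> K).

(** Half the component of degree n of the tensor square of the series Q, which
    is a function of the peak data in both arguments. *)
Lemma delta_qgen n g : (0 < n)%N -> peak_const2 n (Delta (qgen n g)).
Proof.
move=> n0.
have key u v : (Delta (qgen n g))@_(cstd u, cstd v) =
    if (size u + size v == n)%N then veeQ g u * veeQ g v / 2%:R else 0.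
  have e a b : (Delta (qgen n g))@_(a, b) =
      if (tag a + tag b == n)%N then veeQ g (cw a) * veeQ g (cw b) / 2%:R else 0.
    have bab := below_shift a b.
    rewrite -[a in LHS]cwK -[b in LHS]cwK -(cstd_shift (tag a) (cw b)) mcoeff_delta //.
    apply: (mulIf two_neq0); rewrite big_distrl /=.
    under eq_bigr do rewrite mulr_natr cf_qgen_veeQ //.
    have szw w : w \in shuf (cw a) (shift (tag a) (cw b)) ->
        size w = (tag a + tag b)%N.
      move=> win; have wp := shuf_perm win.
      by rewrite (perm_size wp) size_cat (size_map _ (cw b)) !size_cw.
    case: ifP => abn; last first.
      by rewrite mul0r big1_seq // => w /andP[_ win]; rewrite (szw _ win) abn.
    rewrite divfK //; under eq_big_seq => w win do rewrite (szw w win) abn.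
    rewrite grouplike_veeQ //; congr (_ * _).
    by apply: veeQ_pdat; apply: pdat_pat; rewrite pat_shift.
  have eQ w : veeQ g (cw (cstd w)) = veeQ g w.
    by apply: veeQ_pdat; apply: pdat_pat; rewrite pat_cstd.
  by rewrite e !tag_cstd !eQ.
split=> [u u' v v' eu ev|u v uv]; rewrite !key ?(negbTE uv) //.
rewrite -!(size_pdat u) -!(size_pdat v) eu ev !size_pdat.
by rewrite (veeQ_pdat g eu) (veeQ_pdat g ev).
Qed.

(** The coefficient of t^n in Q(t) Q(-t) = 1.  For n even its two extreme terms
    add up to 4 q_n, while the inner ones are 4 times the products of smaller
    generators with alternating signs. *)
Lemma qgen_even n g : (0 < n)%N -> ~~ odd n ->
  qgen n g = \sum_(i < n.-1) (-1) ^+ i *: (qgen i.+1 g ** qgen (n - i.+1)%N g).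
Proof.
case: n => // m _ om; apply: cf_ext => w; rewrite [RHS]cf_sum cf_qgen // -pred_Sn.
have homq i : (0 < i)%N -> homog i (qgen i g).
  by move=> i0 v vi; rewrite cf_qgen // (negbTE vi).
have [wn|wn] /= := eqVneq (size w) m.+1; last first.
  rewrite big1 // => i _; rewrite cfZ (homog_mul (homq _ _) (homq _ _)) ?mulr0 //.
    by rewrite subn_gt0 ltnS ltn_ord.
  by rewrite subnKC // ltnS ltnW.
(* The value of Q(t) Q(-t) = 1 at w. *)
have : \sum_(i < m.+2) veeQ g (take i w) * sgn (veeQ g) (drop i w) = 0.
  have := conv_veeQ_sgn g w; rewrite /conv splitsE big_map wn.
  have -> : nilp w = false by rewrite /nilp wn.
  by rewrite -[m.+2]subn0 -/(index_iota 0 m.+2) big_mkord subn0.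
have vQ v : (0 < size v)%N -> veeQ g v = (vee g v)%:R *+ 2 by case: v.
have w0 : (0 < size w)%N by rewrite wn.
rewrite big_ord_recl big_ord_recr /= take0 drop0 /bump /= add1n.
have om' : odd m by move: om; rewrite /= negbK.
rewrite (take_oversize (eq_leq wn)) (drop_oversize (eq_leq wn)).
rewrite (eq_bigr (fun i : 'I_m => - (4%:R *
    cf ((-1) ^+ i *: (qgen i.+1 g ** qgen (m.+1 - i.+1)%N g)) w))); last first.
  move=> i _; have im : (i < m.+1)%N by rewrite ltnS ltnW.
  have st : size (take i.+1 w) = i.+1 by rewrite size_takel ?wn.
  have sd : size (drop i.+1 w) = (m - i)%N by rewrite size_drop wn subSS.
  have mi : (0 < m - i)%N by rewrite subn_gt0.
  rewrite cfZ (cf_mul_homog _ _ (homq _ _)) // !cf_qgen ?subSS // st sd !eqxx /=.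
  rewrite /sgn !vQ ?st ?sd // -[(-1) ^+ (m - i)]signr_odd -[(-1) ^+ i]signr_odd.
  rewrite oddB 1?ltnW // om' addTb; case: (odd i) => /=; ring.
rewrite sumrN -big_distrr /= /sgn wn -signr_odd (negbTE om) /= !mulr1 !mul1r vQ //.
set V := (vee g w)%:R; set R := \sum_(i < m) _ => /eqP.
have -> : V *+ 2 + (- (4%:R * R) + V *+ 2) = 2%:R * (2%:R * (V - R)) by ring.
by rewrite !mulf_eq0 (negbTE two_neq0) /= subr_eq0 => /eqP.
Qed.

End Generators.

(** * The odd generators span the peak subspace *)

Section Spanning.
Context {K : fieldType} {gT : finGroupType}.
Local Notation word := (seq (nat * gT)).
Local Notation flags := (seq (gT * bool)).
Local Notation KG := {malg K[colperm gT]}.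
Local Notation "x ** y" := (kmul x y) (at level 40, left associativity).
Local Notation Delta := (@kdelta K gT).
Implicit Types (w u v : word) (a b : colperm gT) (x y z : KG) (g : gT).
Implicit Types (c d : seq (nat * gT)) (s t : flags).

Definition qmon c : KG := foldr (fun i x => qgen i.1 i.2 ** x) (KG_one K gT) c.

Definition posc c := all (fun i : nat * gT => 0 < i.1)%N c.

(** The support of [qmon c]: words that can be cut into peakless blocks of the
    sizes and colours in c. *)
Fixpoint fits c w : bool :=
  if c is (n, g) :: c' then
    [&& (n <= size w)%N, vee g (take n w) & fits c' (drop n w)]
  else nilp w.

Lemma homog_qgen n g : homog n (qgen n g : KG).
Proof. by have := @homog_p_G K _ [:: (n, g)]; rewrite /weight /= addn0. Qed.

Lemma cf_qmon c w : posc c -> cf (qmon c) w = (fits c w)%:R.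
Proof.
elim: c w => [|[n g] c IH] w /=; first by rewrite cf_one.
case/andP=> n0 cp; rewrite (cf_mul_homog _ _ (@homog_qgen n g)) cf_qgen // IH //.
rewrite size_take_min -natrM mulnb -andbA; congr (_ && _)%:R.
by rewrite -[LHS]/(minn n (size w) == n); apply/eqP/minn_idPl.
Qed.

Lemma weight_cons n g c : weight ((n, g) :: c) = (n + weight c)%N.
Proof. by []. Qed.

Lemma homog_qmon c : homog (weight c) (qmon c).
Proof.
elim: c => [|[n g] c IH]; first exact: homog_one.
by rewrite weight_cons; apply: homog_mul => //; apply: homog_qgen.
Qed.

Lemma peak_const_qmon c : peak_const (qmon c).
Proof.
elim: c => [|[n g] c IH] /=; first exact: peak_const_one.
by apply: peak_const_mul => //; apply: peak_const_p_G.
Qed.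

(** A position following a flagged one is not a peak, so cutting a word at its
    flagged positions preserves the remaining flags. *)
Lemma cdat_blk_cat p w n g s : cdat is_peak p w = blk n.+1 g ++ s ->
  exists u v, [/\ w = u ++ v, size u = n.+1, cdat is_peak p u = blk n.+1 g
    & pdat v = s].
Proof.
elim: n p w => [|n IH] p [|l w] //.
  move=> -[lg fl e]; exists [:: l], w; split=> //; first by rewrite /blk /= lg.
  rewrite -e; case: w fl {e} => // m w fl; rewrite /pdat /=; congr ((_, _) :: _).
  case: w => //= m' w; congr (_ || _); case: eqP fl => //= _ pk.
  by case: (same_colour p l) pk => //= z /andP[_ ml]; rewrite leqNgt ml.
move=> -[lg fl /IH[[|m u] [v [wE sz e ev]]]] //.
exists (l :: m :: u), v; rewrite wE; split=> //; first by rewrite /= -sz.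
by rewrite cdat_cons2 e blkSS; move: fl; rewrite wE /= => ->; rewrite lg.
Qed.

Lemma fits_self c w : posc c -> pdat w = dec c -> fits c w.
Proof.
elim: c w => [|[n g] c IH] w; first by case: w.
rewrite dec_cons; case: n => // n /= cp /cdat_blk_cat[u [v [-> sz pu pv]]].
rewrite -sz take_size_cat // drop_size_cat // size_cat leq_addr IH //.
by rewrite /vee sz -pu eqxx.
Qed.

(** Each flag contributes the number of positions from there to the end, so that
    moving flags to the right or removing them lowers the sum. *)
Fixpoint mu s : nat :=
  if s is (g, b) :: s' then (if b then (size s').+1 else 0%N) + mu s' else 0%N.

(** The flags of t arise from those of s by removing some of them or moving them
    one step to the right.  The boolean k tells that the position before s had a
    flag that was dropped, so that the first position may receive it. *)
Fixpoint flag_shift (k : bool) s t : bool :=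
  match s, t with
  | (g, b) :: s', (h, d) :: t' =>
      [&& g == h, d ==> b || k & flag_shift (b && ~~ d) s' t']
  | [::], [::] => true
  | _, _ => false
  end.

Lemma flag_shift_size k s t : flag_shift k s t -> size s = size t.
Proof. by elim: s t k => [|[g b] s IH] [|[h d] t] k //= /and3P[_ _ /IH->]. Qed.

Lemma flag_shift_mu k s t : flag_shift k s t ->
  (~~ k && (s == t)) || (mu t < mu s + k * (size s).+1)%N.
Proof.
elim: s k t => [|[g b] s IH] k [|[h d] t] //=; first by case: k.
case/and3P=> /eqP-> dbk st; have sz := flag_shift_size st; move/IH: st.
rewrite eqseq_cons xpair_eqE eqxx sz /=.
have muE : s == t -> mu s = mu t by move/eqP->.
by case: b d k dbk => [] [] [] //= _; case: eqP muE => [_ /(_ isT)|_ _] /=; lia.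
Qed.

Lemma flag_shift_cons k g (b : bool) s h (d : bool) t :
  flag_shift k ((g, b) :: s) ((h, d) :: t) =
  [&& g == h, d ==> b || k & flag_shift (b && ~~ d) s t].
Proof. by []. Qed.

(** Inside a peakless block no flag can be acquired, except at the first letter,
    which may be a peak in the larger word; then the letter before it is not a
    peak, and the flag at the end of the preceding block has been lost. *)
Lemma flag_shift_cat p0 p (k : bool) g u v s : u != [::] ->
  cdat is_peak p0 u == blk (size u) g ->
  (forall l m u', u = l :: m :: u' -> is_peak (same_colour p l) l.1 m.1 -> k) ->
  (forall q (k' : bool), (forall l m v', v = l :: m :: v' ->
      is_peak (same_colour q l) l.1 m.1 -> k') ->
     flag_shift k' s (cdat is_peak q v)) ->
  flag_shift k (blk (size u) g ++ s) (cdat is_peak p (u ++ v)).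
Proof.
move=> + + + Hv; elim: u p0 p k => // l [|m u] IH p0 p k _ e H.
  have /eqP lg := cdat_blk_head e; rewrite /= lg eqxx implybT /=.
  apply: Hv => m m' v' -> /=; rewrite -lg.
  case: eqP => //= _ /andP[lm _]; rewrite /is_peak; case: (same_colour p l) => //= z.
  by rewrite negb_and -leqNgt lm orbT.
have /eqP lg := cdat_blk_head e; move: e.
rewrite cdat_cons2 [size _]/= blkSS eqseq_cons xpair_eqE eqbF_neg negb_or negbK.
case/andP=> /andP[_ /andP[/eqP lm _]] e.
rewrite ![(_ :: _) ++ _]cat_cons cdat_cons2 -[m :: (u ++ v)]cat_cons flag_shift_cons lg eqxx.
rewrite -{1}lg lm eqxx /= -/(cdat is_peak (Some l) ((m :: u) ++ v)).
apply/andP; split; first by apply/implyP; apply: H.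
apply: (IH (Some l) (Some l) false) => // m1 m2 u' [<- ue].
move: e; rewrite ue cdat_cons2 [size _]/= blkSS eqseq_cons.
by rewrite xpair_eqE eqbF_neg negb_or => /andP[/andP[_ /andP[_ /negbTE->]]].
Qed.

Lemma fits_flag_shift c w : posc c -> fits c w ->
  flag_shift false (dec c) (pdat w).
Proof.
move=> cp fcw; suff: forall p (k : bool), (forall l m w', w = l :: m :: w' ->
    is_peak (same_colour p l) l.1 m.1 -> k) -> flag_shift k (dec c) (cdat is_peak p w).
  by apply.
elim: c w cp fcw => [|[n g] c IH] w; first by move=> _ /nilP->.
case/andP=> n0 cp /and3P[nw vu fv] p k Hk.
have szu : size (take n w) = n by rewrite size_takel.
have u0 : take n w != [::] by rewrite -size_eq0 szu -lt0n.
rewrite -[in X in flag_shift _ _ X](cat_take_drop n w) dec_cons -[(n, g).1]szu.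
apply: (flag_shift_cat (p0 := None)) => //.
- by move=> l m u' e; apply: (Hk l m (u' ++ drop n w)); rewrite -[LHS](cat_take_drop n) e.
by move=> q k' H; apply: IH.
Qed.

Lemma fits_mu c w : posc c -> fits c w ->
  dec c = pdat w \/ (mu (pdat w) < mu (dec c))%N.
Proof.
move=> cp /(fits_flag_shift cp)/flag_shift_mu; rewrite mul0n addn0.
by case/orP=> [/eqP|]; [left | right].
Qed.

(** * The algebra generated by the odd generators *)

Local Notation oddI := ({n : nat | odd n} * gT)%type.

Definition odd_word (m : {fmonom oddI}) : seq (nat * gT) :=
  [seq (val i.1, i.2) | i <- fmonom_val m].

Definition odd_eval (F : {malg K[{fmonom oddI}]}) : KG :=
  lext (fun m => qmon (odd_word m)) F.

Definition odd_gen x := exists F, odd_eval F = x.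

Lemma odd_gen_subspace : subspace odd_gen.
Proof.
split; first by exists 0; rewrite /odd_eval raddf0.
by move=> k x y [F <-] [F' <-]; exists (k *: F + F'); rewrite /odd_eval linearP.
Qed.

Lemma kmul_lext (T U : choiceType) (f : T -> KG) (h : U -> KG) F F' :
  lext f F ** lext h F' = lext2 (fun i j => f i ** h j) F F'.
Proof.
rewrite unlock lext2_lext /lext2; apply: eq_lext => i.
exact: lext2_lextr.
Qed.

Lemma qmon_cat c d : qmon (c ++ d) = qmon c ** qmon d.
Proof.
elim: c => [|i c IH] /=; first by rewrite KG_mul1x.
by rewrite IH KG_mulA.
Qed.

Lemma odd_gen_mul x y : odd_gen x -> odd_gen y -> odd_gen (x ** y).
Proof.
move=> [F <-] [F' <-].
exists (lext2 (fun m m' => << FMonom (fmonom_val m ++ fmonom_val m') >>) F F').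
rewrite /odd_eval lext_lext2 kmul_lext; apply: eq_lext2 => m m'.
by rewrite lextU /odd_word /= map_cat qmon_cat.
Qed.

Lemma odd_gen_one : odd_gen (KG_one K gT).
Proof. by exists << FMonom [::] >>; rewrite /odd_eval lextU. Qed.

Context (two_neq0 : 2%:R != 0 :> K).

Lemma odd_gen_qgen n g : (0 < n)%N -> odd_gen (qgen n g).
Proof.
elim/ltn_ind: n => n IH n0; case: (boolP (odd n)) => on.
  exists << FMonom [:: (exist (fun n => odd n) n on, g)] >>.
  by rewrite /odd_eval lextU /= KG_mulx1.
rewrite qgen_even //; apply: subspace_sum => [|i _ _]; first exact: odd_gen_subspace.
have im : (i.+1 < n)%N by rewrite -ltn_predRL.
apply: subspaceZ; first exact: odd_gen_subspace.
apply: odd_gen_mul; apply: IH => //; first by rewrite ltn_subrL.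
by rewrite subn_gt0.
Qed.

Lemma odd_gen_qmon c : posc c -> odd_gen (qmon c).
Proof.
elim: c => [|[n g] c IH] /=; first by move=> _; apply: odd_gen_one.
by case/andP=> n0 cp; apply: odd_gen_mul; [apply: odd_gen_qgen | apply: IH].
Qed.

(** A product of generators is a peak sum plus peak sums with a smaller value of
    [mu], so the system is unitriangular and can be inverted by induction on a
    bound for [mu] on the support. *)
Lemma odd_gen_peak x : peak_const x -> odd_gen x.
Proof.
move=> px; have [n] : exists n, forall w, cf x w != 0 -> (mu (pdat w) < n)%N.
  exists (\max_(a <- msupp x) mu (pdat (cw a))).+1 => w xw; rewrite ltnS.
  rewrite -(pdat_pat (pat_cstd w)).
  apply: (@leq_bigmax_seq _ _ predT (fun a : colperm gT => mu (pdat (cw a))) (cstd w)) => //.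
  by rewrite -mcoeff_neq0.
elim: n x px => [|n IH] x px xn.
  suff -> : x = 0 by case: odd_gen_subspace.
  apply: cf_ext => w; rewrite /cf mcoeff0; apply/eqP/negbNE/negP => xw.
  by have := xn w xw.
have [|a b|val {1}->] := @class_expansion _ _ _ (fun a => P_G (tagged a)) (@p_G K gT) x.
- by move=> e b _; rewrite mcoeff_p_G.
- by move/(peak_constP x): px; apply.
apply: subspace_sum => [|e]; first exact: odd_gen_subspace.
rewrite mem_undup => /mapP[a ax ->] _; apply: subspaceZ; first exact: odd_gen_subspace.
set c := P_G (tagged a).
have cp : posc c by rewrite /c P_G_cw; apply: enc_pos.
have cE : dec c = pdat (cw a) by rewrite /c P_G_cw encK // wf_cdat.
have mun : (mu (dec c) < n.+1)%N by rewrite cE; apply: xn; rewrite cf_cw mcoeff_neq0.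
rewrite -[p_G K c](subKr (qmon c)); apply: subspaceB; first exact: odd_gen_subspace.
  exact: odd_gen_qmon.
apply: IH => [|w].
  by apply: (subspaceB peak_const_subspace); [apply: peak_const_qmon | apply: peak_const_p_G].
rewrite cfB cf_qmon // cf_p_G; case: (boolP (fits c w)) => [/(fits_mu cp)[ce|lt] neq0|nf].
- by case/eqP: neq0; rewrite -ce decK // eqxx subrr.
- exact: leq_trans lt _.
case: (enc _ =P c) => [ce|_]; last by rewrite subrr eqxx.
by case/negP: nf; apply: fits_self => //; rewrite -ce encK // wf_cdat.
Qed.

Lemma peak_const_odd_gen x : odd_gen x -> peak_const x.
Proof.
move=> [F <-]; apply: (subspace_sum peak_const_subspace) => m _ _.
by apply: (subspaceZ _ peak_const_subspace); apply: peak_const_qmon.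
Qed.

Lemma odd_genP x : odd_gen x <-> Peak x.
Proof.
by rewrite PeakP; split; [apply: peak_const_odd_gen | apply: odd_gen_peak].
Qed.

End Spanning.

(** * The odd generators are free *)

Section Independence.
Context {K : fieldType} {gT : finGroupType}.
Local Notation word := (seq (nat * gT)).
Local Notation KG := {malg K[colperm gT]}.
Local Notation "x ** y" := (kmul x y) (at level 40, left associativity).
Implicit Types (w u v : word) (a b : colperm gT) (x y z : KG) (g : gT).
Implicit Types (c d o : seq (nat * gT)).
Local Notation letter_at w i := (nth 0%N (unzip1 w) i).

Definition peak_at w i :=
  (letter_at w i.-1 <= letter_at w i)%N && (letter_at w i.+1 < letter_at w i)%N.

Lemma pdat_ext w w' : unzip2 w = unzip2 w' ->
  (forall i, (0 < i)%N -> (i.+1 < size w)%N -> peak_at w i = peak_at w' i) ->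
  pdat w = pdat w'.
Proof.
suff H l l' u u' : l.2 = l'.2 -> unzip2 u = unzip2 u' ->
    (forall i, (0 < i)%N -> (i.+1 < (size u).+1)%N ->
       peak_at (l :: u) i = peak_at (l' :: u') i) ->
    cdat is_peak (Some l) u = cdat is_peak (Some l') u'.
  case: w w' => [|l w] [|l' w'] //= [ll' ww'] Hp; rewrite /pdat /= ll'.
  congr ((_, _) :: _); last exact: H.
  by case: w w' ww' {Hp} => [|m w] [|m' w'] //= [-> _].
elim: u u' l l' => [|m u IH] [|m' u'] l l' //= ll' [mm' uu'] Hp.
rewrite mm'; congr ((_, _) :: _); last first.
  by apply: IH => // -[|i] // _ iu; apply: (Hp i.+2).
case: u u' uu' Hp {IH} => [|m2 u] [|m2' u'] //= [-> _] Hp.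
by rewrite ll'; congr (_ || _); case: eqP => //= _; apply: (Hp 1%N).
Qed.

Lemma cdat_blk_nopeak p u g i : cdat is_peak p u == blk (size u) g ->
  (0 < i)%N -> (i.+1 < size u)%N -> ~~ peak_at u i.
Proof.
elim: u p i => // l [|m u] IH p i //.
rewrite cdat_cons2 [size _]/= blkSS eqseq_cons xpair_eqE eqbF_neg negb_or negbK.
case/andP=> /andP[_ /andP[/eqP lm _]] e.
case: i => [|[|i]] // _; last by move=> iu; apply: (IH _ i.+1 e).
case: u e {IH} => // m2 u; rewrite cdat_cons2 [size _]/= blkSS eqseq_cons xpair_eqE.
rewrite eqbF_neg negb_or => /andP[/andP[_ /andP[_]]].
by rewrite /is_peak /same_colour lm eqxx.
Qed.

Lemma mono_vee g u : u != [::] -> mono leq g u -> vee g u.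
Proof.
case: u => // l [|m u] _.
  by rewrite /mono /vee /pdat /blk /= !andbT eqseq_cons xpair_eqE eqxx !andbT.
rewrite mono_cons2 vee_cons2 => /and3P[-> lm ->].
by rewrite ltnNge lm.
Qed.

(** The odd offsets in the blocks of o.  When the blocks have odd size, they are
    neither first nor last in their block, and no two of them are neighbours. *)
Fixpoint inner o t : bool :=
  if o is (n, g) :: o' then if (t < n)%N then odd t else inner o' (t - n)%N else false.

Fixpoint cuts c : seq nat :=
  0%N :: (if c is (n, g) :: c' then [seq (n + i)%N | i <- cuts c'] else [::]).

(** No block of c, placed from position M on, has e strictly between its first
    and its last position. *)
Fixpoint avoid c M e : bool :=
  if c is (n, g) :: c' then
    ~~ ((M < e) && (e.+1 < M + n))%N && avoid c' (M + n)%N e else true.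

Definition oddc o := all (fun i : nat * gT => odd i.1) o.

Lemma inner_succ o t : oddc o -> inner o t -> ~~ inner o t.+1.
Proof.
elim: o t => // -[n g] o IH t /= /andP[on oo].
case: ltnP => tn.
  case: ltnP => tn' ot; first by rewrite /= ot.
  have -> : (t.+1 - n)%N = 0%N by lia.
  by case: o oo {IH} => // -[[|m] h] o.
by rewrite ltnNge (leqW tn) /= subSn //; apply: IH.
Qed.

Lemma inner_gt0 o t : oddc o -> inner o t -> (0 < t)%N.
Proof.
case: t => //; elim: o => // -[n g] o IH /= /andP[on oo].
by case: n on.
Qed.

Lemma inner_pred o t : oddc o -> inner o t -> ~~ inner o t.-1.
Proof.
move=> oo it; have t0 := inner_gt0 oo it.
by apply: contraL it => it; rewrite -(prednK t0); apply: inner_succ.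
Qed.

Lemma inner_sizes o o' : unzip1 o = unzip1 o' -> inner o =1 inner o'.
Proof.
elim: o o' => [|[n g] o IH] [|[n' g'] o'] //= [-> e] t.
by rewrite (IH _ e).
Qed.

(** If i is not a cut, then i - 1 and i belong to the same block, and one of two
    neighbouring offsets is odd. *)
Lemma inner_cut o i : oddc o -> i \notin cuts o -> (0 < i < weight o)%N ->
  inner o i.-1 || inner o i.
Proof.
elim: o i => [|[n g] o IH] i; first by rewrite /weight /=; case: i.
rewrite weight_cons => /= /andP[on oo]; rewrite inE negb_or => /andP[i0 ic] /andP[_ iw].
have [lt|gt|e] := ltngtP i n.
- rewrite (leq_ltn_trans (leq_pred _) lt); case: i i0 {ic iw lt} => //= i _.
  by case: (odd i).
- have -> : (i.-1 < n)%N = false by lia.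
  have -> : (i.-1 - n)%N = (i - n).-1 by lia.
  apply: IH => //; last by lia.
  by apply: contra ic => c; rewrite -(subnKC (ltnW gt)) map_f.
by case/negP: ic; rewrite e -[n in X in X \in _]addn0 map_f //; case: (o).
Qed.

Lemma avoid_le c M e : (e <= M)%N -> avoid c M e.
Proof.
elim: c M => // -[n g] c IH M eM /=; rewrite ltnNge eM /=.
by apply: IH; rewrite (leq_trans eM) ?leq_addr.
Qed.

Lemma avoid_cut c M i e : i \in cuts c -> (M + i <= e.+1)%N -> (e <= M + i)%N ->
  avoid c M e.
Proof.
elim: c M i => // -[n g] c IH M i; rewrite inE => /orP[/eqP->|].
  by move=> _ eM; apply: avoid_le; rewrite addn0 in eM.
case/mapP=> j jc -> le1 le2; rewrite /=; apply/andP; split; last first.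
  by apply: (IH _ j) => //; rewrite -addnA.
rewrite negb_and -!leqNgt; apply/orP; right.
by apply: leq_trans le1; rewrite leq_add2l leq_addr.
Qed.

Lemma size_cuts c : size (cuts c) = (size c).+1.
Proof. by elim: c => // -[n g] c IH /=; rewrite size_map IH. Qed.

Lemma cuts_sorted c : posc c -> sorted ltn (cuts c).
Proof.
elim: c => // -[n g] c IH /= /andP[n0 cp].
rewrite (path_sortedE ltn_trans); apply/andP; split.
  by apply/allP => _ /mapP[i _ ->]; rewrite ltn_addr.
by rewrite sorted_map; apply: sub_sorted (IH cp) => i j /=; rewrite ltn_add2l.
Qed.

Lemma cuts_le c i : i \in cuts c -> (i <= weight c)%N.
Proof.
elim: c i => [|[n g] c IH] i; first by rewrite inE => /eqP->.
rewrite inE => /orP[/eqP->//|].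
by case/mapP=> j jc ->; rewrite weight_cons leq_add2l IH.
Qed.

Lemma mem_cuts_weight c : weight c \in cuts c.
Proof.
elim: c => // -[n g] c IH; rewrite inE; apply/orP; right.
by rewrite weight_cons map_f.
Qed.

Lemma cuts_inj c d : cuts c = cuts d -> unzip1 c = unzip1 d.
Proof.
have cuts0 e : cuts e = 0%N :: behead (cuts e) by case: e.
elim: c d => [|[n g] c IH] [|[n' g'] d] // [].
  by rewrite [cuts d]cuts0.
  by rewrite [cuts c]cuts0.
move=> e; have nn' : n = n'.
  by move: e; rewrite [cuts c]cuts0 [cuts d]cuts0 /= !addn0 => -[].
rewrite /= nn' (IH d) //; move: e; rewrite nn'; apply: inj_map; exact: addnI.
Qed.

(** An inner position of c lies strictly inside a peakless block. *)
Lemma fits_inner c w t : fits c w -> inner c t -> oddc c -> ~~ peak_at w t.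
Proof.
elim: c w t => // -[n g] c IH w t /= /and3P[nw vu fv] it /andP[on oc].
have t0 : (0 < t)%N by apply: (inner_gt0 (o := (n, g) :: c)); rewrite //= on oc.
have letterT i : (i < n)%N -> letter_at (take n w) i = letter_at w i.
  by move=> im; rewrite /unzip1 map_take nth_take.
have letterD i : (n <= i)%N -> letter_at (drop n w) (i - n) = letter_at w i.
  by move=> ni; rewrite /unzip1 map_drop nth_drop subnKC.
move: it; case: ltnP => [tn ot|nt it].
  have t1n : (t.+1 < n)%N.
    rewrite ltn_neqAle tn andbT; apply: contraTneq on => <-; by rewrite /= ot.
  have := cdat_blk_nopeak vu t0; rewrite size_takel // => /(_ t1n).
  by rewrite /peak_at !letterT // (leq_ltn_trans (leq_pred _) tn).
have nt' : (n < t)%N.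
  by have := inner_gt0 oc it; rewrite subn_gt0.
have := IH _ _ fv it oc; rewrite /peak_at letterD //.
have -> : (t - n).-1 = (t.-1 - n)%N by lia.
have -> : (t - n).+1 = (t.+1 - n)%N by lia.
by rewrite !letterD //; lia.
Qed.

Definition expand c : seq gT := flatten [seq nseq i.1 i.2 | i <- c].

Lemma size_expand c : size (expand c) = weight c.
Proof. by elim: c => // -[n g] c IH; rewrite /= size_cat size_nseq IH. Qed.

Lemma fits_increasing c w : posc c -> unzip2 w = expand c ->
  sorted leq (unzip1 w) -> fits c w.
Proof.
elim: c w => [|[n g] c IH] w /=; first by case: w.
case/andP=> n0 cp wc sw.
have szw : size w = (n + weight c)%N.
  by rewrite -(size_map snd) -/(unzip2 w) wc size_cat size_nseq size_expand.
have nw : (n <= size w)%N by rewrite szw leq_addr.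
rewrite nw /=; apply/andP; split.
  apply: mono_vee; first by rewrite -size_eq0 size_takel // -lt0n.
  rewrite /mono; apply/andP; split.
    have : unzip2 (take n w) = nseq n g.
      by rewrite /unzip2 map_take -/(unzip2 w) wc take_size_cat ?size_nseq.
    move=> e; have : all (pred1 g) (unzip2 (take n w)) by rewrite e all_pred1_nseq.
    by rewrite all_map.
  have : sorted leq (unzip1 (take n w)) by rewrite /unzip1 map_take take_sorted.
  by rewrite sorted_map.
apply: IH => //; last by rewrite /unzip1 map_drop drop_sorted.
by rewrite /unzip2 map_drop -/(unzip2 w) wc drop_size_cat ?size_nseq.
Qed.

Lemma fits_uniq c d w : posc c -> unzip1 c = unzip1 d -> fits c w -> fits d w ->
  c = d.
Proof.
elim: c d w => [|[n g] c IH] [|[n' h] d] w //= /andP[n0 cp] [<- e].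
case/and3P=> nw vg fc /and3P[_ vh fd]; congr ((_, _) :: _); last exact: IH e fc fd.
have : take n w != [::] by rewrite -size_eq0 size_takel // -lt0n.
move: vg vh; rewrite /vee; case: (take n w) => // l u.
by move=> /cdat_blk_head/eqP<- /cdat_blk_head/eqP->.
Qed.

(** * The separating functionals *)

(** The test word attached to a set S of positions has the colours prescribed
    by o; its letters increase except that those at the positions in S are
    raised above the remaining ones; at inner positions they become peaks. *)
Definition test_word o (S : {set 'I_(weight o)}) : word :=
  [seq ((i + (i \in S) * weight o)%N, nth 1%g (expand o) i)
     | i : 'I_(weight o) <- enum 'I_(weight o)].

Definition inner_set o : {set 'I_(weight o)} := [set i : 'I_(weight o) | inner o i].

Definition theta o x : K :=
  \sum_(S : {set 'I_(weight o)} | S \subset inner_set o)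
     (-1) ^+ #|S| * cf x (test_word S).

Lemma size_test_word o (S : {set 'I_(weight o)}) : size (test_word S) = weight o.
Proof. by rewrite size_map size_enum_ord. Qed.

Lemma test_word_colours o (S : {set 'I_(weight o)}) : unzip2 (test_word S) = expand o.
Proof.
rewrite /unzip2 -map_comp; apply: (@eq_from_nth _ 1%g).
  by rewrite size_map size_enum_ord size_expand.
move=> i; rewrite size_map size_enum_ord => io.
by rewrite (nth_map (Ordinal io)) ?size_enum_ord //= nth_enum_ord.
Qed.

Lemma letter_test_word o (S : {set 'I_(weight o)}) (i : 'I_(weight o)) :
  letter_at (test_word S) i = (i + (i \in S) * weight o)%N.
Proof.
by rewrite /unzip1 -map_comp (nth_map i) ?size_enum_ord // nth_ord_enum.
Qed.

Lemma letter_test_word_low o (S : {set 'I_(weight o)}) i : S \subset inner_set o ->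
  (i < weight o)%N -> ~~ inner o i -> letter_at (test_word S) i = i.
Proof.
move=> Sin io ni; rewrite -[i]/(nat_of_ord (Ordinal io)) letter_test_word.
case: (boolP (_ \in S)) => [/(subsetP Sin)|_]; last by rewrite addn0.
by rewrite inE /= (negbTE ni).
Qed.

Lemma letter_test_word_ge o (S : {set 'I_(weight o)}) i :
  (i < weight o)%N -> (i <= letter_at (test_word S) i)%N.
Proof.
by move=> io; rewrite -{2}[i]/(nat_of_ord (Ordinal io)) letter_test_word leq_addr.
Qed.

(** Raising the letter at e can only create or destroy a peak at e, because its
    neighbours are not inner positions and increase in any case; and e is not
    strictly inside the slice. *)
Lemma slice_toggle o (S S' : {set 'I_(weight o)}) (e : 'I_(weight o)) M k :
  oddc o -> inner o e -> S \subset inner_set o -> S' \subset inner_set o ->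
  (forall i, i != e -> (i \in S) = (i \in S')) -> (M + k <= weight o)%N ->
  ~~ ((M < e) && (e.+1 < M + k))%N ->
  pdat (take k (drop M (test_word S))) = pdat (take k (drop M (test_word S'))).
Proof.
move=> oo ie So S'o SS' Mk nMe; apply: pdat_ext.
  by rewrite /unzip2 !map_take !map_drop -!/(unzip2 _) !test_word_colours.
have szS (R : {set 'I_(weight o)}) : size (take k (drop M (test_word R))) = k.
  by rewrite size_takel // size_drop size_test_word leq_subRL // (leq_trans _ Mk) ?leq_addr.
move=> i i0; rewrite szS => ik.
have lE (R : {set 'I_(weight o)}) j : (j < k)%N ->
    letter_at (take k (drop M (test_word R))) j = letter_at (test_word R) (M + j)%N.
  by move=> jk; rewrite /unzip1 map_take map_drop nth_take // nth_drop.
have ipk : (i.-1 < k)%N by lia.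
have ik' : (i < k)%N by apply: ltnW.
rewrite /peak_at !lE //.
have [-> ->] : (M + i.-1)%N = (M + i).-1 /\ (M + i.+1)%N = (M + i).+1 by split; lia.
have tN : ((M + i).+1 < weight o)%N by lia.
have Mt : (M < M + i)%N by lia.
have tk : ((M + i).+1 < M + k)%N by lia.
move: (M + i)%N Mt tk tN => t Mt tk tN.
have te : t != e by apply: contraNneq nMe => <-; rewrite Mt tk.
case: (boolP (inner o t)) => it; last first.
  have up (R : {set 'I_(weight o)}) : R \subset inner_set o ->
      (letter_at (test_word R) t.+1 < letter_at (test_word R) t)%N = false.
    move=> Ro; rewrite (letter_test_word_low Ro (ltnW tN) it).
    by apply/negbTE; rewrite -leqNgt (leq_trans (leqnSn t)) ?letter_test_word_ge.
  by rewrite !up // !andbF.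
have agree j : (j < weight o)%N -> j != e ->
    letter_at (test_word S) j = letter_at (test_word S') j.
  move=> jo je; rewrite -[j]/(nat_of_ord (Ordinal jo)) !letter_test_word SS' //.
rewrite !agree ?(ltnW tN) //.
- by apply: contraTneq ie => <-; apply: inner_succ.
- by apply: leq_ltn_trans (leq_pred t) (ltnW tN).
- by apply: contraTneq ie => <-; apply: inner_pred.
Qed.

Lemma fits_toggle o (S S' : {set 'I_(weight o)}) (e : 'I_(weight o)) c M :
  oddc o -> inner o e -> S \subset inner_set o -> S' \subset inner_set o ->
  (forall i, i != e -> (i \in S) = (i \in S')) -> (M + weight c <= weight o)%N ->
  avoid c M e -> fits c (drop M (test_word S)) = fits c (drop M (test_word S')).
Proof.
move=> oo ie So S'o SS'; elim: c M => [|[n g] c IH] M.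
  by rewrite /= /nilp !size_drop !size_test_word.
rewrite weight_cons addnA /= => Mc /andP[nMe av].
rewrite !size_drop !size_test_word; congr (_ && _).
have Mn : (M + n <= weight o)%N by apply: leq_trans Mc; rewrite leq_addr.
rewrite !drop_drop [(n + M)%N]addnC (IH (M + n)%N) //; congr (_ && _).
have ep := slice_toggle oo ie So S'o SS' Mn nMe.
by rewrite /vee ep -(size_pdat (take n _)) ep size_pdat.
Qed.

Definition toggle (T : finType) (e : T) (S : {set T}) : {set T} :=
  if e \in S then S :\ e else e |: S.

Lemma toggleK (T : finType) (e : T) : involutive (toggle e).
Proof.
move=> S; rewrite /toggle; case: (boolP (e \in S)) => eS.
  by rewrite !inE eqxx /= setD1K.
by rewrite setU11 setU1K.
Qed.

Lemma in_toggle (T : finType) (e : T) S i :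
  i != e -> (i \in toggle e S) = (i \in S).
Proof. by move=> ie; rewrite /toggle; case: ifP => _; rewrite !inE (negbTE ie). Qed.

Lemma sign_toggle (T : finType) (e : T) S :
  (-1) ^+ #|toggle e S| = - (-1) ^+ #|S| :> K.
Proof.
rewrite /toggle; case: (boolP (e \in S)) => eS.
  by rewrite [in RHS](cardsD1 e) eS exprS mulN1r opprK.
by rewrite cardsU1 eS exprS mulN1r.
Qed.

Lemma toggle_sub (T : finType) (e : T) (S E : {set T}) : e \in E ->
  (toggle e S \subset E) = (S \subset E).
Proof.
move=> eE; apply/subsetP/subsetP => H i iS; case: (eqVneq i e) => [->//|ie].
  by apply: H; rewrite in_toggle.
by apply: H; rewrite -(in_toggle _ ie).
Qed.

Context (two_neq0 : 2%:R != 0 :> K).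

(** A cut of c which is not a cut of o lies strictly inside a block of o, next to
    a position e that is inner for o and at the border of a block of c.  So
    toggling e in S does not affect [qmon c], and changes the sign. *)
Lemma theta_cut o c i : oddc o -> posc c -> weight c = weight o ->
  i \in cuts c -> i \notin cuts o -> theta o (qmon c) = 0.
Proof.
move=> oo cp co ic nio.
have i0 : (0 < i)%N by rewrite lt0n; apply: contraNneq nio => ->; case: (o).
have io : (i < weight o)%N.
  rewrite ltn_neqAle -{2}co cuts_le // andbT.
  by apply: contraNneq nio => ->; apply: mem_cuts_weight.
have [e ie ae] : exists2 e : 'I_(weight o), inner o e & avoid c 0 e.
  (* Of i - 1 and i, the one with odd offset in its block of o. *)
  have /orP[ii|ii] := inner_cut oo nio (introT andP (conj i0 io)).
    exists (Ordinal (leq_ltn_trans (leq_pred i) io)) => //.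
    by apply: (avoid_cut ic); rewrite add0n /= ?leq_pred ?prednK.
  by exists (Ordinal io) => //; apply: (avoid_cut ic); rewrite add0n.
(* Toggling e shows that theta is its own opposite. *)
apply: (mulfI two_neq0); rewrite mulr0 mulr_natl mulr2n {1}/theta.
rewrite (reindex_inj (inv_inj (toggleK e))) /= /theta.
rewrite [X in X + _](eq_big (fun S : {set 'I_(weight o)} => S \subset inner_set o)
  (fun S : {set 'I_(weight o)} => - ((-1) ^+ #|S| * cf (qmon c) (test_word S)))).
- by rewrite sumrN addNr.
- by move=> S; rewrite toggle_sub // inE.
move=> S; rewrite toggle_sub ?inE // => So.
rewrite sign_toggle mulNr !cf_qmon //; congr (- (_ * _%:R)).
rewrite -[test_word (toggle e S)]drop0 -[test_word S]drop0; congr nat_of_bool.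
apply: (fits_toggle (e := e)) => //; first by rewrite toggle_sub // inE.
  exact: in_toggle.
by rewrite add0n co.
Qed.

Lemma test_word0_fits o : posc o -> fits o (test_word (set0 : {set 'I_(weight o)})).
Proof.
move=> op; apply: fits_increasing => //; first exact: test_word_colours.
rewrite /unzip1 -map_comp.
rewrite (eq_map (g := fun i : 'I_(weight o) => nat_of_ord i)) => [|i].
  by rewrite val_enum_ord; apply: (@sub_sorted _ ltn leq ltnW); apply: iota_ltn_sorted.
by rewrite /= inE mul0n addn0.
Qed.

(** If c has a cut that o has not, [theta_cut] applies.  Otherwise the cuts of c
    are among those of o, and there are at least as many of them, so c and o
    have the same sizes.  Then a raised letter is a peak inside a block of c, so
    only the empty set contributes to theta, and its test word increases, which
    leaves the colours to be compared. *)
Lemma theta_qmon o c : oddc o -> posc c -> (size o <= size c)%N ->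
  theta o (qmon c) = (c == o)%:R.
Proof.
move=> oo cp szoc.
have op : posc o by apply: sub_all oo => -[[]].
have [wco|wco] := eqVneq (weight c) (weight o); last first.
  rewrite /theta big1 => [|S _]; last first.
    by rewrite (homog_qmon (c := c)) ?mulr0 // size_test_word eq_sym.
  by case: (eqVneq c o) => [co|//]; rewrite co eqxx in wco.
have [sub|] := boolP (all [in cuts o] (cuts c)); last first.
  case/allPn => i ic nio; rewrite (theta_cut oo cp wco ic nio).
  by case: (eqVneq c o) => [co|//]; rewrite -co ic in nio.
have unz : unzip1 c = unzip1 o.
  apply: cuts_inj; apply: (irr_sorted_eq ltn_trans ltnn); rewrite ?cuts_sorted //.
  have uc : uniq (cuts c) by apply: (sorted_uniq ltn_trans ltnn); apply: cuts_sorted.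
  have [] := uniq_min_size uc (allP sub); first by rewrite !size_cuts.
  by [].
have oc : oddc c.
  move: oo; rewrite /oddc -(all_map fst odd) -(all_map fst odd c).
  by rewrite -!/(unzip1 _) unz.
rewrite /theta (bigD1 set0) ?sub0set //= cards0 mul1r big1 ?addr0 => [|S /andP[So S0]].
  rewrite cf_qmon //; congr _%:R; congr nat_of_bool; apply/idP/eqP => [fc|->].
    exact: fits_uniq cp unz fc (test_word0_fits op).
  exact: test_word0_fits.
rewrite cf_qmon //; case: (boolP (fits c _)) => [fc|_]; last by rewrite mulr0.
have [e eS] := set0Pn _ S0; have ie : inner o e.
  by have := subsetP So _ eS; rewrite inE.
have ice : inner c e by rewrite (inner_sizes unz).
have := fits_inner fc ice oc.
have e0 := inner_gt0 oo ie; rewrite /peak_at letter_test_word eS mul1n.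
have ep : (e.-1 < weight o)%N by apply: leq_ltn_trans (leq_pred e) _.
rewrite (letter_test_word_low So ep) ?(inner_pred oo ie) //.
have -> : (e.-1 <= e + weight o)%N := leq_trans (leq_pred e) (leq_addr _ _).
have [e1|e1] := ltnP e.+1 (weight o).
  rewrite (letter_test_word_low So e1) ?(inner_succ oo ie) //.
  by have -> : (e.+1 < e + weight o)%N := leq_trans e1 (leq_addl _ _).
(* If e is the last position, the letter read after it is 0. *)
rewrite nth_default; last by rewrite size_map size_test_word.
by rewrite addn_gt0 e0.
Qed.

Lemma theta_lext (T : choiceType) o (f : T -> KG) F :
  theta o (lext f F) = \sum_(a <- msupp F) F@_a * theta o (f a).
Proof.
rewrite /theta; under [RHS]eq_bigr do rewrite big_distrr.
rewrite exchange_big /=; apply: eq_bigr => S _.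
rewrite /cf mcoeff_lext big_distrr /=; apply: eq_bigr => a _; ring.
Qed.

Local Notation oddI := ({n : nat | odd n} * gT)%type.

Lemma odd_word_inj : injective (@odd_word gT).
Proof.
move=> [m] [m'] /= e; congr FMonom; move: e; apply: inj_map.
by move=> [n g] [n' g'] /= [/val_inj-> ->].
Qed.

Lemma oddc_odd_word (m : {fmonom oddI}) : oddc (odd_word m).
Proof. by apply/allP => _ /mapP[[[n on] g] _ ->]. Qed.

(** The functional of a shortest monomial in the support isolates it. *)
Lemma odd_eval_inj : injective (@odd_eval K gT).
Proof.
move=> F F' e; apply/eqP; rewrite -subr_eq0; set D := F - F'.
have D0 : odd_eval D = 0 by rewrite /odd_eval linearB /= -!/(odd_eval _) e subrr.
apply/negPn/negP => nz; have [m0 m0D] : exists m, m \in msupp D.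
  by apply/fset0Pn; rewrite msupp_eq0.
have exn : exists n, has (fun m : {fmonom oddI} => size (odd_word m) == n) (msupp D).
  by exists (size (odd_word m0)); apply/hasP; exists m0.
have [n /hasP[m mD /eqP mn] minn] := ex_minnP exn.
have : theta (odd_word m) (odd_eval D) = 0.
  by rewrite D0 /theta big1 // => S _; rewrite /cf mcoeff0 mulr0.
rewrite /odd_eval theta_lext.
rewrite (eq_big_seq (fun m' => D@_m' * (m' == m)%:R)) => [|m' m'D]; last first.
  rewrite theta_qmon ?oddc_odd_word ?(inj_eq odd_word_inj) //.
    by apply: sub_all (oddc_odd_word m') => -[[]].
  by rewrite mn minn //; apply/hasP; exists m'.
by rewrite sum_msupp_eq => /eqP; rewrite (mcoeff_eq0 D m) mD.
Qed.

End Independence.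

(** * The coproduct and the antipode on the peak subspace *)

Section PeakCoproduct.
Context {K : fieldType} {gT : finGroupType}.
Local Notation word := (seq (nat * gT)).
Local Notation KG := {malg K[colperm gT]}.
Local Notation "x ** y" := (kmul x y) (at level 40, left associativity).
Local Notation Delta := (@kdelta K gT).
Local Notation one := (KG_one K gT).
Implicit Types (w u v : word) (a b : colperm gT) (x y z : KG) (g : gT).
Implicit Types (S T U : colperm gT -> KG).

Lemma delta_homog n x u v : homog n x -> (size u + size v)%N != n ->
  (Delta x)@_(cstd u, cstd v) = 0.
Proof.
move=> hx uvn; have := mcoeff_delta x (below_shift (cstd u) (cstd v)).
rewrite cstd_shift !cwK => ->; rewrite big1_seq // => w /andP[_ win].
apply: hx; have wp := shuf_perm win.
by rewrite (perm_size wp) size_cat (size_map _ (cw _)) !size_cw !tag_cstd.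
Qed.

Context (two_neq0 : 2%:R != 0 :> K).

Lemma delta_qmon c : posc c -> peak_const2 (weight c) (Delta (qmon c)).
Proof.
elim: c => [_|[n g] c IH /andP[n0 cp]] /=.
  rewrite KG_delta1; split=> [u u' v v' eu ev|u v uv]; rewrite !mcoeff_tens.
    rewrite -!/(cf _ _) /=; have := peak_const_one (K := K) eu.
    by have := peak_const_one (K := K) ev; rewrite /cf => -> ->.
  have := cf_one (K := K) u; have := cf_one (K := K) v; rewrite /cf /= => -> ->.
  move: uv; rewrite /nilp /weight /= addn_eq0.
  by case: (size u == 0%N); rewrite /= ?mul0r // => /negbTE->; rewrite mulr0.
rewrite weight_cons KG_deltaM; apply: peak_const2_mul; last exact: IH.
exact: delta_qgen.
Qed.

(** It suffices to check products of generators, where multiplicativity of the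
    coproduct reduces the claim to [delta_qgen]. *)
Lemma delta_peak n x : peak_const x -> homog n x -> peak_const2 n (Delta x).
Proof.
move=> px hx; split=> [u u' v v' eu ev|u v uv]; last exact: delta_homog hx uv.
have [F <-] := odd_gen_peak two_neq0 px.
have linD : Delta (odd_eval F) = lext (fun m => Delta (qmon (odd_word m))) F.
  by rewrite unlock /odd_eval lext_comp.
rewrite linD !mcoeff_lext; apply: eq_bigr => m _; congr (_ * _).
have [|c2 _] := @delta_qmon (odd_word m); last exact: c2.
by apply: sub_all (oddc_odd_word m) => -[[]].
Qed.

(** * Convolution *)

(** The convolution product of two linear maps given on the basis; its unit is
    [unitm]. *)
Definition convm S T a : KG := lext (fun p => S p.1 ** T p.2) (KG_deltab K a).

Definition unitm a : KG := KG_epsb K a *: one.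

Lemma kmulE x y : x ** y = lext2 (@KG_mulb K gT) x y.
Proof. by rewrite unlock. Qed.

Lemma kdeltaE x : Delta x = lext (@KG_deltab K gT) x.
Proof. by rewrite unlock. Qed.

Lemma kmulBl x y z : (x - y) ** z = x ** z - y ** z.
Proof. by rewrite !kmulE -!/(lext2r _ _ _) raddfB. Qed.

Lemma kmulBr x y z : x ** (y - z) = x ** y - x ** z.
Proof. by rewrite !kmulE raddfB. Qed.

Lemma kmulZl (k : K) x y : (k *: x) ** y = k *: (x ** y).
Proof. by rewrite !kmulE -!/(lext2r _ _ _) linearZ. Qed.

Lemma kmulZr (k : K) x y : x ** (k *: y) = k *: (x ** y).
Proof. by rewrite !kmulE linearZ. Qed.

Lemma kmul0r x : x ** 0 = 0.
Proof. by rewrite kmulE raddf0. Qed.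

Lemma kmul0l x : 0 ** x = 0.
Proof. by rewrite kmulE -!/(lext2r _ _ _) raddf0. Qed.

Lemma kmul_lextr (I : choiceType) (h : I -> KG) x F :
  x ** lext h F = lext (fun i => x ** h i) F.
Proof. by rewrite kmulE lext2_lextr; apply: eq_lext => i; rewrite kmulE. Qed.

Lemma kmul_lextl (I : choiceType) (h : I -> KG) F x :
  lext h F ** x = lext (fun i => h i ** x) F.
Proof. by rewrite kmulE lext2_lext; apply: eq_lext => i; rewrite kmulE. Qed.

Lemma eq_convm S S' T T' : S =1 S' -> T =1 T' -> convm S T =1 convm S' T'.
Proof. by move=> eS eT a; apply: eq_lext => p; rewrite eS eT. Qed.

Lemma convmA S T U a : convm S (convm T U) a = convm (convm S T) U a.
Proof.
pose phi (r : colperm gT * (colperm gT * colperm gT)) :=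
  S r.1 ** (T r.2.1 ** U r.2.2).
have := congr1 (lext phi) (KG_deltaA (<< a >> : KG)).
rewrite kdeltaE lextU /tens_assoc !lext_comp => e.
transitivity (lext (fun p => lext phi (tens << p.1 >> (KG_deltab K p.2))) (KG_deltab K a)).
  apply: eq_lext => p; rewrite /convm kmul_lextr lext_tens lext2Ul.
  by apply: eq_lext => -[q1 q2].
rewrite -e; apply: eq_lext => p; rewrite /convm kmul_lextl lext_tens.
rewrite /lext2 lext_exchange lextU; apply: eq_lext => -[q1 q2] /=.
by rewrite lextU /phi /= KG_mulA.
Qed.

Lemma convm_unitl S a : convm unitm S a = S a.
Proof.
have := congr1 (lext S) (KG_counitl (<< a >> : KG)).
rewrite kdeltaE !lextU lext_comp => <-; apply: eq_lext => p.
by rewrite /unitm kmulZl KG_mul1x linearZ /= lextU.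
Qed.

Lemma convm_unitr S a : convm S unitm a = S a.
Proof.
have := congr1 (lext S) (KG_counitr (<< a >> : KG)).
rewrite kdeltaE !lextU lext_comp => <-; apply: eq_lext => p.
by rewrite /unitm kmulZr KG_mulx1 linearZ /= lextU.
Qed.

Lemma convmBl S S' T a :
  convm (fun b => S b - S' b) T a = convm S T a - convm S' T a.
Proof.
rewrite /convm /lext -sumrB; apply: eq_bigr => p _.
by rewrite kmulBl scalerBr.
Qed.

Lemma convmBr S T T' a :
  convm S (fun b => T b - T' b) a = convm S T a - convm S T' a.
Proof.
rewrite /convm /lext -sumrB; apply: eq_bigr => p _.
by rewrite kmulBr scalerBr.
Qed.

Definition posm a : KG := if tag a == 0%N then 0 else << a >>.

Lemma unitm_posm a : << a >> = unitm a + posm a.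
Proof.
rewrite /unitm /posm /KG_epsb; case: eqP => [a0|_]; last by rewrite scale0r add0r.
rewrite scale1r addr0 /KG_one; congr << _ >>; rewrite -[a]cwK; apply/eqP.
by rewrite cstd_nil /nilp size_cw a0.
Qed.

(** The partial sums of the inverse of id = unit + posm as a geometric series
    1 - posm + posm ^ 2 - ...; they become stationary in each degree since posm
    vanishes in degree 0. *)
Fixpoint geom (k : nat) : colperm gT -> KG :=
  if k is k'.+1 then fun a => unitm a - convm (geom k') posm a else fun=> 0.

Lemma geomS k a : geom k.+1 a = unitm a - convm (geom k) posm a.
Proof. by []. Qed.

Lemma geom_comm k a : convm posm (geom k) a = convm (geom k) posm a.
Proof.
elim: k a => [|k IH] a.
  by rewrite /convm /lext /= !big1 // => p _; rewrite ?kmul0r ?kmul0l scaler0.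
rewrite -[geom k.+1]/(fun b => unitm b - convm (geom k) posm b).
rewrite (convmBr posm unitm) (convmBl unitm).
rewrite (convm_unitl posm) (convm_unitr posm); congr (_ - _).
by rewrite (convmA posm); apply: eq_convm.
Qed.

Lemma convm_ext S S' T T' a :
  (forall i, (i <= tag a)%N ->
     S (cstd (lo i (cw a))) ** T (cstd (hi i (cw a))) =
     S' (cstd (lo i (cw a))) ** T' (cstd (hi i (cw a)))) ->
  convm S T a = convm S' T' a.
Proof.
move=> e; rewrite /convm KG_deltabE !lext_sum; apply: eq_bigr => i _.
by rewrite !lextU /= e // -ltnS.
Qed.

Lemma tag_lo a i : (i <= tag a)%N -> tag (cstd (lo i (cw a))) = i.
Proof. by move=> ia; rewrite tag_cstd (size_lo (size_cw_split ia) (permw_cw a)). Qed.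

Lemma tag_hi a i : (i <= tag a)%N -> tag (cstd (hi i (cw a))) = (tag a - i)%N.
Proof. by move=> ia; rewrite tag_cstd (size_hi (size_cw_split ia) (permw_cw a)). Qed.

Lemma geom_stable k a : (tag a < k)%N -> geom k.+1 a = geom k a.
Proof.
elim: k a => [|k IH] a; first (by rewrite ltn0 => /notF; case).
move=> ak; rewrite (geomS k.+1) (geomS k); congr (_ - _).
apply: convm_ext => i ia; have [ia'|ia'] := ltnP i (tag a).
  by rewrite IH // tag_lo // (leq_trans ia').
by rewrite /posm tag_hi // subn_eq0 ia' !kmul0r.
Qed.

Definition antip a : KG := geom (tag a).+1 a.

Lemma antip_geom k a : (tag a < k)%N -> antip a = geom k a.
Proof.
move=> ak; rewrite -(subnKC ak); elim: (k - _)%N => [|d IH]; first by rewrite addn0.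
by rewrite IH addnS; apply/esym/geom_stable; rewrite leq_addr.
Qed.

Lemma antip_left a : convm antip (fun b => << b >>) a = unitm a.
Proof.
rewrite (convm_ext (S' := geom (tag a).+1) (T' := fun b => << b >>)) => [|i ia].
  rewrite (convm_ext (S' := geom (tag a).+1)
    (T' := fun b => unitm b - (0 - posm b))) => [|i ia]; last first.
    by rewrite sub0r opprK -unitm_posm.
  rewrite convmBr convm_unitr convmBr.
  have -> : convm (geom (tag a).+1) (fun=> 0) a = 0.
    by rewrite /convm /lext big1 // => p _; rewrite kmul0r scaler0.
  rewrite sub0r opprK -{1}(geom_stable (k := (tag a).+1)) // [geom _.+2 a]/=.
  by rewrite -/(geom (tag a).+1) subrK.
by rewrite (antip_geom (k := (tag a).+1)) // tag_lo // ltnS.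
Qed.

Lemma antip_right a : convm (fun b => << b >>) antip a = unitm a.
Proof.
rewrite (convm_ext (S' := fun b => << b >>) (T' := geom (tag a).+1)) => [|i ia].
  rewrite (convm_ext (S' := fun b => unitm b - (0 - posm b))
    (T' := geom (tag a).+1)) => [|i ia]; last first.
    by rewrite sub0r opprK -unitm_posm.
  rewrite convmBl convm_unitl convmBl geom_comm.
  have -> : convm (fun=> 0) (geom (tag a).+1) a = 0.
    by rewrite /convm /lext big1 // => p _; rewrite kmul0l scaler0.
  rewrite sub0r opprK -{1}(geom_stable (k := (tag a).+1)) // [geom _.+2 a]/=.
  by rewrite -/(geom (tag a).+1) subrK.
by rewrite (antip_geom (k := (tag a).+1)) // tag_hi // ltnS leq_subr.
Qed.

(** * The antipode preserves the peak subspace *)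

Lemma homog0_one x : homog 0 x -> x = cf x [::] *: one.
Proof.
move=> hx; apply: cf_ext => w; rewrite cfZ cf_one.
by case: w => [|l w]; rewrite ?mulr1 // mulr0 hx.
Qed.

Lemma homog_eps n x : (0 < n)%N -> homog n x -> cf x [::] = 0.
Proof. by move=> n0 hx; apply: hx; rewrite neq_ltn n0. Qed.

Lemma Peak_subspace : subspace (@Peak K gT).
Proof.
have [p0 pl] := @peak_const_subspace K gT.
split=> [|k x y]; first exact/PeakP.
by rewrite !PeakP; apply: pl.
Qed.

Lemma Peak_one : Peak one.
Proof. exact/PeakP/peak_const_one. Qed.

Lemma Peak_mul x y : Peak x -> Peak y -> Peak (x ** y).
Proof. by rewrite !PeakP; apply: peak_const_mul. Qed.

(** Since id = eps 1 + (id - eps 1), the antipode equation expresses S on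
    degree n through its values in smaller degrees, which is a recursion within
    the peak subspace because of [delta_peak].  As the equation is only required
    there, this applies to the antipode of Sigma(G) as well as to that of the
    peak subspace itself. *)
Lemma antipode_Peak S :
  (forall x, Peak x ->
     lext (fun p => S p.1 ** << p.2 >>) (Delta x) = cf x [::] *: one) ->
  forall x, Peak x -> Peak (lext S x).
Proof.
move=> HS x [n [y [Py ->]]]; rewrite lext_sum.
apply: subspace_sum => [|i _ _]; first exact: Peak_subspace.
move: (nat_of_ord i) (y i) (Py i) => {}n {}x {y Py i}.
elim/ltn_ind: n x => n IH x Px; have [px hx] := (Peak_grP n x).1 Px.
pose Psi p := S p.1 ** (unitm p.2 - << p.2 >>).
have -> : lext S x = lext Psi (Delta x) + cf x [::] *: one.
  rewrite -(HS x (Peak_gr_Peak Px)) -[in LHS](KG_counitr x) lext_comp.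
  rewrite (eq_lext (g := fun p => S p.1 ** unitm p.2)) => [|p].
    rewrite /lext -big_split; apply: eq_bigr => p _ /=.
    by rewrite /Psi kmulBr scalerBr subrK.
  by rewrite linearZ /= lextU /unitm kmulZr KG_mulx1.
apply: subspaceD; first exact: Peak_subspace; last first.
  by apply: subspaceZ; [apply: Peak_subspace | apply: Peak_one].
have sA : subspace (fun t => Peak (lext Psi t)).
  split; first by rewrite raddf0; case: Peak_subspace.
  move=> k s t Ps Pt; rewrite linearP; case: Peak_subspace => _; exact.
apply: (span_min sA) (peak_const2_span (delta_peak px hx)).
move=> _ [i [j [y [z [ijn Py Pz ->]]]]].
have [pz hz] := (Peak_grP j z).1 Pz.
have -> : lext Psi (tens y z) = lext S y ** (cf z [::] *: one - z).
  rewrite lext_tens /lext2 kmul_lextl; apply: eq_lext => a.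
  rewrite kmulBr /Psi /= -heps_cf lextZl -[z in _ - _ ** z]malg_lext.
  by rewrite !kmul_lextr /lext -sumrB; apply: eq_bigr => b _; rewrite kmulBr scalerBr.
(* In degree 0, id - eps 1 vanishes; otherwise y has smaller degree than x. *)
case: j ijn Pz hz => [|j] ijn Pz hz.
  by rewrite -(homog0_one hz) subrr kmul0r; case: Peak_subspace.
apply: Peak_mul; first by apply: (IH i) => //; rewrite -ijn addnS ltnS leq_addr.
apply: subspaceB; first exact: Peak_subspace.
  by apply: subspaceZ; [apply: Peak_subspace | apply: Peak_one].
exact: Peak_gr_Peak Pz.
Qed.

End PeakCoproduct.

(** * Change of colours *)

Section ChangeOfColours.
Context {K : fieldType} {gT gT' : finGroupType} (f : gT -> gT').
Local Notation kmap := (lext (@KG_map K gT gT' f)).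
Local Notation "x ** y" := (kmul x y) (at level 40, left associativity).
Implicit Types (w : seq (nat * gT)) (a b : colperm gT) (x y : {malg K[colperm gT]}).

Definition cmap a : colperm gT' :=
  colp (Wreath (wperm (tagged a)) [ffun i => f (wcol (tagged a) i)]).

Definition map_colours w := [seq (l.1, f l.2) | l <- w].

Lemma cw_cmap a : cw (cmap a) = map_colours (cw a).
Proof.
rewrite /map_colours /cw /coloured_word -map_comp; apply: eq_map => i /=.
by rewrite ffunE.
Qed.

Lemma pat_map_colours w : pat (map_colours w) = [seq (f p.1, p.2) | p <- pat w].
Proof. by elim: w => //= l w IH; rewrite -IH -map_comp. Qed.

Lemma cstd_map_colours w : cstd (map_colours w) = cmap (cstd w).
Proof. by apply/cstd_eq; rewrite cw_cmap !pat_map_colours pat_cstd. Qed.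

Lemma kmapU a : kmap << a >> = << cmap a >>.
Proof. exact: lextU. Qed.

Lemma kmap_mulb a b : kmap (KG_mulb K a b) = KG_mulb K (cmap a) (cmap b).
Proof.
rewrite /KG_mulb lext_sum; apply: eq_bigr => u _; rewrite kmapU.
congr << colp _ >>; apply: wreath_ext => k /=; first by rewrite !permM.
rewrite !(ffunE, mul1g) /=.
by case: (split k) => j; rewrite ?ffunE.
Qed.

Lemma kmap_mul x y : kmap (x ** y) = kmap x ** kmap y.
Proof.
rewrite !kmulE lext_lext2 lext2_lext; apply: eq_lext => a.
by rewrite lext2_lextr; apply: eq_lext => b; rewrite lext2UU kmap_mulb.
Qed.

Lemma lo_map_colours i w : lo i (map_colours w) = map_colours (lo i w).
Proof. by rewrite /lo filter_map. Qed.

Lemma hi_map_colours i w : hi i (map_colours w) = map_colours (hi i w).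
Proof. by rewrite /hi filter_map. Qed.

(** A change of colours does not affect the letters, which alone decide where a
    word is split. *)
Lemma kmap_delta x : kdelta (kmap x) =
  lext (fun p => tens (KG_map K f p.1) (KG_map K f p.2)) (kdelta x).
Proof.
rewrite !kdeltaE !lext_comp; apply: eq_lext => a; rewrite lextU !KG_deltabE lext_sum.
apply: eq_bigr => i _; rewrite lextU /= -/(cmap _) cw_cmap.
rewrite /KG_map -/(cmap _) -/(cmap _) tensUU.
by rewrite lo_map_colours hi_map_colours (cstd_map_colours (lo _ _)) (cstd_map_colours (hi _ _)).
Qed.

Lemma kmap_cf x : cf (kmap x) [::] = cf x [::].
Proof.
rewrite -(heps_cf (kmap x)) -(heps_cf x) lext_comp; apply: (@eq_lext K _ K^o) => a.
by rewrite lextU.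
Qed.

Lemma kmap_one : kmap (KG_one K gT) = KG_one K gT'.
Proof.
rewrite kmapU; congr << _ >>; apply/eqP.
by rewrite -[cmap _]cwK cstd_nil /nilp size_cw.
Qed.

Lemma kmap_homog n x : homog n x -> homog n (kmap x).
Proof.
move=> /homogP hx; apply/homogP => b bn; rewrite mcoeff_lext big1_seq // => a /andP[_ ax].
rewrite mcoeffU; case: eqP => [ab|_]; last by rewrite mulr0.
by rewrite hx ?mul0r //; move: bn; rewrite -ab.
Qed.

End ChangeOfColours.

Section ChangeOfColoursPeak.
Context {K : fieldType}.

Lemma cdat_colour_vee (gT : finGroupType) (v : seq nat) (g : gT) :
  vee g (colour v g) = (mdat is_peak None v == rcons (nseq (size v).-1 false) true).
Proof.
rewrite /vee /pdat cdat_colour size_map /blk.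
rewrite -(map_nseq _ (fun b => (g, b))) -(map_rcons (fun b => (g, b)) _ true).
by apply: inj_eq; apply: inj_map => b b' [].
Qed.

Lemma vee_colours (gT : finGroupType) g (w : seq (nat * gT)) :
  (0 < size w)%N -> vee g w -> w = colour (unzip1 w) g.
Proof.
move=> w0 /eqP e; have : unzip2 w = nseq (size w) g.
  rewrite -(cdat_colours is_peak None) -/(pdat w) e /blk /unzip1 map_rcons map_nseq.
  by rewrite -[in RHS](prednK w0) -[in RHS]addn1 nseqD cats1.
elim: w {w0 e} => //= -[x h] w IH [-> /IH e].
by rewrite /colour /= [in LHS]e.
Qed.

(** The words of a peakless sum have a constant colour, so the set of their
    permutations does not depend on this colour. *)
Lemma qgen_sum (gT : finGroupType) n (g : gT) : (0 < n)%N -> qgen n g =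
  \sum_(s : 'S_n | mdat is_peak None [seq (s i).+1 | i <- enum 'I_n] ==
                   rcons (nseq n.-1 false) true)
    << colp (Wreath s [ffun=> g]) >> :> {malg K[colperm gT]}.
Proof.
move=> n0; apply/malgP => b; rewrite -[LHS]cf_cw cf_qgen // raddf_sum /=.
under eq_bigr do rewrite mcoeffU.
have [tb|tb] := eqVneq (size (cw b)) n; last first.
  rewrite big1 // => s _; case: eqP => // e.
  by rewrite -e size_cw eqxx in tb.
have [{tb}[t h] ->] := colp_cast (etrans (esym (size_cw b)) tb).
rewrite andTb; under eq_bigr do rewrite colp_eq.
pose V (s : 'S_n) := mdat is_peak None [seq (s i).+1 | i <- enum 'I_n] ==
  rcons (nseq n.-1 false) true.
have cwE : h = [ffun=> g] -> cw (colp (Wreath t h)) =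
    colour [seq (t i).+1 | i <- enum 'I_n] g.
  by move=> ->; rewrite /colour -map_comp; apply: eq_map => i /=; rewrite ffunE.
have -> : vee g (cw (colp (Wreath t h))) = V t && (h == [ffun=> g]).
  apply/idP/andP => [vt|[Vt /eqP /cwE->]]; last first.
    by rewrite cdat_colour_vee size_map size_enum_ord.
  have n0' : (0 < size (cw (colp (Wreath t h))))%N by rewrite size_cw.
  have e := vee_colours n0' vt.
  have hg : h = [ffun=> g].
    apply/ffunP => i; rewrite ffunE; have : (wcol (Wreath t h) i) \in
        unzip2 (cw (colp (Wreath t h))) by rewrite cw_colours map_f // mem_enum.
    by rewrite e /unzip2 -map_comp => /mapP[].
  split; last exact/eqP.
  by move: vt; rewrite cwE // cdat_colour_vee size_map size_enum_ord.
rewrite -/(V _) big_mkcond (bigD1 t) //= big1 ?addr0 => [|s st].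
  rewrite -/(V t); case: (V t) => //=; congr (_%:R); congr nat_of_bool.
  by apply/eqP/eqP => [->|[]].
case: ifP => // _; case: eqP => // -[e _].
by rewrite e eqxx in st.
Qed.

Lemma kmap_qgen (gT gT' : finGroupType) (f : gT -> gT') n g : (0 < n)%N ->
  lext (KG_map K f) (qgen n g) = qgen n (f g).
Proof.
move=> n0; rewrite !qgen_sum // lext_sum; apply: eq_bigr => s _.
rewrite kmapU /cmap /=; congr << colp (Wreath _ _) >>.
by apply/ffunP => i; rewrite !ffunE.
Qed.

Lemma kmap_qmon (gT gT' : finGroupType) (f : gT -> gT') c : posc c ->
  lext (KG_map K f) (qmon c) = qmon [seq (i.1, f i.2) | i <- c].
Proof.
elim: c => [|[n g] c IH] /=; first by rewrite kmap_one.
by case/andP=> n0 cp; rewrite kmap_mul kmap_qgen // IH.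
Qed.

(** The image of a general peak sum is not a peak sum, as f may identify the
    colours of neighbouring runs; that it lies in the peak subspace is seen on
    the products of generators. *)
Lemma kmap_Peak_gr (gT gT' : finGroupType) (f : gT -> gT') n x :
  2%:R != 0 :> K -> Peak_gr n x -> Peak_gr n (lext (KG_map K f) x).
Proof.
move=> two_neq0 /Peak_grP[px hx]; apply/Peak_grP; split; last exact: kmap_homog.
have [F <-] := odd_gen_peak two_neq0 px; rewrite /odd_eval lext_comp.
apply: (subspace_sum (@peak_const_subspace K gT')) => m _ _.
apply: (subspaceZ _ (@peak_const_subspace K gT')); rewrite kmap_qmon.
  exact: peak_const_qmon.
by apply: sub_all (oddc_odd_word m) => -[[]].
Qed.

End ChangeOfColoursPeak.

(** * The Hopf algebra of peak classes *)

Section PeakHopf.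
Context {K : fieldType} {gT : finGroupType}.
Local Notation KG := {malg K[colperm gT]}.
Local Notation "x ** y" := (kmul x y) (at level 40, left associativity).
Local Notation Delta := (@kdelta K gT).
Local Notation one := (KG_one K gT).
Implicit Types (W : nat -> KG -> Prop) (x y : KG).

Lemma hmulE W x y : hmul (H := KG_hopf W) x y = x ** y.
Proof. exact/esym/kmulE. Qed.

Lemma hdeltaE W x : hdelta (H := KG_hopf W) x = Delta x.
Proof. exact/esym/kdeltaE. Qed.

Lemma hepsE W x : heps (H := KG_hopf W) x = cf x [::].
Proof. exact: heps_cf. Qed.

Lemma gdirect_Peak_gr : gdirect (@Peak_gr K gT).
Proof.
move=> n y Py y0 i ni; apply: cf_ext => w.
have [wi|wi] := eqVneq (size w) i; last first.
  by case/Peak_grP: (Py i) => _ -> //; rewrite /cf mcoeff0.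
have := congr1 (fun x => cf x w) y0; rewrite cf_sum (bigD1 (Ordinal ni)) //=.
rewrite big1 ?addr0 // => j ji; case/Peak_grP: (Py j) => _ -> //.
by apply: contraNneq ji => wj; apply/eqP/val_inj; rewrite /= -wi wj.
Qed.

Lemma lext_convm S T x : lext (fun p => S p.1 ** T p.2) (Delta x) = lext (convm S T) x.
Proof. by rewrite kdeltaE lext_comp. Qed.

Lemma lext_unitm x : lext (@unitm K gT) x = cf x [::] *: one.
Proof.
rewrite -heps_cf /lext scaler_suml; apply: eq_bigr => a _.
by rewrite /unitm scalerA.
Qed.

Context (two_neq0 : 2%:R != 0 :> K).

Lemma Peak_antip : antipode (H := Peak_hopf K gT) (@antip K gT).
Proof.
move=> x Px; rewrite hdeltaE hepsE.
have left z : lext (fun p => hmul (H := Peak_hopf K gT) (antip p.1) << p.2 >>) (Delta z) =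
    cf z [::] *: one.
  rewrite -lext_unitm -(eq_lext (@antip_left K gT)) -lext_convm.
  by apply: eq_lext => p; rewrite hmulE.
split; [|exact: left|].
  apply: (antipode_Peak two_neq0) Px => z _; rewrite -left.
  by apply: eq_lext => p; rewrite hmulE.
rewrite -lext_unitm -(eq_lext (@antip_right K gT)) -lext_convm.
by apply: eq_lext => p; rewrite hmulE.
Qed.

Lemma Peak_gc_hopf : gc_hopf (Peak_hopf K gT).
Proof.
split.
- move=> n; exact: span_subspace.
- exact: gdirect_Peak_gr.
- by apply/Peak_grP; split; [apply: peak_const_one | apply: homog_one].
- move=> i j x y /Peak_grP[px hx] /Peak_grP[py hy]; rewrite hmulE.
  by apply/Peak_grP; split; [apply: peak_const_mul | apply: homog_mul].
- by move=> x y z _ _ _; rewrite !hmulE KG_mulA.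
- by move=> x _; rewrite hmulE KG_mul1x.
- by move=> x _; rewrite hmulE KG_mulx1.
- move=> n x /Peak_grP[px hx]; rewrite hdeltaE.
  exact/peak_const2_span/delta_peak.
- by move=> x _; rewrite hdeltaE; apply: KG_deltaA.
- by move=> n x n0 /Peak_grP[_ hx]; rewrite hepsE; apply: homog_eps hx.
- by move=> x _; rewrite hdeltaE; apply: KG_counitl.
- by move=> x _; rewrite hdeltaE; apply: KG_counitr.
- by rewrite hdeltaE; apply: KG_delta1.
- by move=> x y _ _; rewrite !hdeltaE hmulE; apply: KG_deltaM.
- by rewrite hepsE cf_one.
- by move=> x y _ _; rewrite !hepsE hmulE; apply: KG_epsM.
- by move=> x /Peak_grP[_ /homog0_one]; exists (cf x [::]).
- by exists (@antip K gT); apply: Peak_antip.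
Qed.

Lemma Peak_subalgebra : subalgebra (H := Sigma_hopf K gT) (@Peak K gT).
Proof.
split; [|exact: Peak_subspace|exact: Peak_one|].
- by move=> x [n [y [Py ->]]]; exists n, y; split=> // i; apply: Peak_Sigma_gr.
- by move=> x y Px Py; rewrite hmulE; apply: Peak_mul.
Qed.

Lemma free_eval_odd_peak F :
  free_eval (H := Sigma_hopf K gT) (odd_peak K (gT := gT)) F = odd_eval F.
Proof.
apply: eq_lext => m; rewrite /odd_word /qmon; elim: (fmonom_val m) => //= i s ->.
exact: hmulE.
Qed.

Lemma Peak_free :
  freely_generated_by (H := Sigma_hopf K gT) (@Peak K gT) (odd_peak K (gT := gT)).
Proof.
split=> [F F'|x]; first by rewrite !free_eval_odd_peak; apply: odd_eval_inj.
rewrite -(odd_genP two_neq0); split=> -[F <-]; exists F => //.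
  exact: free_eval_odd_peak.
exact/esym/free_eval_odd_peak.
Qed.

Lemma Peak_hopf_subalgebra : hopf_subalgebra (H := Sigma_hopf K gT) (@Peak K gT).
Proof.
split; first exact: Peak_subalgebra.
- move=> x [n [y [Py ->]]]; rewrite hdeltaE kdeltaE lext_sum.
  apply: subspace_sum => [|i _ _]; first exact: span_subspace.
  have /Peak_grP[py hy] := Py i; rewrite -kdeltaE.
  have := peak_const2_span (delta_peak two_neq0 py hy).
  apply: span_min => [|t [j [k [u [v [_ Pu Pv ->]]]]]]; first exact: span_subspace.
  by apply: span_gen; exists u, v; split=> //; apply: Peak_gr_Peak; eassumption.
- have [sub _ _ _] := Peak_subalgebra.
  move=> S antS; apply: (antipode_Peak two_neq0) => x /sub/antS[_ e _].
  rewrite hdeltaE hepsE in e; rewrite -e.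
  by apply: eq_lext => p; rewrite hmulE.
Qed.

End PeakHopf.

(** * Functoriality *)

Section Functor.
Context {K : fieldType} (two_neq0 : 2%:R != 0 :> K).

Lemma KG_map_hopf_morphism (gT gT' : finGroupType) (f : gT -> gT') :
  hopf_morphism (H := Peak_hopf K gT) (H' := Peak_hopf K gT') (KG_map K f).
Proof.
split.
- by move=> n x; apply: kmap_Peak_gr.
- exact: kmap_one.
- by move=> x y _ _; rewrite !hmulE kmap_mul.
- by move=> x _; rewrite !hdeltaE kmap_delta.
- by move=> x _; rewrite !hepsE kmap_cf.
Qed.

Lemma Peak_functor : hopf_functor (F := Peak_hopf K) (fun G G' f => KG_map K f).
Proof.
split.
- by move=> G _; apply: Peak_gc_hopf.
- by move=> G G' f _ _ _; apply: KG_map_hopf_morphism.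
- move=> G _ x _; rewrite -[RHS]malg_lext; apply: eq_lext => -[n [s h]].
  rewrite /KG_map; congr << colp (Wreath _ _) >>.
  by apply/ffunP => i; rewrite ffunE.
- move=> G G' G'' f f' _ _ _ _ _ x _; rewrite lext_comp; apply: eq_lext => a.
  rewrite lextU /KG_map; congr << colp (Wreath _ _) >>.
  by apply/ffunP => i; rewrite !ffunE.
Qed.

End Functor.

Theorem theorem4p1 (K : fieldType) (charK : [pchar K]%R =i pred0) :
  (forall gT : finGroupType, abelian [set: gT] ->
     [/\ subalgebra (H := Sigma_hopf K gT) (Peak (gT := gT)),
         freely_generated_by (H := Sigma_hopf K gT)
           (Peak (gT := gT)) (odd_peak K (gT := gT))
       & hopf_subalgebra (H := Sigma_hopf K gT) (Peak (gT := gT))])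
  /\ hopf_functor (F := Peak_hopf K) (fun G G' f => KG_map K f).
Proof.
have two_neq0 : 2%:R != 0 :> K by have := charK 2; rewrite !inE /= => ->.
split=> [gT _|]; last exact: Peak_functor.
by split; [apply: Peak_subalgebra | apply: Peak_free | apply: Peak_hopf_subalgebra].
Qed.
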